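(* Let $A$ be an analytic function in the unit disc $\mathbb{D}$. If $|A(z)|^2(1-|z|^2)^3\,dm(z)$ is a Carleson measure, then all normal solutions $f$ of $f''+Af=0$ in $\mathbb{D}$ belong to the Hardy space $H^p$ for any sufficiently small $0<p<\infty$ (that is, for each normal solution $f$ there is $p_0>0$ such that $f\in H^p$ for all $0<p<p_0$).
   Context: $dm$ denotes Lebesgue area measure on the unit disc $\mathbb{D}\subset\mathbb{C}$. For $0<p<\infty$, $H^p$ consists of the analytic functions $f$ in $\mathbb{D}$ with $$\|f\|_{H^p}=\lim_{r\to1^-}\left(\frac1{2\pi}\int_0^{2\pi}|f(re^{i\theta})|^p\,d\theta\right)^{1/p}<\infty.$$ A positive Borel measure $\mu$ on $\mathbb{D}$ is a Carleson measure if for $0<p<\infty$ there is a positive constant $C$ with $\int_{\mathbb{D}}|f|^p\,d\mu\le C\|f\|_{H^p}^p$ for all $f\in H^p$; equivalently, $\sup_{a\in\mathbb{D}}\int_{\mathbb{D}}\frac{1-|a|^2}{|1-\overline{a}z|^2}\,d\mu(z)<\infty$. A meromorphic function $f$ in $\mathbb{D}$ is normal if $$\sigma(f)=\sup_{z\in\mathbb{D}}(1-|z|^2)\frac{|f'(z)|}{1+|f(z)|^2}<\infty.$$ Solutions $f$ are analytic functions in $\mathbb{D}$. *)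

(* Defs.v *)
(* MathComp / MathComp-Analysis.  [R] is an arbitrary model of the real numbers
   and [R[i]] its field of complex numbers.  Functions on the unit disc are
   total functions [R[i] -> R[i]] whose values outside the disc are never
   used; [R[i]^o] is [R[i]] seen as a normed space over itself, so that
   [derivable _ z 1] and [derive1] are the complex notions. *)
From HB Require Import structures.
From mathcomp Require Import all_boot all_order all_algebra.
From mathcomp Require Import all_classical all_reals all_analysis.
From mathcomp Require Import complex.

Set Implicit Arguments.
Unset Strict Implicit.
Unset Printing Implicit Defensive.

Import Order.TTheory GRing.Theory Num.Theory.
Import numFieldNormedType.Exports.

Local Open Scope classical_set_scope.
Local Open Scope ring_scope.
Local Open Scope complex_scope.

(* The real-valued modulus; the library's [`|z|] lives in [R[i]]. *)
Definition cabs (R : realType) (z : R[i]) : R := ComplexField.Normc.normc z.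

Definition unit_disc (R : realType) : set R[i] := [set z | cabs z < 1].
Arguments unit_disc R : clear implicits.

Definition analytic_disc (R : realType) (f : R[i]^o -> R[i]^o) : Prop :=
  forall z : R[i]^o, unit_disc R z -> derivable f z 1.

Definition cexpi (R : realType) (t : R) : R[i] := cos t +i* sin t.

(* [R[i]] carries no measurable structure, so measures on the complex plane live
   on [R * R] with its Borel sigma-algebra, identified with [R[i]] by [cpx]. *)
Notation plane R := (measurableTypeR R * measurableTypeR R)%type.

Definition cpx (R : realType) (w : plane R) : R[i] := w.1 +i* w.2.

Definition plane_disc (R : realType) : set (plane R) :=
  [set w | unit_disc R (cpx w)].
Arguments plane_disc R : clear implicits.

Definition area (R : realType) : {measure set (plane R) -> \bar R} :=
  (lebesgue_measure \x lebesgue_measure)%E.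
Arguments area R : clear implicits.

Definition circle_mean (R : realType) (p : R) (f : R[i] -> R[i]) (r : R) :
    \bar R :=
  ((((2 * pi)^-1)%R%:E *
    \int[lebesgue_measure]_(t in [set` `[0%R, (2 * pi)%R]])
      (cabs (f (r%:C * cexpi t)) `^ p)%:E) `^ p^-1)%E.

Definition hardy_norm (R : realType) (p : R) (f : R[i] -> R[i]) : \bar R :=
  lim (circle_mean p f r @[r --> (1 : R)^'-]).

(* [lim] takes a default value when there is no limit, whence the explicit
   convergence clause (in the extended reals). *)
Definition hardy (R : realType) (p : R) (f : R[i] -> R[i]) : Prop :=
  [/\ analytic_disc f,
      cvg (circle_mean p f r @[r --> (1 : R)^'-]) &
      (hardy_norm p f < +oo)%E].

Definition carleson (R : realType) (mu : {measure set (plane R) -> \bar R}) :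
    Prop :=
  forall p : R, 0 < p -> exists2 C : R, 0 < C &
    forall f : R[i] -> R[i], hardy p f ->
      (\int[mu]_(w in plane_disc R) (cabs (f (cpx w)) `^ p)%:E
         <= C%:E * hardy_norm p f `^ p)%E.

(* [mu] is the measure [g dm] on the unit disc, extended by 0 to the plane. *)
Definition has_disc_density (R : realType)
    (mu : {measure set (plane R) -> \bar R}) (g : R[i] -> R) : Prop :=
  forall S : set (plane R), measurable S ->
    mu S = (\int[area R]_(w in S `&` plane_disc R) (g (cpx w))%:E)%E.

(* The supremum sigma(f), for analytic f. *)
Definition normal_sup (R : realType) (f : R[i]^o -> R[i]^o) : \bar R :=
  ereal_sup [set ((1 - cabs z ^+ 2) * (cabs (derive1 f z)
                   / (1 + cabs (f z) ^+ 2)))%:E | z in unit_disc R].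

Definition normal_function (R : realType) (f : R[i] -> R[i]) : Prop :=
  (normal_sup f < +oo)%E.

(* The derivability of [derive1 f] makes [derive1 (derive1 f)] a genuine
   second derivative. *)
Definition ode_solution (R : realType) (A f : R[i]^o -> R[i]^o) : Prop :=
  [/\ analytic_disc f, analytic_disc (derive1 f) &
      forall z, unit_disc R z -> derive1 (derive1 f) z + A z * f z = 0].

(* Main.v *)
Require Import Defs.
From HB Require Import structures.
From mathcomp Require Import all_boot all_order all_algebra.
From mathcomp Require Import all_classical all_reals all_analysis.
From mathcomp Require Import complex.
From mathcomp Require Import measurable_realfun ring lra.

(** Write [z = e^(x + i t)], [x < 0], and let [F], [G] be [f] and its derivative
    in the variable [x + i t], so that the equation becomes [F'' = G - B F] with
    [B = z^2 A].  The claim is that the means of [w = (1 + |F|^2)^q] over the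
    circles [x = X] stay bounded as [X] increases to [0], for [q = p / 2] small.

    The Laplacian of [w] is at most [8 q w N], where [N = |G|^2 / (1 + |F|^2)];
    with [y = X - x], the function [y N] has to be absorbed.  Two fields do this.
    The first is [w V], with
      [V = - E(T) e_x + (y g(T) / 2) grad log (1 + |F|^2)],  [T = y^2 N],
    where [E] and [g] are chosen so that the divergence of [w V] is at least
    [w (c y N - C y^3 |B|^2)]; this uses that [T] is bounded
    ([field_div_ge], [has_div_field]).  The second disposes of [y^3 |B|^2]: the
    Carleson measure has a bounded potential [phi] whose Laplacian is at least a
    multiple of [y^2 |B|^2] ([phi_bounds], [philap_ge]), so the Laplacian of
    [u = e^phi w] is at least [u] times it.  With suitable constants the field
      [y grad w + w e_x - alpha w V - beta (y grad u + u e_x)]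
    has nonpositive divergence ([main_field]).  On [x = X] its [x]-component is
    [w - beta u >= w / 2], and on a fixed inner circle it is bounded uniformly in
    [X]; the divergence theorem bounds the means of [w] ([circle_bound]).

    That [T] is bounded says that [(1 - |z|) |f'| <= L (1 + |f|^2)^(1/2)], and is
    where normality enters ([derive_growth]).  The Carleson condition gives
    [|A(z)| (1 - |z|)^2 <= K] ([coefficient_bound]).  If [|f'|] were too large at
    a point where [|f| > 1], the equation would keep [f'] nearly constant on a disc
    around it that is small compared with the distance to the circle and contains
    points where [f] is nearly zero; but [1 / (1 + |f|^2)] is Lipschitz for the
    hyperbolic distance because [f] is normal.

    The circle means of [|f|^p] increase with the radius ([pmean_monotone]), so
    their boundedness gives the limit required by the Hardy norm.

    The solution and its derivative are complex differentiable, which makes the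
    fields above differentiable at each point; the divergence theorem for such
    fields is proved as an inequality, by Goursat's subdivision ([flux_le0]).  The
    mean value property of analytic functions is a case of it ([mean_value]).
    Means over discs follow from means over circles by rotation invariance of the area
    ([area_sub_mean]), and the potential is differentiated under the integral
    sign ([has_grad_integral]). *)

Set Implicit Arguments.
Unset Strict Implicit.
Unset Printing Implicit Defensive.

Import Order.TTheory GRing.Theory Num.Theory.
Import numFieldNormedType.Exports.

Local Open Scope classical_set_scope.
Local Open Scope ring_scope.
Local Open Scope complex_scope.

Local Notation Re := complex.Re.
Local Notation Im := complex.Im.

(** * Differentiability in two real variables *)

Lemma eq_le_refl (F : numDomainType) (x y : F) : x = y -> x <= y.
Proof. by move=> ->. Qed.

Lemma le_opp_eq (F : numDomainType) (x y x' y' : F) :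
  x' = - x -> y' = - y -> y' <= x' -> x <= y.
Proof. by move=> -> ->; rewrite lerN2. Qed.

Section segment_integral.
Context {R : realType}.
Implicit Types (a b m c : R) (f g : R -> R).

Definition cint a b f : R := \int[lebesgue_measure]_(t in `[a, b]) f t.

Definition ccont a b f := {within `[a, b], continuous f}.

Lemma ccontP a b f : {in `[a, b], forall t, {for t, continuous f}} -> ccont a b f.
Proof.
move=> h; apply: continuous_in_subspaceT => t; rewrite inE/= => tab.
exact: h.
Qed.

Lemma ccont_int a b f : ccont a b f ->
  lebesgue_measure.-integrable `[a, b] (EFin \o f).
Proof.
move=> cf; apply: continuous_compact_integrable => //; exact: segment_compact.
Qed.

Lemma cint_cst a b c : a <= b -> cint a b (fun _ => c) = c * (b - a).
Proof.
move=> ab; rewrite /cint Rintegral_cst//= lebesgue_measure_itv/= lte_fin.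
by case: ltgtP ab => // ->; rewrite subrr.
Qed.

Lemma cintB a b f g : ccont a b f -> ccont a b g ->
  cint a b (fun t => f t - g t) = cint a b f - cint a b g.
Proof. by move=> cf cg; rewrite /cint RintegralB//; exact: ccont_int. Qed.

Lemma cintD a b f g : ccont a b f -> ccont a b g ->
  cint a b (fun t => f t + g t) = cint a b f + cint a b g.
Proof. by move=> cf cg; rewrite /cint RintegralD//; exact: ccont_int. Qed.

Lemma cintZ a b c f : ccont a b f ->
  cint a b (fun t => c * f t) = c * cint a b f.
Proof. by move=> cf; rewrite /cint RintegralZl//; exact: ccont_int. Qed.

Lemma cint_le a b f g : ccont a b f -> ccont a b g ->
  {in `[a, b], forall t, f t <= g t} -> cint a b f <= cint a b g.
Proof.
move=> cf cg fg; rewrite /cint le_Rintegral//; try exact: ccont_int.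
Qed.

Lemma ccont_cst a b c : ccont a b (fun _ => c).
Proof. by apply: ccontP => t _; exact: cst_continuous. Qed.

Lemma cint_split a m b f : a <= m -> m <= b -> ccont a b f ->
  cint a b f = cint a m f + cint m b f.
Proof.
move=> am mb cf; have If := ccont_int cf.
have := @Rintegral_itvB R f (BLeft a) (BRight b) m If.
rewrite !bnd_simp => /(_ am mb) => /eqP; rewrite subr_eq => /eqP.
rewrite /cint => ->; rewrite addrC; congr (_ + _).
rewrite Rintegral_itv_obnd_cbnd//.
apply: integrableS If => //; apply: subset_itv; rewrite ?bnd_simp//.
Qed.

End segment_integral.

Section uniform_gradient.
Context {R : realType} {W : Type}.
Implicit Types (E : set W) (u v : W -> R -> R -> R) (ux ut vx vt : W -> R).

(** The bounds and the error term are uniform over the parameters in [E]: this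
    is what survives integration over the parameter. *)
Definition ugrad E u x t ux ut :=
  (exists2 M, 0 < M & forall w, E w -> [/\ `|u w x t| <= M, `|ux w| <= M & `|ut w| <= M]) /\
  forall e, 0 < e -> exists2 d, 0 < d & forall w h k, E w -> `|h| < d -> `|k| < d ->
    `|u w (x + h) (t + k) - u w x t - ux w * h - ut w * k| <= e * (`|h| + `|k|).

Lemma ugrad_eq E u x t ux ut ux' ut' : ugrad E u x t ux ut ->
  (forall w, E w -> ux w = ux' w) -> (forall w, E w -> ut w = ut' w) ->
  ugrad E u x t ux' ut'.
Proof.
move=> [[M M0 hM] H] h1 h2; split.
  by exists M => // w Ew; rewrite -h1// -h2//; exact: hM.
move=> e e0; have [d d0 {}H] := H e e0; exists d => // w h k Ew hd kd.
by rewrite -h1// -h2//; exact: H.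
Qed.

Lemma ugrad_cst E (c : W -> R) x t M : 0 < M -> (forall w, E w -> `|c w| <= M) ->
  ugrad E (fun w _ _ => c w) x t (fun _ => 0) (fun _ => 0).
Proof.
move=> M0 hM; split.
  by exists M => // w Ew; split; [exact: hM|rewrite normr0 ltW..].
move=> e e0; exists 1 => // w h k _ _ _.
by rewrite !mul0r !subr0 subrr normr0 mulr_ge0 ?addr_ge0 ?(ltW e0).
Qed.

Lemma ugrad_lip E u x t ux ut : ugrad E u x t ux ut ->
  exists M, [/\ 0 < M, forall w, E w -> [/\ `|u w x t| <= M, `|ux w| <= M & `|ut w| <= M] &
    exists2 d, 0 < d & forall w h k, E w -> `|h| < d -> `|k| < d ->
    `|u w (x + h) (t + k) - u w x t| <= M * (`|h| + `|k|)].
Proof.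
move=> [[M M0 hM] /(_ 1 ltr01)[d d0 H]].
exists (1 + 2 * M); split; first by lra.
  by move=> w /hM[h1 h2 h3]; split; lra.
exists d => // w h k Ew hd kd; have [h1 h2 h3] := hM _ Ew.
have := H w h k Ew hd kd; rewrite mul1r => H1.
rewrite (_ : u w (x + h) (t + k) - u w x t =
  (u w (x + h) (t + k) - u w x t - ux w * h - ut w * k) + ux w * h + ut w * k); last by ring.
apply: (le_trans (ler_normD _ _)).
apply: (le_trans (lerD (ler_normD _ _) (lexx _))).
rewrite !normrM; have h0 := normr_ge0 h; have k0 := normr_ge0 k.
have a1 := ler_wpM2r h0 h2; have a2 := ler_wpM2r k0 h3; nra.
Qed.

Lemma ugradD E u v x t ux ut vx vt : ugrad E u x t ux ut ->
  ugrad E v x t vx vt ->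
  ugrad E (fun w x t => u w x t + v w x t) x t
    (fun w => ux w + vx w) (fun w => ut w + vt w).
Proof.
move=> [[M1 M10 hM1] hu] [[M2 M20 hM2] hv]; split.
  exists (M1 + M2); first exact: addr_gt0.
  move=> w Ew; have [a1 a2 a3] := hM1 w Ew; have [b1 b2 b3] := hM2 w Ew.
  by split; apply: (le_trans (ler_normD _ _)); apply: lerD.
move=> e e0; have e20 : 0 < e / 2 by rewrite divr_gt0.
have [d1 d10 H1] := hu _ e20; have [d2 d20 H2] := hv _ e20.
exists (Num.min d1 d2); first by rewrite lt_min d10 d20.
move=> w h k Ew; rewrite !lt_min => /andP[h1 h2] /andP[k1 k2].
rewrite (_ : _ - _ = (u w (x + h) (t + k) - u w x t - ux w * h - ut w * k) +
 (v w (x + h) (t + k) - v w x t - vx w * h - vt w * k)); last by ring.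
apply: (le_trans (ler_normD _ _)); apply: le_trans (lerD (H1 _ _ _ Ew h1 k1) (H2 _ _ _ Ew h2 k2)) _.
lra.
Qed.

Lemma ugradM E u v x t ux ut vx vt : ugrad E u x t ux ut ->
  ugrad E v x t vx vt ->
  ugrad E (fun w x t => u w x t * v w x t) x t
    (fun w => ux w * v w x t + u w x t * vx w)
    (fun w => ut w * v w x t + u w x t * vt w).
Proof.
move=> hu hv.
have [Mu [Mu0 hMu [d1 d10 L1]]] := ugrad_lip hu.
have [Mv [Mv0 hMv [d2 d20 L2]]] := ugrad_lip hv.
have MM0 : 0 < Mu * Mv by exact: mulr_gt0.
split.
  exists (2 * (Mu * Mv)); first by rewrite mulr_gt0.
  move=> w Ew; have [a1 a2 a3] := hMu w Ew; have [b1 b2 b3] := hMv w Ew.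
  have E2 : 2 * (Mu * Mv) = Mu * Mv + Mu * Mv by ring.
  split; last 2 first.
  - rewrite E2; apply: (le_trans (ler_normD _ _)); rewrite !normrM.
    by apply: lerD; apply: ler_pM.
  - rewrite E2; apply: (le_trans (ler_normD _ _)); rewrite !normrM.
    by apply: lerD; apply: ler_pM.
  rewrite normrM; apply: (@le_trans _ _ (Mu * Mv)); first by apply: ler_pM.
  by rewrite E2 lerDl ltW.
move=> e e0.
have e10 : 0 < e / (4 * Mv) by rewrite divr_gt0// mulr_gt0.
have e20 : 0 < e / (4 * Mu) by rewrite divr_gt0// mulr_gt0.
have [d3 d30 H1] := hu.2 _ e10; have [d4 d40 H2] := hv.2 _ e20.
pose d5 := e / (8 * (Mu * Mv)).
have d50 : 0 < d5 by rewrite divr_gt0// !mulr_gt0.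
exists (Num.min (Num.min d1 d2) (Num.min (Num.min d3 d4) d5)).
  by rewrite !lt_min d10 d20 d30 d40 d50.
move=> w h k Ew; rewrite !lt_min => /andP[/andP[h1 h2] /andP[/andP[h3 h4] h5]].
move=> /andP[/andP[k1 k2] /andP[/andP[k3 k4] k5]].
have [a1 a2 a3] := hMu w Ew; have [b1 b2 b3] := hMv w Ew.
have {}L1 := L1 _ _ _ Ew h1 k1; have {}L2 := L2 _ _ _ Ew h2 k2.
have {}H1 := H1 _ _ _ Ew h3 k3; have {}H2 := H2 _ _ _ Ew h4 k4.
set S := `|h| + `|k| in L1 L2 H1 H2 *.
have S0 : 0 <= S by rewrite addr_ge0.
set U1 := u w (x + h) (t + k) in L1 H1 *; set V1 := v w (x + h) (t + k) in L2 H2 *.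
rewrite (_ : _ - _ = (U1 - u w x t - ux w * h - ut w * k) * v w x t +
 u w x t * (V1 - v w x t - vx w * h - vt w * k) +
 (U1 - u w x t) * (V1 - v w x t)); last by ring.
apply: (le_trans (ler_normD _ _)).
apply: (le_trans (lerD (ler_normD _ _) (lexx _))).
rewrite !normrM.
have A1 : `|U1 - u w x t - ux w * h - ut w * k| * `|v w x t| <= e / 4 * S.
  apply: (le_trans (ler_pM _ _ H1 b1)) => //.
  by apply: eq_le_refl; field; rewrite gt_eqF.
have A2 : `|u w x t| * `|V1 - v w x t - vx w * h - vt w * k| <= e / 4 * S.
  apply: (le_trans (ler_pM _ _ a1 H2)) => //.
  by apply: eq_le_refl; field; rewrite gt_eqF.
have A3 : `|U1 - u w x t| * `|V1 - v w x t| <= e / 4 * S.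
  apply: (le_trans (ler_pM _ _ L1 L2)) => //.
  have : S <= 2 * d5 by rewrite /S; lra.
  move=> /(ler_wpM2l (mulr_ge0 (mulr_ge0 (ltW Mu0) (ltW Mv0)) S0)).
  rewrite (_ : _ * (2 * d5) = e / 4 * S); last first.
    by rewrite /d5; field; rewrite !gt_eqF.
  by move=> A; apply: le_trans A; apply: eq_le_refl; ring.
have : 0 <= e / 4 * S by rewrite mulr_ge0// divr_ge0// ltW.
lra.
Qed.

Lemma ugradV E u x t ux ut m : 0 < m -> (forall w, E w -> m <= `|u w x t|) ->
  ugrad E u x t ux ut ->
  ugrad E (fun w x t => (u w x t)^-1) x t
    (fun w => - ux w / u w x t ^+ 2) (fun w => - ut w / u w x t ^+ 2).
Proof.
move=> m0 hm hu.
have [M [M0 hM [d1 d10 L]]] := ugrad_lip hu.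
have m20 : 0 < m ^+ 2 by rewrite exprn_gt0.
have sqm w : E w -> m ^+ 2 <= u w x t ^+ 2.
  move=> Ew; rewrite -(real_normK (num_real (u w x t))).
  by rewrite ler_sqr ?nnegrE ?(ltW m0)// hm.
split.
  exists (m^-1 + M / m ^+ 2); first by rewrite addr_gt0 ?invr_gt0 ?divr_gt0.
  move=> w Ew; have [a1 a2 a3] := hM w Ew; have um := hm w Ew.
  have um0 : 0 < `|u w x t| by exact: lt_le_trans um.
  have q : `|u w x t ^+ 2|^-1 <= (m ^+ 2)^-1.
    rewrite lef_pV2 ?posrE// ?normr_gt0 ?expf_neq0 -?normr_gt0//.
    by rewrite ger0_norm ?sqr_ge0// sqm.
  have p1 : 0 < m^-1 by rewrite invr_gt0.
  have p2 : 0 < M / m ^+ 2 by rewrite divr_gt0.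
  split.
  - rewrite normfV; apply: (@le_trans _ _ m^-1); last by rewrite lerDl ltW.
    by rewrite lef_pV2 ?posrE.
  - rewrite normrM normrN normfV; apply: (@le_trans _ _ (M / m ^+ 2)).
      by apply: ler_pM => //; rewrite invr_ge0.
    by rewrite lerDr ltW.
  - rewrite normrM normrN normfV; apply: (@le_trans _ _ (M / m ^+ 2)).
      by apply: ler_pM => //; rewrite invr_ge0.
    by rewrite lerDr ltW.
move=> e e0.
have e10 : 0 < e * m ^+ 2 / 2 by rewrite divr_gt0// mulr_gt0.
have [d2 d20 H] := hu.2 _ e10.
pose d3 := m / (4 * M); pose d4 := e * (m ^+ 2 * m) / (8 * M ^+ 2).
have d30 : 0 < d3 by rewrite divr_gt0// mulr_gt0.
have d40 : 0 < d4 by rewrite divr_gt0// !mulr_gt0 ?exprn_gt0.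
exists (Num.min (Num.min d1 d2) (Num.min d3 d4)); first by rewrite !lt_min d10 d20 d30 d40.
move=> w h k Ew; rewrite !lt_min => /andP[/andP[h1 h2] /andP[h3 h4]].
move=> /andP[/andP[k1 k2] /andP[k3 k4]].
have {}L := L _ _ _ Ew h1 k1; have {}H := H _ _ _ Ew h2 k2.
have um := hm w Ew; have sq := sqm w Ew.
set S := `|h| + `|k| in L H *.
have S0 : 0 <= S by rewrite addr_ge0.
set u1 := u w (x + h) (t + k) in L H *; set u0 := u w x t in L H um sq *.
have dist : `|u1 - u0| <= m / 2.
  apply: (le_trans L); have : S <= 2 * d3 by rewrite /S; lra.
  move=> /(ler_wpM2l (ltW M0)) /le_trans; apply.
  by apply: eq_le_refl; rewrite /d3; field; rewrite gt_eqF.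
have u1m : m / 2 <= `|u1|.
  have := ler_normD (u0 - u1) u1; rewrite subrK distrC => K; lra.
have u1n0 : u1 != 0 by rewrite -normr_gt0; apply: lt_le_trans u1m; rewrite divr_gt0.
have u0n0 : u0 != 0 by rewrite -normr_gt0; apply: lt_le_trans um.
rewrite (_ : _ - _ = (u1 - u0) ^+ 2 / (u0 ^+ 2 * u1) -
  (u1 - u0 - ux w * h - ut w * k) / u0 ^+ 2); last by field; rewrite u1n0 u0n0.
apply: (le_trans (ler_normB _ _)).
have n0 : 0 < `|u0 ^+ 2| by rewrite normr_gt0 expf_neq0.
have n0E : `|u0 ^+ 2| = u0 ^+ 2 by rewrite ger0_norm ?sqr_ge0.
have A1 : `|(u1 - u0) ^+ 2 / (u0 ^+ 2 * u1)| <= e / 2 * S.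
  rewrite normrM normfV ler_pdivrMr; last by rewrite normr_gt0 mulf_neq0// expf_neq0.
  rewrite [`|u0 ^+ 2 * u1|]normrM n0E.
  have -> : `|(u1 - u0) ^+ 2| = `|u1 - u0| * `|u1 - u0| by rewrite expr2 normrM.
  apply: (@le_trans _ _ (M * S * (M * (2 * d4)))).
    apply: ler_pM => //; apply: (le_trans L).
    by rewrite ler_wpM2l ?(ltW M0)// /S; lra.
  apply: (@le_trans _ _ (e / 2 * S * (m ^+ 2 * (m / 2)))); last first.
    apply: ler_wpM2l; first by rewrite mulr_ge0// divr_ge0// ltW.
    by apply: ler_pM => //; [exact: ltW|rewrite divr_ge0// ltW].
  by apply: eq_le_refl; rewrite /d4; field; rewrite gt_eqF.
have A2 : `|(u1 - u0 - ux w * h - ut w * k) / u0 ^+ 2| <= e / 2 * S.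
  rewrite normrM normfV ler_pdivrMr//; apply: (le_trans H); rewrite n0E.
  rewrite (_ : e * m ^+ 2 / 2 * S = e / 2 * S * m ^+ 2); last by field.
  by apply: ler_wpM2l => //; rewrite mulr_ge0// divr_ge0// ltW.
lra.
Qed.

End uniform_gradient.

Section gradient.
Context {R : realType}.
Implicit Types (u v : R -> R -> R).

(** Frechet differentiability at a point, which is what complex
    differentiability of a solution and of its derivative provides. *)
Definition has_grad u (x t ux ut : R) := forall e, 0 < e ->
  exists2 d, 0 < d & forall h k, `|h| < d -> `|k| < d ->
    `|u (x + h) (t + k) - u x t - ux * h - ut * k| <= e * (`|h| + `|k|).

Lemma has_grad_eq u x t ux ut ux' ut' : has_grad u x t ux ut ->
  ux = ux' -> ut = ut' -> has_grad u x t ux' ut'.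
Proof. by move=> h <- <-. Qed.

Lemma has_grad_near u v x t ux ut e : 0 < e ->
  (forall h k, `|h| < e -> `|k| < e -> v (x + h) (t + k) = u (x + h) (t + k)) ->
  has_grad u x t ux ut -> has_grad v x t ux ut.
Proof.
move=> e0 uv hu r r0; have [d d0 hd] := hu r r0.
exists (Num.min d e); first by rewrite lt_min d0 e0.
move=> h k; rewrite !lt_min => /andP[hd' he] /andP[kd ke].
have := uv 0 0; rewrite !normr0 !addr0 => /(_ e0 e0) ->.
by rewrite uv// hd.
Qed.

Lemma has_grad_cst c x t : has_grad (fun _ _ => c) x t 0 0.
Proof.
move=> e e0; exists 1 => // h k _ _.
by rewrite !mul0r !subr0 subrr normr0 mulr_ge0 ?addr_ge0 ?(ltW e0).
Qed.

Lemma has_grad_fst x t : has_grad (fun x _ => x) x t 1 0.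
Proof.
move=> e e0; exists 1 => // h k _ _.
rewrite (_ : _ - _ = 0); last by ring.
by rewrite normr0 mulr_ge0 ?addr_ge0 ?(ltW e0).
Qed.

Lemma has_grad_snd x t : has_grad (fun _ t => t) x t 0 1.
Proof.
move=> e e0; exists 1 => // h k _ _.
rewrite (_ : _ - _ = 0); last by ring.
by rewrite normr0 mulr_ge0 ?addr_ge0 ?(ltW e0).
Qed.

(** A single function is a family over one parameter, so the rules for sums,
    products and inverses are inherited from the uniform ones. *)
Lemma has_grad_ugrad {W : Type} (E : set W) u x t ux ut : has_grad u x t ux ut ->
  ugrad E (fun _ => u) x t (fun _ => ux) (fun _ => ut).
Proof.
move=> hu; split.
  exists (1 + `|u x t| + `|ux| + `|ut|); first by rewrite !ltr_wpDr.
  have := normr_ge0 (u x t); have := normr_ge0 ux; have := normr_ge0 ut.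
  by move=> ? ? ? w _; split; lra.
by move=> e /hu[d d0 H]; exists d => // w h k _; exact: H.
Qed.

Lemma ugrad_has_grad {W : Type} (E : set W) (u : W -> R -> R -> R) x t
    (ux ut : W -> R) w : E w ->
  ugrad E u x t ux ut -> has_grad (u w) x t (ux w) (ut w).
Proof. by move=> Ew [_ H] e /H[d d0 {}H]; exists d => // h k; exact: H. Qed.

Lemma has_grad_lip u x t ux ut : has_grad u x t ux ut ->
  exists2 M, 0 < M & exists2 d, 0 < d & forall h k, `|h| < d -> `|k| < d ->
    `|u (x + h) (t + k) - u x t| <= M * (`|h| + `|k|).
Proof.
move=> /(has_grad_ugrad [set: unit]) /ugrad_lip[M [M0 _ [d d0 H]]].
by exists M => //; exists d => // h k; exact: (H tt).
Qed.

Lemma has_gradD u v x t ux ut vx vt : has_grad u x t ux ut ->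
  has_grad v x t vx vt ->
  has_grad (fun x t => u x t + v x t) x t (ux + vx) (ut + vt).
Proof.
move=> /(has_grad_ugrad [set: unit]) hu /(has_grad_ugrad [set: unit]) hv.
exact: (ugrad_has_grad (w := tt) I (ugradD hu hv)).
Qed.

Lemma has_gradM u v x t ux ut vx vt : has_grad u x t ux ut ->
  has_grad v x t vx vt ->
  has_grad (fun x t => u x t * v x t) x t
    (ux * v x t + u x t * vx) (ut * v x t + u x t * vt).
Proof.
move=> /(has_grad_ugrad [set: unit]) hu /(has_grad_ugrad [set: unit]) hv.
exact: (ugrad_has_grad (w := tt) I (ugradM hu hv)).
Qed.

Lemma is_derive_lin (f : R -> R) (a df : R) : is_derive a 1 f df ->
  forall e, 0 < e -> exists2 d, 0 < d &
    forall s, `|s| < d -> `|f (a + s) - f a - df * s| <= e * `|s|.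
Proof.
move=> [fd fE] e e0; move: fd; rewrite /derivable => /cvg_ex[l fl].
have <- : l = df by rewrite -fE; apply/esym/cvg_lim.
move/cvgrPdist_le : fl => /(_ e e0) /nbhs_ballP[d/= d0 hd].
exists d => // s sd; have [->|s0] := eqVneq s 0.
  by rewrite addr0 subrr mulr0 subr0 normr0 mulr0.
have := hd s; rewrite /ball/= sub0r normrN => /(_ sd s0).
rewrite [s *: 1]mulr1 (addrC s) distrC.
move=> /(ler_wpM2r (normr_ge0 s)); rewrite -normrM mulrBl.
by rewrite [_ *: _ * _]mulrAC mulVf// mul1r.
Qed.

Lemma has_grad_comp (f : R -> R) u x t ux ut df : has_grad u x t ux ut ->
  is_derive (u x t) 1 f df ->
  has_grad (fun x t => f (u x t)) x t (df * ux) (df * ut).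
Proof.
move=> hu /is_derive_lin hf e e0.
have [Mu Mu0 [d1 d10 L1]] := has_grad_lip hu.
have e10 : 0 < e / (2 * Mu) by rewrite divr_gt0// mulr_gt0.
have [d2 d20 H2] := hf _ e10.
have e20 : 0 < e / (2 * (1 + `|df|)) by rewrite divr_gt0// mulr_gt0// ltr_wpDr.
have [d3 d30 H3] := hu _ e20.
pose d4 := d2 / (2 * Mu).
have d40 : 0 < d4 by rewrite divr_gt0// mulr_gt0.
exists (Num.min (Num.min d1 d3) d4); first by rewrite !lt_min d10 d30 d40.
move=> h k; rewrite !lt_min => /andP[/andP[h1 h3] h4] /andP[/andP[k1 k3] k4].
have {}L1 := L1 _ _ h1 k1; have {}H3 := H3 _ _ h3 k3.
set S := `|h| + `|k| in L1 H3 *.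
have S0 : 0 <= S by rewrite addr_ge0.
set U1 := u (x + h) (t + k) in L1 H3 *.
have Us : `|U1 - u x t| < d2.
  apply: le_lt_trans L1 _; have : S < 2 * d4 by rewrite /S; lra.
  rewrite -(ltr_pM2l Mu0) => /lt_le_trans; apply.
  by apply: eq_le_refl; rewrite /d4; field; rewrite gt_eqF.
have {}H2 := H2 _ Us; rewrite [u x t + _]addrC subrK in H2.
rewrite (_ : _ - _ = (f U1 - f (u x t) - df * (U1 - u x t)) +
  df * (U1 - u x t - ux * h - ut * k)); last by ring.
apply: (le_trans (ler_normD _ _)); rewrite normrM.
have A1 : e / (2 * Mu) * `|U1 - u x t| <= e / 2 * S.
  apply: (le_trans (ler_wpM2l (ltW e10) L1)).
  by apply: eq_le_refl; field; rewrite gt_eqF.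
have D0 : 0 < 1 + `|df| by rewrite ltr_wpDr.
have A2 : `|df| * `|U1 - u x t - ux * h - ut * k| <= e / 2 * S.
  apply: (le_trans (ler_wpM2l _ H3)) => //.
  have : `|df| <= 1 + `|df| by lra.
  move=> /(ler_wpM2r (mulr_ge0 (ltW e20) S0)) /le_trans; apply.
  by apply: eq_le_refl; field; rewrite gt_eqF.
lra.
Qed.

Lemma has_gradN u x t ux ut : has_grad u x t ux ut ->
  has_grad (fun x t => - u x t) x t (- ux) (- ut).
Proof.
move=> hu; apply: has_grad_near (ltr01) _ (has_grad_eq (has_gradM (has_grad_cst (-1) x t) hu) _ _).
- by move=> h k _ _ /=; rewrite mulN1r.
- by rewrite mul0r add0r mulN1r.
- by rewrite mul0r add0r mulN1r.
Qed.

Lemma has_gradB u v x t ux ut vx vt : has_grad u x t ux ut ->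
  has_grad v x t vx vt ->
  has_grad (fun x t => u x t - v x t) x t (ux - vx) (ut - vt).
Proof. by move=> hu hv; exact: has_gradD hu (has_gradN hv). Qed.

Lemma has_gradV u x t ux ut : u x t != 0 -> has_grad u x t ux ut ->
  has_grad (fun x t => (u x t)^-1) x t (- ux / u x t ^+ 2) (- ut / u x t ^+ 2).
Proof.
move=> u0 /(has_grad_ugrad [set: unit]) hu; rewrite -normr_gt0 in u0.
exact: (ugrad_has_grad (w := tt) I (ugradV u0 (fun _ _ => lexx _) hu)).
Qed.

Lemma has_grad_continuousx u x t ux ut : has_grad u x t ux ut ->
  {for x, continuous (u^~ t)}.
Proof.
move=> /has_grad_lip[M M0 [d d0 H]]; apply/cvgrPdist_le => e e0.
have em : 0 < Num.min d (e / M) by rewrite lt_min d0 divr_gt0.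
near=> y; have yx : `|y - x| < Num.min d (e / M).
  by rewrite distrC; near: y; exact: cvgr_dist_lt.
move: yx; rewrite lt_min => /andP[yd ye].
have := H (y - x) 0 yd; rewrite normr0 !addr0 [x + _]addrC subrK distrC => /(_ d0).
move=> /le_trans; apply; rewrite mulrC -ler_pdivlMr// ltW//.
Unshelve. all: by end_near. Qed.

Lemma has_grad_continuoust u x t ux ut : has_grad u x t ux ut ->
  {for t, continuous (u x)}.
Proof.
move=> /has_grad_lip[M M0 [d d0 H]]; apply/cvgrPdist_le => e e0.
have em : 0 < Num.min d (e / M) by rewrite lt_min d0 divr_gt0.
near=> y; have yx : `|y - t| < Num.min d (e / M).
  by rewrite distrC; near: y; exact: cvgr_dist_lt.
move: yx; rewrite lt_min => /andP[yd ye].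
have := H 0 (y - t) _ yd; rewrite normr0 addr0 add0r [t + _]addrC subrK distrC => /(_ d0).
move=> /le_trans; apply; rewrite mulrC -ler_pdivlMr// ltW//.
Unshelve. all: by end_near. Qed.

End gradient.

(** * The divergence inequality *)

Section flux.
Context {R : realType}.
Implicit Types (l k : R -> R -> R).

Definition div_le0 l k (x t : R) := exists lx lt kx kt : R,
  [/\ has_grad l x t lx lt, has_grad k x t kx kt & lx + kt <= 0].

(** The outward flux of the field [(l, k)] through the boundary of the
    rectangle with opposite vertices [(a, c)] and [(b, d)]. *)
Definition flux l k (a b c d : R) : R :=
  cint c d (fun t => l b t - l a t) + cint a b (fun x => k x d - k x c).

Definition smooth_rect l k (a b c d : R) := forall x t,
  a <= x <= b -> c <= t <= d -> div_le0 l k x t.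

Lemma smooth_rectS l k a b c d a' b' c' d' : smooth_rect l k a b c d ->
  a <= a' -> b' <= b -> c <= c' -> d' <= d -> smooth_rect l k a' b' c' d'.
Proof.
move=> h aa bb cc dd x t /andP[ax xb] /andP[ct td]; apply: h.
  by rewrite (le_trans aa ax) (le_trans xb bb).
by rewrite (le_trans cc ct) (le_trans td dd).
Qed.

Lemma smooth_rect_ccontt l k a b c d x : smooth_rect l k a b c d ->
  a <= x <= b -> ccont c d (l x).
Proof.
move=> h xab; apply: ccontP => t; rewrite in_itv/= => tcd.
have [lx [lt [kx [kt [hl _ _]]]]] := h x t xab tcd.
exact: has_grad_continuoust hl.
Qed.

Lemma smooth_rect_ccontx l k a b c d t : smooth_rect l k a b c d ->
  c <= t <= d -> ccont a b (k ^~ t).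
Proof.
move=> h tcd; apply: ccontP => x; rewrite in_itv/= => xab.
have [lx [lt [kx [kt [_ hk _]]]]] := h x t xab tcd.
exact: has_grad_continuousx hk.
Qed.

Lemma ccontS a b a' b' (f : R -> R) : ccont a b f -> a <= a' -> b' <= b ->
  ccont a' b' f.
Proof.
move=> cf aa bb; apply: continuous_subspaceW cf.
by apply: subset_itv; rewrite bnd_simp.
Qed.

Lemma ccontB a b (f g : R -> R) : ccont a b f -> ccont a b g ->
  ccont a b (fun t => f t - g t).
Proof. by move=> cf cg x; apply: cvgB; [exact: cf|exact: cg]. Qed.

Lemma flux_split_x l k a m b c d : a <= m -> m <= b -> c <= d ->
  smooth_rect l k a b c d -> flux l k a b c d = flux l k a m c d + flux l k m b c d.
Proof.
move=> am mb cd h; have ab := le_trans am mb.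
have cl x : a <= x <= b -> ccont c d (l x) by move=> hx; exact: smooth_rect_ccontt h hx.
have ck t : c <= t <= d -> ccont a b (k ^~ t) by move=> hx; exact: smooth_rect_ccontx h hx.
rewrite /flux (@cint_split _ a m b) => //; last first.
  by apply: ccontB; apply: ck; rewrite ?lexx ?cd.
have [ca cm cb] : [/\ ccont c d (l a), ccont c d (l m) & ccont c d (l b)].
  by split; apply: cl; rewrite ?lexx ?ab ?am ?mb.
have [kc kd] : ccont a b (k^~ c) /\ ccont a b (k^~ d).
  by split; apply: ck; rewrite ?lexx ?cd.
have [kc1 kd1] := (ccontS kc (lexx a) mb, ccontS kd (lexx a) mb).
have [kc2 kd2] := (ccontS kc am (lexx b), ccontS kd am (lexx b)).
by rewrite !cintB//; ring.
Qed.

Lemma flux_split_t l k a b c m d : a <= b -> c <= m -> m <= d ->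
  smooth_rect l k a b c d -> flux l k a b c d = flux l k a b c m + flux l k a b m d.
Proof.
move=> ab cm md h; have cd := le_trans cm md.
have cl x : a <= x <= b -> ccont c d (l x) by move=> hx; exact: smooth_rect_ccontt h hx.
have ck t : c <= t <= d -> ccont a b (k ^~ t) by move=> hx; exact: smooth_rect_ccontx h hx.
rewrite /flux (@cint_split _ c m d) => //; last first.
  by apply: ccontB; apply: cl; rewrite ?lexx ?ab.
have [kc km kd] : [/\ ccont a b (k^~ c), ccont a b (k^~ m) & ccont a b (k^~ d)].
  by split; apply: ck; rewrite ?lexx ?cd ?cm ?md.
have [la lb] : ccont c d (l a) /\ ccont c d (l b).
  by split; apply: cl; rewrite ?lexx ?ab.
have [la1 lb1] := (ccontS la (lexx c) md, ccontS lb (lexx c) md).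
have [la2 lb2] := (ccontS la cm (lexx d), ccontS lb cm (lexx d)).
by rewrite !cintB//; ring.
Qed.

(** The affine part of the field at [(x, t)] has flux [lx + kt] times the
    area; only the linearisation error contributes, at most [e] times the
    square of the size of the rectangle. *)
Lemma flux_small l k x t lx lt kx kt e d a b c f :
  has_grad l x t lx lt -> has_grad k x t kx kt -> lx + kt <= 0 -> 0 < e ->
  (forall h s, `|h| < d -> `|s| < d ->
    `|l (x + h) (t + s) - l x t - lx * h - lt * s| <= e * (`|h| + `|s|)) ->
  (forall h s, `|h| < d -> `|s| < d ->
    `|k (x + h) (t + s) - k x t - kx * h - kt * s| <= e * (`|h| + `|s|)) ->
  smooth_rect l k a b c f -> a <= x <= b -> c <= t <= f ->
  b - a < d -> f - c < d ->
  flux l k a b c f <= 2 * e * ((b - a) + (f - c)) ^+ 2.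
Proof.
move=> hl hk lk e0 H1 H2 sm /andP[ax xb] /andP[ct tf] bad fcd.
have ab := le_trans ax xb; have cf := le_trans ct tf.
set S := (b - a) + (f - c).
have B1 : cint c f (fun s => l b s - l a s) <=
    (lx * (b - a) + 2 * e * S) * (f - c).
  rewrite -cint_cst//; apply: cint_le.
  - by apply: ccontB; apply: smooth_rect_ccontt sm _; rewrite lexx ab.
  - exact: ccont_cst.
  move=> s; rewrite in_itv/= => /andP[cs sf].
  have st : `|s - t| <= f - c by rewrite ler_norml; apply/andP; split; lra.
  have bx : `|b - x| <= b - x by rewrite ger0_norm ?subr_ge0.
  have xa : `|a - x| <= x - a by rewrite distrC ger0_norm ?subr_ge0.
  have := H1 (b - x) (s - t); have := H1 (a - x) (s - t).
  rewrite ![x + _]addrC ![t + _]addrC !subrK.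
  have -> : `|b - x| < d by apply: le_lt_trans bx _; lra.
  have -> : `|a - x| < d by apply: le_lt_trans xa _; lra.
  have -> : `|s - t| < d by apply: le_lt_trans st _; lra.
  move=> /(_ isT isT); rewrite ler_norml => /andP[P1 P2].
  move=> /(_ isT isT); rewrite ler_norml => /andP[Q1 Q2].
  have eb : e * (`|b - x| + `|s - t|) <= e * S.
    by apply: ler_wpM2l; [exact: ltW|rewrite /S; lra].
  have ea : e * (`|a - x| + `|s - t|) <= e * S.
    by apply: ler_wpM2l; [exact: ltW|rewrite /S; lra].
  have E : lx * (b - a) = lx * (b - x) - lx * (a - x) by ring.
  rewrite E; lra.
have B2 : cint a b (fun s => k s f - k s c) <=
    (kt * (f - c) + 2 * e * S) * (b - a).
  rewrite -cint_cst//; apply: cint_le.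
  - by apply: ccontB; apply: smooth_rect_ccontx sm _; rewrite lexx cf.
  - exact: ccont_cst.
  move=> s; rewrite in_itv/= => /andP[cs sf].
  have st : `|s - x| <= b - a by rewrite ler_norml; apply/andP; split; lra.
  have bx : `|f - t| <= f - t by rewrite ger0_norm ?subr_ge0.
  have xa : `|c - t| <= t - c by rewrite distrC ger0_norm ?subr_ge0.
  have := H2 (s - x) (f - t); have := H2 (s - x) (c - t).
  rewrite ![x + _]addrC ![t + _]addrC !subrK.
  have -> : `|f - t| < d by apply: le_lt_trans bx _; lra.
  have -> : `|c - t| < d by apply: le_lt_trans xa _; lra.
  have -> : `|s - x| < d by apply: le_lt_trans st _; lra.
  move=> /(_ isT isT); rewrite ler_norml => /andP[P1 P2].
  move=> /(_ isT isT); rewrite ler_norml => /andP[Q1 Q2].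
  have eb : e * (`|s - x| + `|f - t|) <= e * S.
    by apply: ler_wpM2l; [exact: ltW|rewrite /S; lra].
  have ea : e * (`|s - x| + `|c - t|) <= e * S.
    by apply: ler_wpM2l; [exact: ltW|rewrite /S; lra].
  have E : kt * (f - c) = kt * (f - t) - kt * (c - t) by ring.
  rewrite E; lra.
have E : 2 * e * S ^+ 2 = 2 * e * S * (f - c) + 2 * e * S * (b - a).
  by rewrite /S; ring.
have : (lx + kt) * ((b - a) * (f - c)) <= 0.
  by rewrite mulr_le0_ge0// mulr_ge0 ?subr_ge0.
rewrite /flux E; nra.
Qed.

Section bisection.
Variables (l k : R -> R -> R) (a0 c0 wx wt : R).
Hypotheses (wx0 : 0 <= wx) (wt0 : 0 <= wt).
Hypothesis sm : smooth_rect l k a0 (a0 + wx) c0 (c0 + wt).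

Let w n : R := 2 ^- n.
Let fl n (p : R * R) := flux l k p.1 (p.1 + wx * w n) p.2 (p.2 + wt * w n).

(** Of the four quarters of a rectangle, one has at least a quarter of the
    flux. *)
Let step n (p : R * R) : R * R :=
  let v := fl n p / 4 in
  let a := p.1 in let c := p.2 in
  let a' := a + wx * w n.+1 in let c' := c + wt * w n.+1 in
  if v <= fl n.+1 (a, c) then (a, c) else
  if v <= fl n.+1 (a', c) then (a', c) else
  if v <= fl n.+1 (a, c') then (a, c') else (a', c').

Fixpoint bisect n : R * R := if n is m.+1 then step m (bisect m) else (a0, c0).

Let w0 n : 0 < w n. Proof. by rewrite invr_gt0 exprn_gt0. Qed.
Let wS n : w n = w n.+1 + w n.+1.
Proof. by rewrite /w exprS invfM; field; rewrite expf_neq0. Qed.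

Let bisect_step n : let p := bisect n in let q := bisect n.+1 in
  [/\ p.1 <= q.1, q.1 + wx * w n.+1 <= p.1 + wx * w n,
      p.2 <= q.2 & q.2 + wt * w n.+1 <= p.2 + wt * w n].
Proof.
rewrite /= /step; set p := bisect n.
have hx : 0 <= wx * w n.+1 by rewrite mulr_ge0// ltW.
have ht : 0 <= wt * w n.+1 by rewrite mulr_ge0// ltW.
have -> : wx * w n = wx * w n.+1 + wx * w n.+1 by rewrite wS; ring.
have -> : wt * w n = wt * w n.+1 + wt * w n.+1 by rewrite wS; ring.
by case: ifPn => _; [|case: ifPn => _; [|case: ifPn => _]]; split => /=; lra.
Qed.

Let bisect_mono m n : (m <= n)%N -> let p := bisect m in let q := bisect n in
  [/\ p.1 <= q.1, q.1 + wx * w n <= p.1 + wx * w m,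
      p.2 <= q.2 & q.2 + wt * w n <= p.2 + wt * w m].
Proof.
move=> mn; rewrite -(subnKC mn); elim: (n - m)%N => [|j [h1 h2 h3 h4]].
  by rewrite addn0; split.
have [g1 g2 g3 g4] := bisect_step (m + j); rewrite addnS.
by split; [apply: le_trans g1|apply: le_trans g2 _|apply: le_trans g3|
  apply: le_trans g4 _].
Qed.

Let bisect_smooth n : smooth_rect l k (bisect n).1 ((bisect n).1 + wx * w n)
  (bisect n).2 ((bisect n).2 + wt * w n).
Proof.
have [h1 h2 h3 h4] := bisect_mono (leq0n n).
have w00 : w 0 = 1 by rewrite /w expr0 invr1.
by move: h1 h2 h3 h4; rewrite w00 !mulr1 /=; exact: smooth_rectS.
Qed.

Let bisect_flux n : fl 0 (a0, c0) * w n ^+ 2 <= fl n (bisect n).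
Proof.
elim: n => [|n ih]; first by rewrite /w expr0 invr1 expr1n mulr1.
have -> : fl 0 (a0, c0) * w n.+1 ^+ 2 = fl 0 (a0, c0) * w n ^+ 2 / 4.
  by rewrite (wS n); field.
apply: (@le_trans _ _ (fl n (bisect n) / 4)).
  by rewrite ler_pM2r// invr_gt0.
rewrite /= /step; set p := bisect n.
have smn := @bisect_smooth n; rewrite -/p in smn.
case: ifPn => // /negP h1; case: ifPn => // /negP h2; case: ifPn => // /negP h3.
rewrite leNgt; apply/negP => h4.
have hx : 0 <= wx * w n.+1 by rewrite mulr_ge0// ltW.
have ht : 0 <= wt * w n.+1 by rewrite mulr_ge0// ltW.
have Ex : p.1 + wx * w n = p.1 + wx * w n.+1 + wx * w n.+1 by rewrite wS; ring.
have Et : p.2 + wt * w n = p.2 + wt * w n.+1 + wt * w n.+1 by rewrite wS; ring.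
have : fl n p = fl n.+1 p + fl n.+1 (p.1 + wx * w n.+1, p.2) +
   (fl n.+1 (p.1, p.2 + wt * w n.+1) +
    fl n.+1 (p.1 + wx * w n.+1, p.2 + wt * w n.+1)).
  have hw : 0 <= wx * w n by rewrite mulr_ge0// ltW.
  have x01 : p.1 <= p.1 + wx * w n by lra.
  have x0m : p.1 <= p.1 + wx * w n.+1 by lra.
  have xm1 : p.1 + wx * w n.+1 <= p.1 + wx * w n by lra.
  have t0m : p.2 <= p.2 + wt * w n.+1 by lra.
  have tm1 : p.2 + wt * w n.+1 <= p.2 + wt * w n by lra.
  have sm1 := smooth_rectS smn (lexx _) (lexx _) (lexx _) tm1.
  have sm2 := smooth_rectS smn (lexx _) (lexx _) t0m (lexx _).
  rewrite /fl /= (flux_split_t x01 t0m tm1 smn).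
  rewrite (flux_split_x x0m xm1 t0m sm1) (flux_split_x x0m xm1 tm1 sm2).
  by rewrite Ex Et.
have {h1} : fl n.+1 p < fl n p / 4 by rewrite ltNge; apply/negP; case: (p) h1.
have {h2} : fl n.+1 (p.1 + wx * w n.+1, p.2) < fl n p / 4 by rewrite ltNge; apply/negP.
have {h3} : fl n.+1 (p.1, p.2 + wt * w n.+1) < fl n p / 4 by rewrite ltNge; apply/negP.
lra.
Qed.

(** Goursat's argument: a positive flux persists, relative to the area, in
    nested rectangles that shrink to a point, against [flux_small] at that
    point. *)
Lemma flux_le0_aux : flux l k a0 (a0 + wx) c0 (c0 + wt) <= 0.
Proof.
rewrite leNgt; apply/negP => v0.
set v := flux _ _ _ _ _ _ in v0.
have vE : fl 0 (a0, c0) = v by rewrite /fl /w expr0 invr1 !mulr1.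
pose x := sup (range (fun n => (bisect n).1)).
pose t := sup (range (fun n => (bisect n).2)).
have hx n : (bisect n).1 <= x <= (bisect n).1 + wx * w n.
  have ubn : ubound (range (fun n => (bisect n).1)) ((bisect n).1 + wx * w n).
    move=> _ [m _ <-]; have [/bisect_mono[h1 h2 _ _]|/ltnW/bisect_mono[h1 h2 _ _]] := leqP m n.
      by apply: le_trans h1 _; rewrite lerDl mulr_ge0// ltW.
    by apply: le_trans h2; rewrite lerDl mulr_ge0// ltW.
  apply/andP; split.
    apply: ub_le_sup; first by exists ((bisect n).1 + wx * w n).
    by exists n.
  apply: ge_sup => //; by exists (bisect 0).1, 0%N.
have ht n : (bisect n).2 <= t <= (bisect n).2 + wt * w n.
  have ubn : ubound (range (fun n => (bisect n).2)) ((bisect n).2 + wt * w n).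
    move=> _ [m _ <-]; have [/bisect_mono[_ _ h1 h2]|/ltnW/bisect_mono[_ _ h1 h2]] := leqP m n.
      by apply: le_trans h1 _; rewrite lerDl mulr_ge0// ltW.
    by apply: le_trans h2; rewrite lerDl mulr_ge0// ltW.
  apply/andP; split.
    apply: ub_le_sup; first by exists ((bisect n).2 + wt * w n).
    by exists n.
  apply: ge_sup => //; by exists (bisect 0).2, 0%N.
have [lx [lt [kx [kt [hl hk lk]]]]] : div_le0 l k x t.
  apply: sm; first by have := hx 0; rewrite /w expr0 invr1 mulr1.
  by have := ht 0; rewrite /w expr0 invr1 mulr1.
pose S := wx + wt + 1.
have S0 : 0 < S by rewrite /S ltr_wpDl ?addr_ge0.
pose e := v / (4 * S ^+ 2).
have e0 : 0 < e by rewrite divr_gt0// mulr_gt0// exprn_gt0.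
have [d1 d10 H1] := hl e e0; have [d2 d20 H2] := hk e e0.
pose d := Num.min d1 d2.
have d0 : 0 < d by rewrite lt_min d10 d20.
have dS0 : 0 < d / S by rewrite divr_gt0.
have [n _ /(_ n (leqnn n)) wn] := near_infty_natSinv_expn_lt (PosNum dS0).
have {}wn : S * w n < d by move: wn; rewrite /= div1r ltr_pdivlMr// mulrC.
have := @flux_small l k x t lx lt kx kt e d (bisect n).1
  ((bisect n).1 + wx * w n) (bisect n).2 ((bisect n).2 + wt * w n) hl hk lk e0.
have W := w0 n.
have h1 : wx * w n < d by apply: le_lt_trans wn; rewrite ler_pM2r// /S -addrA lerDl addr_ge0.
have h2 : wt * w n < d.
  by apply: le_lt_trans wn; rewrite ler_pM2r// /S addrAC lerDr addr_ge0.
have {}H1 h s : `|h| < d -> `|s| < d ->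
    `|l (x + h) (t + s) - l x t - lx * h - lt * s| <= e * (`|h| + `|s|).
  by rewrite !lt_min => /andP[hd _] /andP[sd _]; exact: H1.
have {}H2 h s : `|h| < d -> `|s| < d ->
    `|k (x + h) (t + s) - k x t - kx * h - kt * s| <= e * (`|h| + `|s|).
  by rewrite !lt_min => /andP[_ hd] /andP[_ sd]; exact: H2.
move=> /(_ H1 H2 (@bisect_smooth n) (hx n) (ht n)).
have -> : (bisect n).1 + wx * w n - (bisect n).1 = wx * w n by ring.
have -> : (bisect n).2 + wt * w n - (bisect n).2 = wt * w n by ring.
move=> /(_ h1 h2).
apply/negP; rewrite -ltNge.
apply: lt_le_trans (bisect_flux n); rewrite vE -mulrDl exprMn mulrA ltr_pM2r ?exprn_gt0//.
rewrite /e [ltLHS](_ : _ = v / 2 * ((wx + wt) ^+ 2 / S ^+ 2)); last first.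
  by field; rewrite gt_eqF.
have : (wx + wt) ^+ 2 / S ^+ 2 <= 1.
  by rewrite ler_pdivrMr ?exprn_gt0// mul1r ler_sqr ?nnegrE ?(ltW S0) ?addr_ge0// lerDl.
move=> /(ler_wpM2l (ltW v0)) ; lra.
Qed.

End bisection.

Lemma flux_le0 l k a b c d : a <= b -> c <= d -> smooth_rect l k a b c d ->
  flux l k a b c d <= 0.
Proof.
move=> ab cd sm; have := @flux_le0_aux l k a c (b - a) (d - c).
by rewrite !subr_ge0 ![_ + (_ - _)]addrC !subrK => /(_ ab cd sm).
Qed.

End flux.

Section divergence.
Context {R : realType}.
Implicit Types (l k : R -> R -> R).

Definition has_div l k (x t D : R) := exists lx lt kx kt : R,
  [/\ has_grad l x t lx lt, has_grad k x t kx kt & lx + kt = D].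

Lemma has_divD l k l' k' x t D D' : has_div l k x t D -> has_div l' k' x t D' ->
  has_div (fun x t => l x t + l' x t) (fun x t => k x t + k' x t) x t (D + D').
Proof.
move=> [lx [lt [kx [kt [h1 h2 <-]]]]] [lx' [lt' [kx' [kt' [h1' h2' <-]]]]].
exists (lx + lx'), (lt + lt'), (kx + kx'), (kt + kt').
by split; [exact: has_gradD|exact: has_gradD|ring].
Qed.

Lemma has_gradZ (c : R) l x t lx lt : has_grad l x t lx lt ->
  has_grad (fun x t => c * l x t) x t (c * lx) (c * lt).
Proof.
move=> h; have := has_gradM (has_grad_cst c x t) h.
by rewrite !mul0r !add0r.
Qed.

Lemma has_divZ (c : R) l k x t D : has_div l k x t D ->
  has_div (fun x t => c * l x t) (fun x t => c * k x t) x t (c * D).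
Proof.
move=> [lx [lt [kx [kt [h1 h2 <-]]]]].
exists (c * lx), (c * lt), (c * kx), (c * kt).
by split; [exact: has_gradZ|exact: has_gradZ|ring].
Qed.

Lemma flux_periodic_le l k a b : a <= b ->
  (forall x, k x (2 * pi) = k x 0) ->
  (forall x t, a <= x <= b -> exists2 D, has_div l k x t D & D <= 0) ->
  cint 0 (2 * pi) (l b) <= cint 0 (2 * pi) (l a).
Proof.
move=> ab per h.
have pi20 : (0 : R) <= 2 * pi by rewrite mulr_ge0// pi_ge0.
have sm : smooth_rect l k a b 0 (2 * pi).
  move=> x t xab _; have [D [lx [lt [kx [kt [h1 h2 h3]]]]] D0] := h x t xab.
  by exists lx, lt, kx, kt; split=> //; rewrite h3.
have := flux_le0 ab pi20 sm; rewrite /flux.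
have -> : (fun x => k x (2 * pi) - k x 0) = (fun _ => 0).
  by apply/funext => x; rewrite per subrr.
rewrite (cint_cst _ ab) mul0r addr0 cintB ?subr_le0//.
- by apply: smooth_rect_ccontt sm _; rewrite lexx ab.
- by apply: smooth_rect_ccontt sm _; rewrite lexx ab.
Qed.

End divergence.

(** * Complex functions in logarithmic polar coordinates *)

Section complex_basics.
Context {R : realType}.
Implicit Types (z w : R[i]).

Lemma cabs_sq z : cabs z ^+ 2 = Re z ^+ 2 + Im z ^+ 2.
Proof.
by case: z => a b; rewrite /cabs /= sqr_sqrtr// addr_ge0// sqr_ge0.
Qed.

Lemma cabs_ge0 z : 0 <= cabs z.
Proof. by case: z => a b; exact: sqrtr_ge0. Qed.

Lemma cabsM z w : cabs (z * w) = cabs z * cabs w.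
Proof. exact: ComplexField.Normc.normcM. Qed.

Lemma cabsD z w : cabs (z + w) <= cabs z + cabs w.
Proof. exact: (@le_normcD R z w). Qed.

Lemma cabsN z : cabs (- z) = cabs z.
Proof. exact: normcN. Qed.

Lemma cabsB z w : cabs (z - w) = cabs (w - z).
Proof. by rewrite -cabsN opprB. Qed.

Lemma cabsV z : cabs z^-1 = (cabs z)^-1.
Proof. exact: ComplexField.Normc.normcV. Qed.

Lemma cabs0 : cabs (0 : R[i]) = 0.
Proof. exact: ComplexField.Normc.normc0. Qed.

Lemma cabs1 : cabs (1 : R[i]) = 1.
Proof. exact: ComplexField.Normc.normc1. Qed.

Lemma cabs_real (x : R) : cabs x%:C = `|x|.
Proof. by rewrite /cabs /= expr0n addr0 sqrtr_sqr. Qed.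

Lemma cabs_eq0 z : (cabs z == 0) = (z == 0).
Proof.
apply/eqP/eqP => [|->]; last exact: cabs0.
exact: ComplexField.Normc.eq0_normc.
Qed.

Lemma cabs_gt0 z : (0 < cabs z) = (z != 0).
Proof. by rewrite lt_neqAle cabs_ge0 andbT eq_sym cabs_eq0. Qed.

Lemma cabs_norm z : `|z : R[i]^o| = (cabs z)%:C.
Proof. by case: z. Qed.

Lemma Re_le_cabs z : `|Re z| <= cabs z.
Proof.
rewrite -(@ler_sqr _ `|Re z|) ?nnegrE ?cabs_ge0// cabs_sq real_normK ?num_real// lerDl.
exact: sqr_ge0.
Qed.

Lemma Im_le_cabs z : `|Im z| <= cabs z.
Proof.
rewrite -(@ler_sqr _ `|Im z|) ?nnegrE ?cabs_ge0// cabs_sq real_normK ?num_real// lerDr.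
exact: sqr_ge0.
Qed.

Lemma cabs_le_ReIm z : cabs z <= `|Re z| + `|Im z|.
Proof.
rewrite -(@ler_sqr _ (cabs z)) ?nnegrE ?cabs_ge0 ?addr_ge0// cabs_sq.
rewrite -(real_normK (num_real (Re z))) -(real_normK (num_real (Im z))).
have := normr_ge0 (Re z); have := normr_ge0 (Im z); nra.
Qed.

Lemma ReD z w : Re (z + w) = Re z + Re w. Proof. by case: z; case: w. Qed.
Lemma ImD z w : Im (z + w) = Im z + Im w. Proof. by case: z; case: w. Qed.
Lemma ReB z w : Re (z - w) = Re z - Re w. Proof. by case: z; case: w. Qed.
Lemma ImB z w : Im (z - w) = Im z - Im w. Proof. by case: z; case: w. Qed.
Lemma ReMc z w : Re (z * w) = Re z * Re w - Im z * Im w.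
Proof. by case: z => a b; case: w. Qed.
Lemma ImMc z w : Im (z * w) = Re z * Im w + Im z * Re w.
Proof. by case: z => a b; case: w. Qed.

Lemma derivable_eps (f : R[i]^o -> R[i]^o) z : derivable f z 1 ->
  forall e : R, 0 < e -> exists2 d : R, 0 < d & forall h, cabs h < d ->
    cabs (f (z + h) - f z - derive1 f z * h) <= e * cabs h.
Proof.
move=> df e e0; have := df; rewrite /derivable => /cvg_ex[l fl].
have -> : derive1 f z = l by rewrite derive1E /derive; apply/cvg_lim.
have eC : 0 < e%:C by rewrite ltcR.
move/cvgrPdist_le : fl => /(_ e%:C eC) /nbhs_ballP[d /= d0 hd].
have [dE dp] : d = (Re d)%:C /\ 0 < Re d.
  by clear -d0; case: d d0 => a b; rewrite ltcE/= => /andP[/eqP-> ?].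
exists (Re d) => //.
move=> h hdd; have [->|h0] := eqVneq h 0.
  by rewrite addr0 subrr mulr0 subr0 cabs0 mulr0.
have := hd h; rewrite /ball/= sub0r normrN cabs_norm dE ltcR => /(_ hdd h0).
rewrite cabs_norm lecR => H.
have hc : 0 < cabs h by rewrite cabs_gt0.
rewrite -ler_pdivrMr// -cabsV -cabsM; apply: le_trans H.
rewrite -cabsN; apply: eq_le_refl; congr cabs.
rewrite (_ : h *: 1 = h); last by rewrite /GRing.scale/= mulr1.
rewrite /GRing.scale/= [h + z]addrC; field; exact: h0.
Qed.

Definition has_cgrad (F : R -> R -> R[i]) (x t : R) (Fx Ft : R[i]) :=
  has_grad (fun x t => Re (F x t)) x t (Re Fx) (Re Ft) /\
  has_grad (fun x t => Im (F x t)) x t (Im Fx) (Im Ft).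

(** The complex form of differentiability, convenient for the chain rule;
    the definition by components is the one that the real rules apply to. *)
Lemma has_cgradP F x t Fx Ft : has_cgrad F x t Fx Ft <->
  forall e, 0 < e -> exists2 d, 0 < d & forall h k : R, `|h| < d -> `|k| < d ->
    cabs (F (x + h) (t + k) - F x t - Fx * h%:C - Ft * k%:C) <= e * (`|h| + `|k|).
Proof.
have E h k : Re (F (x + h) (t + k) - F x t - Fx * h%:C - Ft * k%:C) =
    Re (F (x + h) (t + k)) - Re (F x t) - Re Fx * h - Re Ft * k.
  by rewrite !ReB !ReMc /= !mulr0 !subr0.
have E' h k : Im (F (x + h) (t + k) - F x t - Fx * h%:C - Ft * k%:C) =
    Im (F (x + h) (t + k)) - Im (F x t) - Im Fx * h - Im Ft * k.
  by rewrite !ImB !ImMc /= !mulr0 !add0r.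
split=> [[H1 H2] e e0|H].
  have e20 : 0 < e / 2 by rewrite divr_gt0.
  have [d1 d10 {}H1] := H1 _ e20; have [d2 d20 {}H2] := H2 _ e20.
  exists (Num.min d1 d2); first by rewrite lt_min d10 d20.
  move=> h k; rewrite !lt_min => /andP[h1 h2] /andP[k1 k2].
  apply: le_trans (cabs_le_ReIm _) _; rewrite E E'.
  apply: le_trans (lerD (H1 _ _ h1 k1) (H2 _ _ h2 k2)) _; lra.
split=> e e0; have [d d0 {}H] := H e e0; exists d => // h k hd kd.
  by rewrite -E; apply: le_trans (Re_le_cabs _) _; exact: H.
by rewrite -E'; apply: le_trans (Im_le_cabs _) _; exact: H.
Qed.

Lemma has_cgrad_lip F x t Fx Ft : has_cgrad F x t Fx Ft ->
  exists2 d, 0 < d & forall h k, `|h| < d -> `|k| < d ->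
    cabs (F (x + h) (t + k) - F x t) <= (1 + cabs Fx + cabs Ft) * (`|h| + `|k|).
Proof.
move=> /has_cgradP /(_ 1 ltr01)[d d0 H]; exists d => // h k hd kd.
have := H h k hd kd; rewrite mul1r => H1.
rewrite (_ : F (x + h) (t + k) - F x t =
  (F (x + h) (t + k) - F x t - Fx * h%:C - Ft * k%:C) + Fx * h%:C + Ft * k%:C);
  last by ring.
apply: (le_trans (cabsD _ _)).
apply: (le_trans (lerD (cabsD _ _) (lexx _))).
rewrite !cabsM !cabs_real; have := normr_ge0 h; have := normr_ge0 k.
have := cabs_ge0 Fx; have := cabs_ge0 Ft; nra.
Qed.

Lemma has_cgrad_comp (f : R[i]^o -> R[i]^o) c x t cx ct :
  has_cgrad c x t cx ct -> derivable f (c x t) 1 ->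
  has_cgrad (fun x t => f (c x t)) x t (derive1 f (c x t) * cx)
    (derive1 f (c x t) * ct).
Proof.
move=> hc /derivable_eps hf; apply/has_cgradP => e e0.
set df := derive1 f (c x t) in hf *.
have [d1 d10 L1] := has_cgrad_lip hc.
set Mu := 1 + cabs cx + cabs ct in L1.
have Mu0 : 0 < Mu by rewrite /Mu !ltr_wpDr ?cabs_ge0.
have e10 : 0 < e / (2 * Mu) by rewrite divr_gt0// mulr_gt0.
have [d2 d20 H2] := hf _ e10.
have D0 : 0 < 1 + cabs df by rewrite ltr_wpDr ?cabs_ge0.
have e20 : 0 < e / (2 * (1 + cabs df)) by rewrite divr_gt0// mulr_gt0.
have [d3 d30 H3] := (has_cgradP _ _ _ _ _).1 hc _ e20.
pose d4 := d2 / (2 * Mu).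
have d40 : 0 < d4 by rewrite divr_gt0// mulr_gt0.
exists (Num.min (Num.min d1 d3) d4); first by rewrite !lt_min d10 d30 d40.
move=> h k; rewrite !lt_min => /andP[/andP[h1 h3] h4] /andP[/andP[k1 k3] k4].
have {}L1 := L1 _ _ h1 k1; have {}H3 := H3 _ _ h3 k3.
set S := `|h| + `|k| in L1 H3 *.
have S0 : 0 <= S by rewrite addr_ge0.
set U1 := c (x + h) (t + k) in L1 H3 *.
have Us : cabs (U1 - c x t) < d2.
  apply: le_lt_trans L1 _; have : S < 2 * d4 by rewrite /S; lra.
  rewrite -(ltr_pM2l Mu0) => /lt_le_trans; apply.
  by apply: eq_le_refl; rewrite /d4; field; rewrite gt_eqF.
have {}H2 := H2 _ Us; rewrite [c x t + _]addrC subrK in H2.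
rewrite (_ : _ - _ = (f U1 - f (c x t) - df * (U1 - c x t)) +
  df * (U1 - c x t - cx * h%:C - ct * k%:C)); last by ring.
apply: (le_trans (cabsD _ _)); rewrite cabsM.
have A1 : e / (2 * Mu) * cabs (U1 - c x t) <= e / 2 * S.
  apply: (le_trans (ler_wpM2l (ltW e10) L1)).
  by apply: eq_le_refl; field; rewrite gt_eqF.
have A2 : cabs df * cabs (U1 - c x t - cx * h%:C - ct * k%:C) <= e / 2 * S.
  apply: (le_trans (ler_wpM2l (cabs_ge0 _) H3)).
  have : cabs df <= 1 + cabs df by lra.
  move=> /(ler_wpM2r (mulr_ge0 (ltW e20) S0)) /le_trans; apply.
  by apply: eq_le_refl; field; rewrite gt_eqF.
lra.
Qed.

Lemma has_cgradM (F G : R -> R -> R[i]) x t Fx Ft Gx Gt :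
  has_cgrad F x t Fx Ft -> has_cgrad G x t Gx Gt ->
  has_cgrad (fun x t => F x t * G x t) x t (Fx * G x t + F x t * Gx) (Ft * G x t + F x t * Gt).
Proof.
move=> [f1 f2] [g1 g2]; split.
  apply: has_grad_eq (has_grad_near (@ltr01 R) _ (has_gradB (has_gradM f1 g1) (has_gradM f2 g2))) _ _.
  - by move=> h k _ _; rewrite ReMc.
  - by rewrite ReD !ReMc; ring.
  - by rewrite ReD !ReMc; ring.
apply: has_grad_eq (has_grad_near (@ltr01 R) _ (has_gradD (has_gradM f1 g2) (has_gradM f2 g1))) _ _.
- by move=> h k _ _; rewrite ImMc.
- by rewrite ImD !ImMc; ring.
- by rewrite ImD !ImMc; ring.
Qed.

(** In the coordinates [(x, t)] circles about the origin are vertical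
    segments of length [2 pi]. *)
Definition cexp (x t : R) : R[i] := (expR x)%:C * cexpi t.

Lemma Re_cexp x t : Re (cexp x t) = expR x * cos t.
Proof. by rewrite /cexp ReMc /= mul0r subr0. Qed.

Lemma Im_cexp x t : Im (cexp x t) = expR x * sin t.
Proof. by rewrite /cexp ImMc /= mul0r addr0. Qed.

Lemma cabs_cexpi t : cabs (cexpi t) = 1 :> R.
Proof. by rewrite /cabs /= cos2Dsin2 sqrtr1. Qed.

Lemma cabs_cexp x t : cabs (cexp x t) = expR x.
Proof. by rewrite cabsM cabs_cexpi cabs_real mulr1 ger0_norm// expR_ge0. Qed.

Lemma has_cgrad_cexp x t : has_cgrad cexp x t (cexp x t) ('i * cexp x t).
Proof.
have hx : has_grad (fun x t : R => expR x) x t (expR x) 0.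
  apply: has_grad_eq (has_grad_comp (has_grad_fst x t) (is_derive_expR x)) _ _.
    by rewrite mulr1.
  by rewrite mulr0.
split.
- apply: (@has_grad_near _ (fun x t => expR x * cos t) _ _ _ _ _ _ ltr01).
    by move=> h k _ _; rewrite Re_cexp.
  apply: has_grad_eq (has_gradM hx (has_grad_comp (has_grad_snd x t) (is_derive_cos t))) _ _.
    by rewrite Re_cexp; ring.
  by rewrite ReMc Re_cexp Im_cexp /=; ring.
- apply: (@has_grad_near _ (fun x t => expR x * sin t) _ _ _ _ _ _ ltr01).
    by move=> h k _ _; rewrite Im_cexp.
  apply: has_grad_eq (has_gradM hx (has_grad_comp (has_grad_snd x t) (is_derive_sin t))) _ _.
    by rewrite Im_cexp; ring.
  by rewrite ImMc Re_cexp Im_cexp /=; ring.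
Qed.

Lemma cexp_2pi x : cexp x (2 * pi) = cexp x 0.
Proof.
rewrite /cexp /cexpi cos0 sin0.
by rewrite mulr_natl cos2pi sin2pi.
Qed.

End complex_basics.

(** * Mean values over circles *)

Section mean_value.
Context {R : realType}.
Implicit Types (z w c : R[i]).

Lemma derivable_close (f : R[i]^o -> R[i]^o) z : derivable f z 1 ->
  forall e : R, 0 < e -> exists2 d : R, 0 < d & forall h, cabs h < d ->
    cabs (f (z + h) - f z) <= e.
Proof.
move=> /derivable_eps /(_ 1 ltr01)[d d0 H] e e0.
have M0 : 0 < 1 + cabs (derive1 f z) by rewrite ltr_wpDr ?cabs_ge0.
exists (Num.min d (e / (1 + cabs (derive1 f z)))).
  by rewrite lt_min d0 divr_gt0.
move=> h; rewrite lt_min => /andP[hd he].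
have := H h hd; rewrite mul1r => H1.
rewrite (_ : _ - _ = (f (z + h) - f z - derive1 f z * h) + derive1 f z * h); last by ring.
apply: le_trans (cabsD _ _) _; rewrite cabsM.
by move: he; rewrite ltr_pdivlMr// => he; apply: ltW; apply: le_lt_trans he; lra.
Qed.

Lemma circle_ccont (f : R[i]^o -> R[i]^o) c (x a b : R) :
  (forall t, derivable f (c + cexp x t) 1) ->
  ccont a b (fun t => Re (f (c + cexp x t))) /\
  ccont a b (fun t => cabs (f (c + cexp x t)) ^+ 2).
Proof.
move=> df.
have hg t : has_cgrad (fun x t => f (c + cexp x t)) x t
    (derive1 f (c + cexp x t) * cexp x t) (derive1 f (c + cexp x t) * ('i * cexp x t)).
  apply: has_cgrad_comp (df t).
  have [h1 h2] := has_cgrad_cexp x t.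
  split.
    have := has_gradD (has_grad_cst (Re c) x t) h1; rewrite !add0r.
    by apply: has_grad_near (@ltr01 _) _ => h k _ _; rewrite ReD.
  have := has_gradD (has_grad_cst (Im c) x t) h2; rewrite !add0r.
  by apply: has_grad_near (@ltr01 _) _ => h k _ _; rewrite ImD.
split; apply: ccontP => t _; have [h1 h2] := hg t.
  exact: (has_grad_continuoust h1).
have E : (fun t => cabs (f (c + cexp x t)) ^+ 2) =
  (fun t => Re (f (c + cexp x t)) * Re (f (c + cexp x t)) +
  Im (f (c + cexp x t)) * Im (f (c + cexp x t))).
  by apply/funext => s; rewrite cabs_sq !expr2.
rewrite E.
exact: has_grad_continuoust (has_gradD (has_gradM h1 h1) (has_gradM h2 h2)).
Qed.

(** By the Cauchy-Riemann equations [(Re f, - Im f)] is divergence free in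
    the coordinates of [cexp], so the mean of [Re f] does not depend on the
    radius; it tends to [Re (f c)] for small radii. *)
Lemma mean_value (f : R[i]^o -> R[i]^o) c (r : R) : 0 < r ->
  (forall z, cabs (z - c) <= r -> derivable f z 1) ->
  cint 0 (2 * pi) (fun t => Re (f (c + r%:C * cexpi t))) = 2 * pi * Re (f c).
Proof.
move=> r0 df; pose l x t := Re (f (c + cexp x t)).
pose k x t := - Im (f (c + cexp x t)).
have pi20 : (0 : R) <= 2 * pi by rewrite mulr_ge0// pi_ge0.
have dfx x t : x <= ln r -> derivable f (c + cexp x t) 1.
  move=> xr; apply: df; rewrite addrC addKr cabs_cexp.
  by rewrite -[leRHS](lnK r0) ler_expR.
have hl x t : x <= ln r -> has_cgrad (fun x t => f (c + cexp x t)) x t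
    (derive1 f (c + cexp x t) * cexp x t) (derive1 f (c + cexp x t) * ('i * cexp x t)).
  move=> xr; apply: has_cgrad_comp (dfx x t xr).
  have [h1 h2] := has_cgrad_cexp x t.
  split.
    have := has_gradD (has_grad_cst (Re c) x t) h1; rewrite !add0r.
    by apply: has_grad_near (@ltr01 _) _ => h k0 _ _; rewrite ReD.
  have := has_gradD (has_grad_cst (Im c) x t) h2; rewrite !add0r.
  by apply: has_grad_near (@ltr01 _) _ => h k0 _ _; rewrite ImD.
have per x : k x (2 * pi) = k x 0 by rewrite /k cexp_2pi.
have cl x : x <= ln r -> ccont 0 (2 * pi) (l x).
  by move=> xr; have [] := @circle_ccont f c x 0 (2 * pi) (fun t => dfx x t xr).
have dl x t : x <= ln r -> has_div l k x t 0.
  move=> xr; have [h1 h2] := hl x t xr; have h3 := has_gradN h2.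
  do 4 eexists; split; [exact: h1|exact: h3|].
  by rewrite !ImMc !ReMc /= !mul0r !mul1r ?add0r ?sub0r; lra.
have const x : x <= ln r -> cint 0 (2 * pi) (l (ln r)) = cint 0 (2 * pi) (l x).
  move=> xr; apply/eqP; rewrite eq_le; apply/andP; split.
    apply: (flux_periodic_le xr per) => y t /andP[_ yr].
    by exists 0 => //; exact: dl.
  have cN y : y <= ln r -> cint 0 (2 * pi) (fun t => -1 * l y t) = - cint 0 (2 * pi) (l y).
    by move=> yr; apply: etrans (cintZ (-1) (cl _ yr)) _; rewrite mulN1r.
  apply: (le_opp_eq (cN _ xr) (cN _ (lexx _))).
  apply: (@flux_periodic_le _ (fun x t => -1 * l x t) (fun x t => -1 * k x t)) => //.
    by move=> y; rewrite per.
  move=> y t /andP[_ yr]; exists (-1 * 0); last by rewrite mulr0.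
  exact: has_divZ (dl y t yr).
have main e : 0 < e -> `|cint 0 (2 * pi) (l (ln r)) - 2 * pi * Re (f c)| <= e * (2 * pi).
  move=> e0.
  have dc : derivable f c 1 by apply: df; rewrite subrr cabs0 ltW.
  have [d d0 H] := derivable_close dc e0.
  pose x := Num.min (ln r) (ln (d / 2)).
  have xr : x <= ln r by rewrite ge_min lexx.
  have xd : expR x < d.
    apply: (@le_lt_trans _ _ (d / 2)); last by lra.
    by rewrite -[leRHS]lnK ?posrE ?divr_gt0// ler_expR ge_min lexx orbT.
  rewrite (const x xr).
  have -> : 2 * pi * Re (f c) = cint 0 (2 * pi) (fun _ => Re (f c)).
    by rewrite cint_cst// subr0 mulrC.
  have cc : ccont 0 (2 * pi) (fun _ : R => Re (f c)) by exact: ccont_cst.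
  rewrite -cintB//; last exact: cl.
  have B t : `|l x t - Re (f c)| <= e.
    by rewrite /l -ReB; apply: le_trans (Re_le_cabs _) _; apply: H; rewrite cabs_cexp.
  have cB : ccont 0 (2 * pi) (fun t => l x t - Re (f c)) by apply: ccontB; [exact: cl|].
  rewrite ler_norml; apply/andP; split.
    have -> : - (e * (2 * pi)) = cint 0 (2 * pi) (fun _ => - e).
      by rewrite cint_cst// subr0 mulNr.
    apply: cint_le; [exact: ccont_cst|exact: cB|].
    by move=> t _; have := B t; rewrite ler_norml => /andP[].
  have -> : e * (2 * pi) = cint 0 (2 * pi) (fun _ => e).
    by rewrite cint_cst// subr0.
  apply: cint_le; [exact: cB|exact: ccont_cst|].
  by move=> t _; have := B t; rewrite ler_norml => /andP[].
have -> : cint 0 (2 * pi) (fun t => Re (f (c + r%:C * cexpi t))) = cint 0 (2 * pi) (l (ln r)).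
  by rewrite /l /cexp lnK.
apply/eqP; rewrite -subr_eq0 -normr_le0; apply/ler_addgt0Pl => e e0.
rewrite addr0; have pi0 : (0 : R) < 2 * pi by rewrite mulr_gt0// pi_gt0.
have := main (e / (2 * pi)); rewrite divr_gt0// => /(_ isT).
by rewrite divfK// gt_eqF.
Qed.

(** The mean value property for [conj (f c) * f], and
    [2 Re (conj a * w) <= |a|^2 + |w|^2]. *)
Lemma sub_mean_value (f : R[i]^o -> R[i]^o) c (r : R) : 0 < r ->
  (forall z, cabs (z - c) <= r -> derivable f z 1) ->
  2 * pi * cabs (f c) ^+ 2 <=
    cint 0 (2 * pi) (fun t => cabs (f (c + r%:C * cexpi t)) ^+ 2).
Proof.
move=> r0 df.
pose a := f c; pose g : R[i]^o -> R[i]^o := fun z => conjc a * f z.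
have dg z : cabs (z - c) <= r -> derivable g z 1.
  move=> /df dfz; apply: (@derivableM _ _ (cst (conjc a : R[i]^o)) f).
    exact: derivable_cst.
  exact: dfz.
have pi20 : (0 : R) <= 2 * pi by rewrite mulr_ge0// pi_ge0.
have E t : c + r%:C * cexpi t = c + cexp (ln r) t by rewrite /cexp lnK.
have inb t : cabs (c + cexp (ln r) t - c) <= r.
  by rewrite addrC addKr cabs_cexp lnK.
have := mean_value r0 dg.
have Ere w : Re (g w) = Re a * Re (f w) + Im a * Im (f w).
  by rewrite /g /= ReMc; case: (a) => u v /=; ring.
rewrite Ere -!expr2 -cabs_sq -/a => M.
have -> : 2 * pi * cabs a ^+ 2 = cint 0 (2 * pi)
   (fun t => 2 * Re (g (c + r%:C * cexpi t)) - cabs a ^+ 2).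
  have cg : ccont 0 (2 * pi) (fun t => Re (g (c + r%:C * cexpi t))).
    have [] := @circle_ccont g c (ln r) 0 (2 * pi) (fun t => dg _ (inb t)).
    by under [in X in X -> _ -> _]eq_fun do rewrite -E.
  rewrite cintB; first by rewrite cintZ// M cint_cst// subr0; ring.
    move=> x; apply: cvgM; [exact: cvg_cst|exact: cg].
  exact: ccont_cst.
apply: cint_le.
- have [h1 h2] := @circle_ccont g c (ln r) 0 (2 * pi) (fun t => dg _ (inb t)).
  apply: ccontB; last exact: ccont_cst.
  under eq_fun do rewrite E.
  by move=> x; apply: cvgM; [exact: cvg_cst|exact: h1].
- have [h1 h2] := @circle_ccont f c (ln r) 0 (2 * pi) (fun t => df _ (inb t)).
  by under eq_fun do rewrite E.
- move=> t _; rewrite Ere !cabs_sq; set w := f _.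
  have := sqr_ge0 (Re a - Re w); have := sqr_ge0 (Im a - Im w); nra.
Qed.

Lemma cauchy_kernel_neq0 (b z : R[i]) : cabs b < 1 -> cabs z <= 1 -> 1 - b * z != 0.
Proof.
move=> b1 z1; apply/eqP => /eqP; rewrite subr_eq0 => /eqP h.
have := cabsM b z; rewrite -h cabs1 => E.
have : cabs b * cabs z <= cabs b * 1 by rewrite ler_wpM2l ?cabs_ge0.
by rewrite -E mulr1 leNgt b1.
Qed.

Lemma derivable_cauchy_kernel (b z : R[i]) : 1 - b * z != 0 ->
  derivable (fun z : R[i]^o => (1 - b * z)^-1 : R[i]^o) z 1.
Proof.
move=> nz; apply: (@derivableV _ _ (fun z : R[i]^o => 1 - b * z : R[i]^o)); first exact: nz.
apply: (@derivableB _ _ _ (cst (1 : R[i]^o)) (fun z : R[i]^o => b * z : R[i]^o)).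
  exact: derivable_cst.
apply: (@derivableM _ _ (cst (b : R[i]^o)) id); first exact: derivable_cst.
exact: derivable_id.
Qed.

(** For [|z| = 1] the integrand is [(2 Re (1 - b z)^-1 - 1) / (1 - |b|^2)],
    the real part of an analytic function. *)
Lemma poisson_mean (b : R[i]) : cabs b < 1 ->
  cint 0 (2 * pi) (fun t => cabs (1 - b * cexpi t)^-1 ^+ 2) =
  2 * pi / (1 - cabs b ^+ 2).
Proof.
move=> b1.
pose f : R[i]^o -> R[i]^o := fun z => (1 - b * z)^-1.
have df z : cabs (z - 0) <= 1 -> derivable f z 1.
  by rewrite subr0 => z1; exact/derivable_cauchy_kernel/cauchy_kernel_neq0.
have := mean_value ltr01 df.
have -> : Re (f 0) = 1 by rewrite /f mulr0 subr0 invr1.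
rewrite mulr1 => M.
have b2 : 0 < 1 - cabs b ^+ 2.
  by rewrite subr_gt0 expr_lt1// cabs_ge0.
have E t : cabs (1 - b * cexpi t)^-1 ^+ 2 =
   (1 - cabs b ^+ 2)^-1 * (2 * Re (f (0 + 1%:C * cexpi t)) - 1).
  have n0 : 1 - b * cexpi t != 0 by apply: cauchy_kernel_neq0; rewrite ?cabs_cexpi.
  have : cabs (b * cexpi t) ^+ 2 = cabs b ^+ 2 by rewrite cabsM cabs_cexpi mulr1.
  rewrite add0r mul1r /f => <-; move: n0; set w := b * cexpi t => n0.
  rewrite cabsV exprVn; apply: (mulfI (x := 1 - cabs w ^+ 2)).
    by rewrite /w cabsM cabs_cexpi mulr1 gt_eqF.
  rewrite mulrA mulfV ?mul1r; last by rewrite /w cabsM cabs_cexpi mulr1 gt_eqF.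
  have n2 : 0 < cabs (1 - w) ^+ 2 by rewrite exprn_gt0// cabs_gt0.
  have vE : (1 - w)^-1 = ((Re (1 - w) / cabs (1 - w) ^+ 2) +i* (- Im (1 - w) / cabs (1 - w) ^+ 2)).
    apply: (mulfI (x := 1 - w)) => //.
    rewrite mulfV//; case: (1 - w) n2 => p q.
    rewrite cabs_sq /= => n2; apply/eqP; rewrite eq_complex /=.
    by apply/andP; split; apply/eqP; field; rewrite gt_eqF.
  rewrite vE /=; move: n2; rewrite !cabs_sq; case: (w) => p q /= n2; field.
  by rewrite gt_eqF// -[- q]sub0r.
under eq_fun do rewrite E.
have bt t : derivable f (0 + cexp 0 t) 1.
  by apply: df; rewrite add0r subr0 cabs_cexp expR0.
have [h _] := @circle_ccont f 0 0 0 (2 * pi) bt.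
rewrite /cexp expR0 in h.
have h2 : ccont 0 (2 * pi) (fun t => 2 * Re (f (0 + 1%:C * cexpi t))).
  by move=> x; apply: cvgM; [exact: cvg_cst|exact: h].
have pi20 : (0 : R) <= 2 * pi by rewrite mulr_ge0// pi_ge0.
have h3 : ccont 0 (2 * pi) (fun t => 2 * Re (f (0 + 1%:C * cexpi t)) - 1).
  by apply: ccontB => //; exact: ccont_cst.
rewrite cintZ// cintB//; last exact: ccont_cst.
by rewrite cintZ// M cint_cst// subr0; field; rewrite gt_eqF.
Qed.

End mean_value.

(** * Area measure and mean values over discs *)

Section plane_measure.
Context {R : realType}.
Notation leb := (@lebesgue_measure R).
Implicit Types (g : plane R -> \bar R).

(** An open set is a countable union of rational boxes. *)
Lemma measurable_open_plane (U : set (plane R)) :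
  (forall w, U w -> exists2 e : R, 0 < e &
    forall v : plane R, `|v.1 - w.1| < e -> `|v.2 - w.2| < e -> U v) ->
  measurable U.
Proof.
move=> oU.
pose box (q : rat * rat * rat * rat) : set (plane R) :=
  `](ratr q.1.1.1 : R), ratr q.1.1.2[%classic `*` `](ratr q.1.2 : R), ratr q.2[%classic.
have -> : U = \bigcup_(n in [set n | exists2 q, unpickle n = Some q & box q `<=` U])
    (if unpickle n is Some q then box q else set0).
  apply/seteqP; split => [w Uw|w [n [q nq bq]]].
    have [e e0 he] := oU w Uw.
    have l1 : w.1 - e < w.1 by lra. have l2 : w.1 < w.1 + e by lra.
    have l3 : w.2 - e < w.2 by lra. have l4 : w.2 < w.2 + e by lra.
    have [q1] := rat_in_itvoo l1; rewrite inE/= => /andP[a1 a2].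
    have [q2] := rat_in_itvoo l2; rewrite inE/= => /andP[b1 b2].
    have [q3] := rat_in_itvoo l3; rewrite inE/= => /andP[c1 c2].
    have [q4] := rat_in_itvoo l4; rewrite inE/= => /andP[d1 d2].
    exists (pickle (q1, q2, q3, q4)).
      exists (q1, q2, q3, q4); first by rewrite pickleK.
      move=> v [/=]; rewrite !in_itv/= => /andP[x1 x2] /andP[y1 y2].
      apply: he; rewrite ltr_distl.
        by rewrite (lt_trans a1 x1) (lt_trans x2 b2).
      by rewrite (lt_trans c1 y1) (lt_trans y2 d2).
    by rewrite pickleK; split => /=; rewrite in_itv/=; apply/andP; split.
  by rewrite nq; exact: bq.
apply: bigcup_measurable => n _; case: unpickle => // q.
by apply: measurableX; exact: measurable_itv.
Qed.

Lemma measurable_fun_superlevel (v : plane R -> R) : (forall w, 0 <= v w) ->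
  (forall a, 0 <= a -> measurable [set w | a < v w]) ->
  measurable_fun setT v.
Proof.
move=> v0 mv _; apply: (measurability _ (RGenOInfty.measurableE R)) => //.
move=> /= _ [_ [a ->] <-]; rewrite setTI.
have -> : v @^-1` `]a, +oo[%classic = [set w | a < v w].
  by apply/seteqP; split => w /=; rewrite in_itv/= andbT.
have [a0|a0] := leP 0 a; first exact: mv.
rewrite (_ : [set w | _] = setT)//; apply/seteqP; split => // w _ /=.
exact: lt_le_trans (v0 w).
Qed.

(** The translated Lebesgue measure agrees with the Lebesgue measure on
    intervals. *)
Lemma integral_shift (g : measurableTypeR R -> \bar R) (c : R) :
  measurable_fun setT g -> (forall x, 0 <= g x)%E ->
  (\int[leb]_x g (x + c)%R = \int[leb]_x g x)%E.
Proof.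
move=> mg g0.
pose phi : measurableTypeR R -> measurableTypeR R := fun x : R => x + c.
have mphi : measurable_fun [set: measurableTypeR R] phi.
  apply: measurable_funD; first exact: measurable_id.
  exact: measurable_cst.
pose m := measure_function_pushforward__canonical__measure_function_Measure leb mphi.
have E A : measurable A -> leb A = pushforward leb phi A.
  move=> mA; apply: (@lebesgue_measure_unique R m) => // X /ocitvP[->|[[a b]/= ab ->]].
    by rewrite /= /pushforward preimage_set0 !measure0.
  rewrite /= /pushforward.
  rewrite (_ : phi @^-1` _ = `]a - c, b - c]%classic); last first.
    by apply/seteqP; split => x /=; rewrite !in_itv/= /phi ltrBlDr lerBrDr.
  rewrite [LHS]lebesgue_measure_itv [RHS]lebesgue_measure_itv/= !lte_fin ltrD2r ab.
  by congr (_%:E); ring.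
have := @ge0_integral_pushforward _ _ _ _ R phi mphi leb setT g measurableT mg.
rewrite preimage_setT => <-; last by [].
by apply: eq_measure_integral => A mA _; exact: (esym (E A mA)).
Qed.

Let area_tonelli1 g : measurable_fun setT g -> (forall w, 0 <= g w)%E ->
  (\int[area R]_w g w = \int[leb]_x \int[leb]_y g (x, y))%E.
Proof. by move=> mg g0; exact: (fubini_tonelli1 g). Qed.

Let area_tonelli2 g : measurable_fun setT g -> (forall w, 0 <= g w)%E ->
  (\int[area R]_w g w = \int[leb]_y \int[leb]_x g (x, y))%E.
Proof. by move=> mg g0; exact: (fubini_tonelli2 g). Qed.

Definition shear1 (a c : R) (w : plane R) : plane R := (w.1 + (c * w.2 + a), w.2).
Definition shear2 (a c : R) (w : plane R) : plane R := (w.1, w.2 + (c * w.1 + a)).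

Lemma measurable_affine (p q r : R) :
  measurable_fun setT (fun w : plane R => (p * w.1 + q * w.2 + r) : measurableTypeR R).
Proof.
apply: measurable_funD; last exact: measurable_cst.
by apply: measurable_funD;
  apply: measurable_funM; try exact: measurable_cst;
  [exact: measurable_fst|exact: measurable_snd].
Qed.

Lemma measurable_shear1 a c : measurable_fun setT (shear1 a c).
Proof.
apply: measurable_fun_pair; last exact: measurable_snd.
have := measurable_affine 1 c a; apply: eq_measurable_fun => w _ /=.
by rewrite mul1r addrA.
Qed.

Lemma measurable_shear2 a c : measurable_fun setT (shear2 a c).
Proof.
apply: measurable_fun_pair; first exact: measurable_fst.
have := measurable_affine c 1 a; apply: eq_measurable_fun => w _ /=.
by rewrite mul1r addrA [c * _ + _]addrC.
Qed.

Lemma integral_shear1 g a c : measurable_fun setT g -> (forall w, 0 <= g w)%E ->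
  (\int[area R]_w g (shear1 a c w) = \int[area R]_w g w)%E.
Proof.
move=> mg g0; rewrite area_tonelli2//; last first.
  exact: measurableT_comp mg (measurable_shear1 a c).
rewrite area_tonelli2//; apply: eq_integral => y _.
apply: (@integral_shift (fun x => g (x, y)) (c * y + a)) => //.
exact: measurableT_comp mg (measurable_pair2 y).
Qed.

Lemma integral_shear2 g a c : measurable_fun setT g -> (forall w, 0 <= g w)%E ->
  (\int[area R]_w g (shear2 a c w) = \int[area R]_w g w)%E.
Proof.
move=> mg g0; rewrite area_tonelli1//; last first.
  exact: measurableT_comp mg (measurable_shear2 a c).
rewrite area_tonelli1//; apply: eq_integral => x _.
apply: (@integral_shift (fun y => g (x, y)) (c * x + a)) => //.
exact: measurableT_comp mg (measurable_pair1 x).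
Qed.

Definition plane_rot (c s : R) (w : plane R) : plane R :=
  (c * w.1 - s * w.2, s * w.1 + c * w.2).

Lemma measurable_rot c s : measurable_fun setT (plane_rot c s).
Proof.
apply: measurable_fun_pair.
  have := measurable_affine c (- s) 0; apply: eq_measurable_fun => w _ /=.
  by rewrite addr0 mulNr.
have := measurable_affine s c 0; apply: eq_measurable_fun => w _ /=.
by rewrite addr0.
Qed.

(** A rotation other than the half-turn is a product of three shears, each
    of which preserves area because translations of the line preserve
    length; the half-turn is the square of a quarter-turn. *)
Lemma integral_rot g c s : c ^+ 2 + s ^+ 2 = 1 ->
  measurable_fun setT g -> (forall w, 0 <= g w)%E ->
  (\int[area R]_w g (plane_rot c s w) = \int[area R]_w g w)%E.
Proof.
have gen g' c' s' : c' ^+ 2 + s' ^+ 2 = 1 -> 1 + c' != 0 ->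
  measurable_fun setT g' -> (forall w, 0 <= g' w)%E ->
  (\int[area R]_w g' (plane_rot c' s' w) = \int[area R]_w g' w)%E.
  move=> cs c1 mg g0; pose k := - s' / (1 + c').
  rewrite -(integral_shear1 0 k mg g0).
  have m1 := measurableT_comp mg (measurable_shear1 0 k).
  rewrite -(integral_shear2 0 s' m1 (fun w => g0 _)).
  have m2 := measurableT_comp m1 (measurable_shear2 0 s').
  rewrite -(integral_shear1 0 k m2 (fun w => g0 _)).
  apply: eq_integral => w _; congr g'; rewrite /plane_rot /shear1 /shear2 /= !addr0.
  have Ec : c' = 1 + s' * k.
    apply: (mulIf c1); rewrite /k.
    have -> : (1 + s' * (- s' / (1 + c'))) * (1 + c') = 1 + c' - s' ^+ 2 by field.
    have -> : s' ^+ 2 = 1 - c' ^+ 2 by rewrite -cs; ring.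
    ring.
  have Es : - s' = 2 * k + s' * k ^+ 2.
    apply: (mulIf (expf_neq0 2 c1)); rewrite /k.
    have -> : (2 * (- s' / (1 + c')) + s' * (- s' / (1 + c')) ^+ 2) * (1 + c') ^+ 2
      = - 2 * s' * (1 + c') + s' * s' ^+ 2 by field.
    have -> : s' ^+ 2 = 1 - c' ^+ 2 by rewrite -cs; ring.
    ring.
  congr pair.
    by rewrite -mulNr Es Ec; ring.
  by rewrite Ec; ring.
move=> cs mg g0; have [c1|c1] := eqVneq (1 + c) 0; last exact: gen.
have cE : c = -1 by apply/eqP; rewrite -subr_eq0 opprK addrC c1.
have sE : s = 0.
  apply/eqP; rewrite -sqrf_eq0; apply/eqP.
  by move: cs; rewrite cE sqrrN expr1n => /eqP; rewrite -subr_eq0 addrC addKr => /eqP.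
have u : (0 : R) ^+ 2 + 1 ^+ 2 = 1 by rewrite expr0n expr1n add0r.
have v : 1 + 0 != 0 :> R by rewrite addr0 oner_eq0.
rewrite -(gen g 0 1 u v mg g0).
have m1 := measurableT_comp mg (measurable_rot 0 1).
rewrite -(gen _ 0 1 u v m1 (fun w => g0 _)).
apply: eq_integral => w _; congr g; rewrite /plane_rot /= cE sE.
by congr pair; ring.
Qed.

Lemma integral_translate g (a b : R) : measurable_fun setT g -> (forall w, 0 <= g w)%E ->
  (\int[area R]_w g (w.1 + a, w.2 + b)%R = \int[area R]_w g w)%E.
Proof.
move=> mg g0; rewrite -(integral_shear1 a 0 mg g0).
have m1 := measurableT_comp mg (measurable_shear1 a 0).
rewrite -(integral_shear2 b 0 m1 (fun w => g0 _)).
by apply: eq_integral => w _; congr g; rewrite /shear1 /shear2 /= !mul0r !add0r.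
Qed.

End plane_measure.

Section area_mean.
Context {R : realType}.
Notation leb := (@lebesgue_measure R).

(** A name for the area measure that carries its sigma-finiteness, which the
    Tonelli theorem on [R * plane R] looks for. *)
Definition plane_area : set (plane R) -> \bar R := area R.
HB.instance Definition _ := Measure.on plane_area.

Let plane_area_sigma_finite : sigma_finite setT plane_area.
Proof.
have /sigma_finiteP[F [TF ndF Foo]] := sigma_finiteT leb.
exists (fun n => F n `*` F n).
  apply/seteqP; split => // -[x y] _.
  have [[n _ Fx] [m _ Fy]] : (\bigcup_i F i) x /\ (\bigcup_i F i) y by rewrite -TF.
  exists (maxn n m) => //; split => /=.
    by move: x Fx; exact/subsetPset/ndF/leq_maxl.
  by move: y Fy; exact/subsetPset/ndF/leq_maxr.
move=> n; have [mF Fn] := Foo n; split; first exact: measurableX.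
rewrite [ltLHS](_ : _ = leb (F n) * leb (F n))%E; last exact: product_measure1E.
by rewrite lte_mul_pinfty// ge0_fin_numE.
Qed.

HB.instance Definition _ := Measure_isSigmaFinite.Build _ _ _ plane_area
  plane_area_sigma_finite.

Lemma cabs_triangle (a b c : R[i]) : cabs (a - c) <= cabs (a - b) + cabs (b - c).
Proof. by rewrite (_ : a - c = (a - b) + (b - c)) ?cabsD//; ring. Qed.

Lemma cpx_close (w v : plane R) (e : R) : `|v.1 - w.1| < e / 2 -> `|v.2 - w.2| < e / 2 ->
  cabs (cpx v - cpx w) < e.
Proof.
move=> h1 h2; apply: le_lt_trans (cabs_le_ReIm _) _; rewrite /= (splitr e).
exact: ltrD.
Qed.

Lemma derivable_affine (f : R[i]^o -> R[i]^o) (a b z : R[i]) :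
  derivable f (a + b * z) 1 -> derivable (fun z : R[i]^o => f (a + b * z)) z 1.
Proof.
move=> /derivable1_diffP df; apply/derivable1_diffP.
pose g : R[i]^o -> R[i]^o := fun z => a + b * z.
have dg : differentiable g (z : R[i]^o).
  apply/derivable1_diffP.
  apply: (@derivableD _ _ _ (cst (a : R[i]^o)) (fun z : R[i]^o => b * z : R[i]^o)).
    exact: derivable_cst.
  apply: (@derivableM _ _ (cst (b : R[i]^o)) id); first exact: derivable_cst.
  exact: derivable_id.
exact: (differentiable_comp dg df).
Qed.

Definition disc_sq (A : R[i] -> R[i]) (z : R[i]) (r : R) (w : plane R) : R :=
  if cabs (cpx w - z) < r then cabs (A (cpx w)) ^+ 2 else 0.

Lemma measurable_disc_sq (A : R[i]^o -> R[i]^o) (z : R[i]) (r : R) :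
  (forall u, cabs (u - z) < r -> derivable A u 1) ->
  measurable_fun setT (disc_sq A z r).
Proof.
move=> dA; apply: measurable_fun_superlevel.
  by move=> w; rewrite /disc_sq; case: ifP => // _; exact: sqr_ge0.
move=> a a0; apply: measurable_open_plane => w; rewrite /= /disc_sq.
case: ifPn => [wr aw|_]; last by rewrite ltNge a0.
have s0 : Num.sqrt a < cabs (A (cpx w)).
  rewrite -(@ltr_sqr _ (Num.sqrt a)) ?nnegrE ?sqrtr_ge0 ?cabs_ge0//.
  by rewrite sqr_sqrtr.
pose e := (cabs (A (cpx w)) - Num.sqrt a) / 2.
have e0 : 0 < e by rewrite divr_gt0// subr_gt0.
have [d d0 H] := derivable_close (dA _ wr) e0.
pose d' := Num.min d (r - cabs (cpx w - z)).
have d'0 : 0 < d' by rewrite lt_min d0 subr_gt0.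
exists (d' / 2); first by rewrite divr_gt0.
move=> v h1 h2; have := cpx_close h1 h2; rewrite lt_min => /andP[hd hr].
have vz : cabs (cpx v - z) < r.
  by apply: le_lt_trans (cabs_triangle _ (cpx w) _) _; rewrite -ltrBrDr.
rewrite vz -[a]sqr_sqrtr// ltr_sqr ?nnegrE ?sqrtr_ge0 ?cabs_ge0//.
have := H _ hd; rewrite (addrC (cpx w)) subrK => K.
have := cabsD (A (cpx w) - A (cpx v)) (A (cpx v)); rewrite subrK cabsB => K2.
move: K K2 e0; rewrite /e; lra.
Qed.

Lemma measurable_disc (z : R[i]) (r : R) :
  measurable [set w : plane R | cabs (cpx w - z) < r].
Proof.
apply: measurable_open_plane => w /= wr.
exists ((r - cabs (cpx w - z)) / 2); first by rewrite divr_gt0// subr_gt0.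
move=> v h1 h2; have := cpx_close h1 h2 => hr.
by apply: le_lt_trans (cabs_triangle _ (cpx w) _) _; rewrite -ltrBrDr.
Qed.

(** The disc contains a square of side [r]. *)
Lemma area_disc_ge (r : R) : 0 < r ->
  ((r ^+ 2)%:E <= area R [set w : plane R | (cabs (cpx w - 0) < r)%R])%E.
Proof.
move=> r0.
pose I : set (measurableTypeR R) := `[(- (r / 2)), (r / 2)]%classic.
have mI : measurable I by exact: measurable_itv.
have -> : (r ^+ 2)%:E = area R (I `*` I).
  have lI : lebesgue_measure I = r%:E.
    rewrite /I; apply: etrans; first exact: lebesgue_measure_itv.
    rewrite /= lte_fin (_ : - (r / 2) < r / 2); last by lra.
    by rewrite -EFinB; congr (_%:E); field.
  transitivity (lebesgue_measure I * lebesgue_measure I)%E.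
    by rewrite lI -EFinM expr2.
  exact/esym/product_measure1E.
apply: le_measure; rewrite ?inE.
- exact: measurableX.
- exact: measurable_disc.
- move=> w [/=]; rewrite /I /= !in_itv/= -!ler_norml => h1 h2.
  change (is_true (cabs (cpx w - 0) < r)); rewrite subr0.
  rewrite -(@ltr_sqr _ (cabs (cpx w))) ?nnegrE ?cabs_ge0 ?ltW// cabs_sq /=.
  rewrite -(real_normK (num_real (w.1))) -(real_normK (num_real (w.2))).
  have := normr_ge0 (w.1 : R); have := normr_ge0 (w.2 : R).
  move: h1 h2; set p := `|_|; set q := `|_| => h1 h2 p0 q0.
  have : p ^+ 2 <= (r / 2) ^+ 2 by rewrite ler_sqr ?nnegrE// divr_ge0// ltW.
  have : q ^+ 2 <= (r / 2) ^+ 2 by rewrite ler_sqr ?nnegrE// divr_ge0// ltW.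
  have : 0 < r ^+ 2 by rewrite exprn_gt0.
  have -> : (r / 2) ^+ 2 = r ^+ 2 / 4 by field.
  move=> a b c; apply: (@le_lt_trans _ _ (r ^+ 2 / 4 + r ^+ 2 / 4)); first exact: lerD.
  lra.
Qed.

(** Averaging the area integral over all rotations about [z] turns it into
    an integral of circle means, to which [sub_mean_value] applies. *)
Lemma area_sub_mean (A : R[i]^o -> R[i]^o) (z : R[i]) (r : R) : 0 < r ->
  (forall u, cabs (u - z) < r -> derivable A u 1) ->
  ((r ^+ 2 * cabs (A z) ^+ 2)%:E <=
   \int[area R]_(w in [set w | (cabs (cpx w - z) < r)%R]) (cabs (A (cpx w)) ^+ 2)%:E)%E.
Proof.
move=> r0 dA; pose v := disc_sq A z r.
have mv : measurable_fun setT v by exact: measurable_disc_sq.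
have v0 w : 0 <= v w by rewrite /v /disc_sq; case: ifP => // _; exact: sqr_ge0.
have -> : (\int[area R]_(w in [set w | (cabs (cpx w - z) < r)%R]) (cabs (A (cpx w)) ^+ 2)%:E
   = \int[area R]_w (v w)%:E)%E.
  rewrite integral_mkcond; apply: eq_integral => w _; rewrite patchE /v /disc_sq.
  have -> : (w \in [set w : plane R | (cabs (cpx w - z) < r)%R]) = (cabs (cpx w - z) < r)%R.
    by apply/idP/idP; rewrite inE.
  by case: ifP.
pose g (w : plane R) := ((v (w.1 + Re z, w.2 + Im z))%:E).
have mEv : measurable_fun setT (fun w => (v w)%:E) by apply/measurable_EFinP.
have mg : measurable_fun setT g.
  apply: (measurableT_comp mEv).
  apply: measurable_fun_pair.
    by have := measurable_affine 1 0 (Re z); apply: eq_measurable_fun => w _ /=; ring.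
  by have := measurable_affine 0 1 (Im z); apply: eq_measurable_fun => w _ /=; ring.
have g0 w : (0 <= g w)%E by rewrite lee_fin.
rewrite -(integral_translate (Re z) (Im z) mEv) -/(g _); last by move=> w; rewrite lee_fin.
set J := (\int[area R]_w g w)%E.
pose T : set (measurableTypeR R) := `[0%R, 2 * pi]%classic.
have mT : measurable T by exact: measurable_itv.
(* The angle [tw.1] rotates the point [tw.2]: integrating over the point
   first gives [2 pi J], integrating over the angle first gives circle
   means. *)
pose G (tw : measurableTypeR R * plane R) : \bar R :=
  ((\1_T tw.1)%:E * g (plane_rot (cos tw.1) (sin tw.1) tw.2))%E.
have G0 x : (0 <= G x)%E by rewrite mule_ge0// lee_fin.
have mcos : measurable_fun setT (fun tw : measurableTypeR R * plane R => cos tw.1 : measurableTypeR R).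
  apply: measurableT_comp; last exact: measurable_fst.
  by apply: continuous_measurable_fun; exact: continuous_cos.
have msin : measurable_fun setT (fun tw : measurableTypeR R * plane R => sin tw.1 : measurableTypeR R).
  apply: measurableT_comp; last exact: measurable_fst.
  by apply: continuous_measurable_fun; exact: continuous_sin.
have m1 : measurable_fun setT (fun tw : measurableTypeR R * plane R => tw.2.1).
  by apply: measurableT_comp; [exact: measurable_fst|exact: measurable_snd].
have m2 : measurable_fun setT (fun tw : measurableTypeR R * plane R => tw.2.2).
  by apply: measurableT_comp; [exact: measurable_snd|exact: measurable_snd].
have mG : measurable_fun setT G.
  apply: emeasurable_funM.
    apply/measurable_EFinP; apply: measurableT_comp; last exact: measurable_fst.
    exact: measurable_indic.
  apply: (measurableT_comp mg); apply: measurable_fun_pair.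
    by apply: measurable_funB; apply: measurable_funM.
  by apply: measurable_funD; apply: measurable_funM.
have := fubini_tonelli (m1 := leb) (m2 := plane_area) G mG G0.
have -> : (\int[leb]_x \int[plane_area]_y G (x, y) = (2 * pi)%:E * J)%E.
  transitivity (\int[leb]_(x in T) J)%E.
    rewrite [RHS]integral_mkcond; apply: eq_integral => t _; rewrite patchE /G /= indicE.
    case: ifPn => tT; last by rewrite integral0_eq// => w _; rewrite mul0e.
    under eq_integral do rewrite mul1e.
    by rewrite (@integral_rot _ g (cos t) (sin t) (cos2Dsin2 t) mg g0).
  rewrite integral_cst// muleC; congr (_ * _)%E.
  apply: etrans; first exact: lebesgue_measure_itv.
  by rewrite /= lte_fin mulr_gt0 ?pi_gt0// -EFinB subr0.
move=> E.
have pi0 : 0 < 2 * pi :> R by rewrite mulr_gt0 ?pi_gt0.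
rewrite -(@lee_pmul2l _ (2 * pi)%:E) ?lte_fin// E.
pose B : set (plane R) := [set w | cabs (cpx w - 0) < r].
have mB : measurable B by exact: measurable_disc.
apply: (@le_trans _ _ (\int[plane_area]_(w in B) (2 * pi * cabs (A z) ^+ 2)%:E)%E).
  rewrite integral_cst// -EFinM.
  have -> : 2 * pi * (r ^+ 2 * cabs (A z) ^+ 2) = 2 * pi * cabs (A z) ^+ 2 * r ^+ 2 by ring.
  rewrite EFinM; apply: lee_pmul => //.
  - by rewrite lee_fin mulr_ge0 ?sqr_ge0// ltW.
  - by rewrite lee_fin sqr_ge0.
  - exact: area_disc_ge.
rewrite integral_mkcond; apply: ge0_le_integral => //.
- by move=> w _; rewrite patchE; case: ifP => // _; rewrite lee_fin mulr_ge0 ?sqr_ge0// ltW.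
- by apply/measurable_restrict => //; rewrite setTI; exact: measurable_cst.
- exact: (measurable_fun_fubini_tonelli_G (m1 := leb) G mG G0).
move=> w _; rewrite patchE; case: ifPn => [|_]; last by apply: integral_ge0.
rewrite inE => wr0; have wr : cabs (cpx w) < r by rewrite -[cpx w]subr0.
pose f : R[i]^o -> R[i]^o := fun u => A (z + cpx w * u).
have df u : cabs (u - 0) <= 1 -> derivable f u 1.
  rewrite subr0 => u1; apply: derivable_affine; apply: dA.
  rewrite addrC addKr cabsM; apply: le_lt_trans wr.
  by rewrite ler_piMr ?cabs_ge0.
have := sub_mean_value ltr01 df; rewrite {1}/f mulr0 addr0.
rewrite -lee_fin => /le_trans; apply.
have cf : ccont 0 (2 * pi) (fun t => cabs (f (0 + 1%:C * cexpi t)) ^+ 2).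
  have bt t : derivable f (0 + cexp 0 t) 1.
    by apply: df; rewrite add0r subr0 cabs_cexp expR0.
  have [_ h] := @circle_ccont _ f 0 0 0 (2 * pi) bt.
  by move: h; rewrite /cexp expR0.
rewrite /cint /Rintegral fineK; last first.
  by apply: integrable_fin_num => //; exact: (ccont_int cf).
rewrite integral_mkcond le_eqVlt; apply/orP; left; apply/eqP; apply: eq_integral => t _.
rewrite patchE /G /= indicE /T; case: ifPn => tT; last by rewrite mul0e.
rewrite mul1e /g /v /disc_sq /plane_rot /=.
have -> : cpx (cos t * w.1 - sin t * w.2 + Re z, sin t * w.1 + cos t * w.2 + Im z) =
   z + cpx w * (0 + 1%:C * cexpi t).
  rewrite add0r mul1r; case: (z) => p q; case: (w) => a b.
  by apply/eqP; rewrite eq_complex /=; apply/andP; split; apply/eqP; ring.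
rewrite ifT; first by rewrite /f.
by rewrite addrC addKr cabsM add0r mul1r cabs_cexpi mulr1.
Qed.

End area_mean.

(** * Hardy spaces and the Carleson condition *)

Section hardy.
Context {R : realType}.
Notation leb := (@lebesgue_measure R).

Lemma powR_sq (x : R) : 0 <= x -> x `^ 2 = x ^+ 2.
Proof. exact: (@powR_mulrn R x 2). Qed.

(** At a zero of [h] the power is not differentiable, so continuity is
    proved directly there. *)
Lemma continuous_powR_nneg (p : R) (h : R -> R) (t : R) : 0 < p ->
  (forall s, 0 <= h s) -> {for t, continuous h} ->
  {for t, continuous (fun s => h s `^ p)}.
Proof.
move=> p0 h0 ch.
have [ht|ht] := eqVneq (h t) 0.
  apply/cvgrPdist_le => e e0 /=; rewrite ht powR0 ?gt_eqF//.
  have e1 : 0 < e `^ p^-1 by rewrite powR_gt0.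
  have /cvgrPdist_lt /(_ _ e1) := ch; rewrite ht; apply: filterS => s.
  rewrite !sub0r !normrN !ger0_norm ?powR_ge0// => /ltW hs.
  rewrite -[e]powRr1 ?(ltW e0)// -(mulVf (lt0r_neq0 p0)) powRrM.
  by apply: ge0_ler_powR => //; rewrite ?nnegrE ?(ltW p0) ?powR_ge0.
have ht0 : 0 < h t by rewrite lt_neqAle eq_sym ht h0.
apply: (@continuous_comp _ _ _ h (fun x => x `^ p)) => //.
apply: differentiable_continuous; apply/derivable1_diffP.
by apply: derivable_powR; rewrite in_itv/= andbT.
Qed.

Lemma continuous_cabs_circle (f : R[i]^o -> R[i]^o) (c : R[i]) (r t : R) :
  derivable f (c + r%:C * cexpi t) 1 ->
  {for t, continuous (fun t => cabs (f (c + r%:C * cexpi t)))}.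
Proof.
move=> df; apply/cvgrPdist_le => e e0 /=.
have [d d0 H] := derivable_close df e0.
have rd : 0 < d / (1 + `|r|) by rewrite divr_gt0// ltr_wpDr.
have [_ /has_grad_continuoust hs] := has_cgrad_cexp (0 : R) t.
have [/has_grad_continuoust hc _] := has_cgrad_cexp (0 : R) t.
have rd2 : 0 < d / (1 + `|r|) / 2 by rewrite divr_gt0.
move/cvgrPdist_lt : hc => /(_ _ rd2) hc.
move/cvgrPdist_lt : hs => /(_ _ rd2) hs.
near=> s.
have h1 : `|Re (cexp 0 t) - Re (cexp 0 s)| < d / (1 + `|r|) / 2 by near: s.
have h2 : `|Im (cexp 0 t) - Im (cexp 0 s)| < d / (1 + `|r|) / 2 by near: s.
have h3 : cabs (cexpi s - cexpi t) < d / (1 + `|r|).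
  rewrite cabsB; apply: le_lt_trans (cabs_le_ReIm _) _; rewrite ReB ImB.
  rewrite (splitr (d / _)); apply: ltrD; move: h1 h2; rewrite !Re_cexp !Im_cexp expR0 !mul1r//.
have K : cabs (f (c + r%:C * cexpi s) - f (c + r%:C * cexpi t)) <= e.
  rewrite (_ : c + r%:C * cexpi s = (c + r%:C * cexpi t) + r%:C * (cexpi s - cexpi t)); last by ring.
  apply: H; rewrite cabsM cabs_real.
  apply: le_lt_trans (_ : (1 + `|r|) * cabs (cexpi s - cexpi t) < _).
    by rewrite ler_wpM2r ?cabs_ge0// lerDr.
  by rewrite mulrC -ltr_pdivlMr// ltr_wpDr.
move: K; set u := f _; set v := f _ => K.
have A := cabsD (u - v) v; have B := cabsD (v - u) u.
rewrite subrK in A; rewrite subrK cabsB in B.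
by rewrite ler_norml; apply/andP; split; lra.
Unshelve. all: by end_near. Qed.

Definition pmean (p : R) (f : R[i] -> R[i]) (r : R) : R :=
  cint 0 (2 * pi) (fun t => cabs (f (r%:C * cexpi t)) `^ p).

Lemma in_disc (r t : R) : 0 < r < 1 -> unit_disc R (r%:C * cexpi t).
Proof.
move=> /andP[r0 r1].
by rewrite /unit_disc /mkset cabsM cabs_cexpi mulr1 cabs_real gtr0_norm.
Qed.

Lemma pmean_ccont (p : R) (f : R[i] -> R[i]) (r : R) : 0 < p -> analytic_disc f ->
  0 < r < 1 -> ccont 0 (2 * pi) (fun t => cabs (f (r%:C * cexpi t)) `^ p).
Proof.
move=> p0 af r01; apply: ccontP => t _.
apply: continuous_powR_nneg => //; first by move=> s; exact: cabs_ge0.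
have -> : (fun s => cabs (f (r%:C * cexpi s))) =
    (fun s => cabs (f (0 + r%:C * cexpi s))).
  by apply/funext => s; rewrite add0r.
by apply: continuous_cabs_circle; rewrite add0r; apply: af; exact: in_disc.
Qed.

Lemma circle_meanE (p : R) (f : R[i] -> R[i]) (r : R) : 0 < p -> analytic_disc f ->
  0 < r < 1 -> circle_mean p f r = (((2 * pi)^-1 * pmean p f r) `^ p^-1)%:E.
Proof.
move=> p0 af r01; rewrite /circle_mean /pmean /cint /Rintegral -poweR_EFin EFinM fineK//.
by apply: integrable_fin_num => //; exact: (ccont_int (pmean_ccont p0 af r01)).
Qed.

(** A bounded monotone function of the radius has a limit, which is the
    convergence that [hardy] asks for. *)
Lemma hardy_monotone (p M : R) (f : R[i] -> R[i]) : 0 < p -> analytic_disc f ->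
  (forall r1 r2, 0 < r1 -> r1 <= r2 -> r2 < 1 -> pmean p f r1 <= pmean p f r2) ->
  (forall r, 0 < r < 1 -> pmean p f r <= M) ->
  hardy p f /\ (hardy_norm p f <= (((2 * pi)^-1 * M) `^ p^-1)%:E)%E.
Proof.
move=> p0 af mono bd.
pose c r := ((2 * pi)^-1 * pmean p f r) `^ p^-1.
have pi0 : 0 < (2 * pi : R)^-1 by rewrite invr_gt0 mulr_gt0 ?pi_gt0.
have pm0 r : 0 <= pmean p f r by apply: Rintegral_ge0 => t _; exact: powR_ge0.
have nn r : (2 * pi)^-1 * pmean p f r \is Num.nneg.
  by rewrite nnegrE mulr_ge0// ltW.
have p10 : 0 <= p^-1 by rewrite invr_ge0 ltW.
have hM : 0 <= M by apply: le_trans (pm0 2^-1) (bd _ _); apply/andP; split; lra.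
have cM r : 0 < r < 1 -> c r <= ((2 * pi)^-1 * M) `^ p^-1.
  move=> r01; apply: (ge0_ler_powR p10 (nn r)); first by rewrite nnegrE mulr_ge0// ltW.
  by rewrite ler_pM2l// bd.
have cvc : cvg (c r @[r --> (1 : R)^'-]).
  apply: nondecreasing_at_left_is_cvgr.
    near=> x => u v; rewrite !in_itv/= => /andP[xu u1] /andP[xv v1] uv.
    apply: (ge0_ler_powR p10 (nn u) (nn v)); rewrite (ler_pM2l pi0); apply: mono uv v1.
    by apply: lt_trans xu; near: x; apply: nbhs_left_gt; exact: ltr01.
  near=> x; exists (((2 * pi)^-1 * M) `^ p^-1) => _ [y /= + <-].
  rewrite in_itv/= => /andP[xy y1]; apply: cM; rewrite y1 andbT.
  by apply: lt_trans xy; near: x; apply: nbhs_left_gt; exact: ltr01.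
have near_eq : \forall r \near (1 : R)^'-, (c r)%:E = circle_mean p f r.
  near=> r; rewrite circle_meanE//; apply/andP; split; last by near: r; exact: nbhs_left_lt.
  by near: r; apply: nbhs_left_gt; exact: ltr01.
have cvE : cvg (circle_mean p f r @[r --> (1 : R)^'-]).
  apply/cvg_ex; exists (lim (c r @[r --> (1 : R)^'-]))%:E.
  apply: cvg_trans; first exact: (near_eq_cvg near_eq).
  by apply: cvg_EFin; [near=> r|exact: cvc].
have le : (hardy_norm p f <= (((2 * pi)^-1 * M) `^ p^-1)%:E)%E.
  apply: lime_le => //; near=> r; rewrite circle_meanE//; last first.
    apply/andP; split; last by near: r; exact: nbhs_left_lt.
    by near: r; apply: nbhs_left_gt; exact: ltr01.
  rewrite lee_fin; apply: cM; apply/andP; split; last by near: r; exact: nbhs_left_lt.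
  by near: r; apply: nbhs_left_gt; exact: ltr01.
split=> //; split=> //; exact: le_lt_trans le (ltry _).
Unshelve. all: by end_near. Qed.

(** The Carleson condition with exponent [2], tested on the function
    [1 / (1 - conj a * z)], whose circle means are those of [poisson_mean]. *)
Lemma carleson_kernel (mu : {measure set (plane R) -> \bar R}) : carleson mu ->
  exists2 C : R, 0 < C & forall a : R[i], cabs a < 1 ->
    (\int[mu]_(w in plane_disc R) (cabs (1 - conjc a * cpx w)^-1 ^+ 2)%:E <=
      (C / (1 - cabs a ^+ 2))%:E)%E.
Proof.
move=> /(_ 2 ltac:(by []))[C C0 H]; exists C => // a a1.
have ca : cabs (conjc a) = cabs a by case: a {a1} => u v; rewrite /cabs /= sqrrN.
pose g : R[i] -> R[i] := fun z => (1 - conjc a * z)^-1.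
have ag : analytic_disc g.
  move=> z z1; apply: derivable_cauchy_kernel.
  by apply: cauchy_kernel_neq0; [rewrite ca|exact: ltW].
have a2 : 0 < 1 - cabs a ^+ 2 by rewrite subr_gt0 expr_lt1// cabs_ge0.
have pi0 : 0 < 2 * pi :> R by rewrite mulr_gt0 ?pi_gt0.
have ra r : 0 < r < 1 -> cabs (conjc a * r%:C) ^+ 2 = r ^+ 2 * cabs a ^+ 2 /\
    0 < 1 - r ^+ 2 * cabs a ^+ 2 /\ r ^+ 2 * cabs a ^+ 2 <= cabs a ^+ 2.
  move=> /andP[r0 r1]; rewrite cabsM ca cabs_real gtr0_norm// exprMn mulrC; split=> //.
  have L : r ^+ 2 * cabs a ^+ 2 <= cabs a ^+ 2.
    by rewrite ler_piMl ?sqr_ge0// expr_le1 ?(ltW r0) ?(ltW r1).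
  by split=> //; lra.
have pg r : 0 < r < 1 -> pmean 2 g r = 2 * pi / (1 - r ^+ 2 * cabs a ^+ 2).
  move=> r01; have [E [L1 L2]] := ra r r01.
  have b1 : cabs (conjc a * r%:C) < 1.
    by rewrite -(@ltr_sqr _ _ 1) ?nnegrE ?cabs_ge0// E expr1n; lra.
  have := poisson_mean b1; rewrite E => <-; rewrite /pmean; congr cint.
  apply/funext => t; rewrite powR_sq ?cabs_ge0//.
  by rewrite /g mulrA.
have mono r1 r2 : 0 < r1 -> r1 <= r2 -> r2 < 1 -> pmean 2 g r1 <= pmean 2 g r2.
  move=> r10 r12 r21.
  have r101 : 0 < r1 < 1 by rewrite r10 (le_lt_trans r12).
  have r201 : 0 < r2 < 1 by rewrite r21 (lt_le_trans r10).
  rewrite !pg//; have [_ [L1 _]] := ra _ r101; have [_ [L2 _]] := ra _ r201.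
  rewrite ler_pM2l// lef_pV2 ?posrE// lerB// ler_wpM2r ?sqr_ge0//.
  by rewrite ler_sqr// nnegrE ltW// (lt_le_trans r10).
have bd r : 0 < r < 1 -> pmean 2 g r <= 2 * pi / (1 - cabs a ^+ 2).
  move=> r01; rewrite pg//; have [_ [L1 L2]] := ra _ r01.
  by rewrite ler_pM2l// lef_pV2 ?posrE// lerB.
have [hg nle] := hardy_monotone (ltr0Sn _ 1) ag mono bd.
have := H g hg.
have -> : (\int[mu]_(w in plane_disc R) (cabs (g (cpx w)) `^ 2)%:E =
  \int[mu]_(w in plane_disc R) (cabs (1 - conjc a * cpx w)^-1 ^+ 2)%:E)%E.
  apply: eq_integral => w _; by rewrite powR_sq ?cabs_ge0.
move=> /le_trans; apply.
have n0 : (0 <= hardy_norm 2 g)%E.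
  have [_ cv _] := hg; apply: lime_ge => //; near=> r; exact: poweR_ge0.
rewrite EFinM; apply: lee_pmul => //; [by rewrite lee_fin ltW|exact: poweR_ge0|].
apply: le_trans (gt0_ler_poweR (ltW (ltr0Sn _ 1)) _ _ nle) _.
- by rewrite in_itv/= n0 leey.
- by rewrite in_itv/= leey lee_fin powR_ge0.
rewrite poweR_EFin -powRrM mulVf// powRr1; last first.
  by rewrite mulr_ge0 ?divr_ge0 ?invr_ge0 ?(ltW pi0) ?(ltW a2).
rewrite lee_fin mulrA mulVf ?gt_eqF// mul1r//.
Unshelve. all: by end_near. Qed.

End hardy.

(** * The potential of a Carleson measure *)

Section potential.
Context {R : realType}.
Variable mu : {measure set (plane R) -> \bar R}.

Let E : set (plane R) := plane_disc R.

Lemma measurable_plane_disc : measurable (plane_disc R).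
Proof.
rewrite (_ : plane_disc R = [set w | cabs (cpx w - 0) < 1]).
  exact: measurable_disc.
by apply/seteqP; split => w; rewrite /plane_disc /unit_disc /mkset subr0.
Qed.

Hypothesis mufin : (mu (plane_disc R) < +oo)%E.

Lemma bounded_integrable_disc (g : plane R -> R) M : measurable_fun E g ->
  (forall w, E w -> `|g w| <= M) -> mu.-integrable E (EFin \o g).
Proof.
move=> mg bg; apply: measurable_bounded_integrable => //.
  exact: measurable_plane_disc.
exists M; split; first exact: num_real.
by move=> y My w Ew; apply: le_trans (ltW My); exact: bg.
Qed.

(** The linearisation error of the integral is at most the uniform error of
    the integrand times the mass of the disc. *)
Lemma has_grad_integral (K : plane R -> R -> R -> R) x t (Kx Kt : plane R -> R) :
  (exists2 d : R, 0 < d & forall h k, `|h| < d -> `|k| < d ->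
    measurable_fun E (fun w => K w (x + h) (t + k))) ->
  measurable_fun E Kx -> measurable_fun E Kt ->
  ugrad E K x t Kx Kt ->
  has_grad (fun x t => \int[mu]_(w in E) K w x t) x t
    (\int[mu]_(w in E) Kx w) (\int[mu]_(w in E) Kt w).
Proof.
move=> [d0 d00 mK] mKx mKt hK e e0.
have mE : measurable E by exact: measurable_plane_disc.
have [M [M0 hM [d1 d10 L]]] := ugrad_lip hK.
pose m := fine (mu E) + 1.
have mE0 : 0 <= fine (mu E) by apply: fine_ge0.
have m0 : 0 < m by rewrite /m; lra.
have em : 0 < e / m by rewrite divr_gt0.
have [d2 d20 H] := hK.2 _ em.
exists (Num.min (Num.min d0 1) (Num.min d1 d2)).
  by rewrite !lt_min d00 d10 d20 ltr01.
move=> h k; rewrite !lt_min => /andP[/andP[h0 h1] /andP[h2 h3]].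
move=> /andP[/andP[k0 k1] /andP[k2 k3]].
have IKx : mu.-integrable E (EFin \o Kx).
  by apply: (@bounded_integrable_disc _ M) => // w /hM[].
have IKt : mu.-integrable E (EFin \o Kt).
  by apply: (@bounded_integrable_disc _ M) => // w /hM[].
have IK0 : mu.-integrable E (EFin \o (fun w => K w x t)).
  apply: (@bounded_integrable_disc _ M) => [|w /hM[]//].
  by have := mK 0 0; rewrite normr0 !addr0 => /(_ d00 d00).
have IK1 : mu.-integrable E (EFin \o (fun w => K w (x + h) (t + k))).
  apply: (@bounded_integrable_disc _ (M + M * 2)) => [|w Ew]; first exact: mK.
  have [a1 _ _] := hM w Ew; have := L w h k Ew h2 k2.
  have := ler_normD (K w (x + h) (t + k) - K w x t) (K w x t); rewrite subrK.
  move: h1 k1; set S := `|K w (x + h) (t + k) - K w x t| => h1 k1 A B.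
  apply: (le_trans A); rewrite addrC; apply: lerD => //.
  by apply: (le_trans B); rewrite ler_wpM2l ?ltW//; lra.
have IKxh : mu.-integrable E (EFin \o (fun w => Kx w * h)).
  rewrite (_ : EFin \o _ = fun w => (h%:E * (EFin \o Kx) w)%E).
    exact: integrableZl.
  by apply/funext => w /=; rewrite -EFinM mulrC.
have IKtk : mu.-integrable E (EFin \o (fun w => Kt w * k)).
  rewrite (_ : EFin \o _ = fun w => (k%:E * (EFin \o Kt) w)%E).
    exact: integrableZl.
  by apply/funext => w /=; rewrite -EFinM mulrC.
have I1 : mu.-integrable E (EFin \o (fun w => K w (x + h) (t + k) - K w x t)).
  by have := integrableB mE IK1 IK0.
have I2 : mu.-integrable E (EFin \o (fun w => K w (x + h) (t + k) - K w x t - Kx w * h)).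
  by have := integrableB mE I1 IKxh.
have I3 : mu.-integrable E (EFin \o (fun w => K w (x + h) (t + k) - K w x t - Kx w * h - Kt w * k)).
  by have := integrableB mE I2 IKtk.
rewrite -!RintegralZr// -!RintegralB//.
apply: le_trans (le_normr_Rintegral mE I3) _.
have -> : e * (`|h| + `|k|) = e / m * (`|h| + `|k|) * m by field; rewrite gt_eqF.
apply: (@le_trans _ _ (\int[mu]_(w in E) (e / m * (`|h| + `|k|)))).
  apply: le_Rintegral => //.
  - exact: (integrable_norm I3).
  - apply: (@bounded_integrable_disc _ (e / m * (`|h| + `|k|))) => [|w Ew]; first exact: measurable_cst.
    by rewrite ger0_norm// mulr_ge0 ?addr_ge0// ltW.
  - by move=> w Ew; exact: H.
rewrite Rintegral_cst//; apply: ler_wpM2l.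
  by rewrite mulr_ge0 ?addr_ge0 ?(ltW em).
by rewrite /m lerDl.
Qed.

End potential.

Section kernel.
Context {R : realType}.
Implicit Types (w : plane R) (x t : R).

Let E : set (plane R) := plane_disc R.

Lemma Re_conjc (z : R[i]) : Re (conjc z) = Re z. Proof. by case: z. Qed.
Lemma Im_conjc (z : R[i]) : Im (conjc z) = - Im z. Proof. by case: z. Qed.
Lemma cabs_conjc (z : R[i]) : cabs (conjc z) = cabs z.
Proof. by case: z => u v; rewrite /cabs /= sqrrN. Qed.

(** With [z = cexp x t] and [w] read as a complex number, [kerP + i kerQ] is
    [conj z * w], while [kern], [rho] and [kerD] are [|w|^2], [|z|^2] and
    [|1 - conj z * w|^2]. *)
Definition kerP w x t : R := w.1 * (expR x * cos t) + w.2 * (expR x * sin t).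
Definition kerQ w x t : R := w.2 * (expR x * cos t) - w.1 * (expR x * sin t).
Definition kern w : R := w.1 ^+ 2 + w.2 ^+ 2.
Definition rho x : R := expR x ^+ 2.
Definition kerD w x t : R := 1 - 2 * kerP w x t + kern w * rho x.

Lemma kerPQ w x t : kerP w x t ^+ 2 + kerQ w x t ^+ 2 = kern w * rho x.
Proof.
rewrite /kerP /kerQ /kern /rho.
have cs := cos2Dsin2 t.
transitivity ((w.1 ^+ 2 + w.2 ^+ 2) * expR x ^+ 2 * (cos t ^+ 2 + sin t ^+ 2)); first by ring.
by rewrite cs mulr1.
Qed.

Lemma kerDE w x t : kerD w x t = cabs (1 - conjc (cexp x t) * cpx w) ^+ 2.
Proof.
rewrite cabs_sq /kerD; have := kerPQ w x t.
rewrite ReB ImB ReMc ImMc Re_conjc Im_conjc Re_cexp Im_cexp.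
rewrite -[Re (cpx w)]/(w.1) -[Im (cpx w)]/(w.2) -[Re 1]/(1 : R) -[Im 1]/(0 : R) => <-.
by rewrite /kerP /kerQ; ring.
Qed.

Lemma kern_lt1 w : E w -> kern w < 1.
Proof.
rewrite /E /plane_disc /unit_disc /mkset => h.
by rewrite /kern -[_ + _]/(Re (cpx w) ^+ 2 + Im (cpx w) ^+ 2) -cabs_sq expr_lt1// cabs_ge0.
Qed.

Lemma kern_ge0 w : 0 <= kern w.
Proof. by rewrite addr_ge0 ?sqr_ge0. Qed.

Lemma kerD_ge w x t : E w -> x < 0 -> (1 - expR x) ^+ 2 <= kerD w x t.
Proof.
move=> Ew x0; rewrite kerDE ler_sqr ?nnegrE ?cabs_ge0//; last first.
  by rewrite subr_ge0 ltW// expR_lt1.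
have h := cabsD (1 - conjc (cexp x t) * cpx w) (conjc (cexp x t) * cpx w).
rewrite subrK cabs1 cabsM in h.
have c : cabs (conjc (cexp x t)) = expR x by rewrite cabs_conjc cabs_cexp.
have : cabs (conjc (cexp x t)) * cabs (cpx w) <= expR x.
  by rewrite c ler_piMr ?expR_ge0// ltW.
move: h; set u := cabs _; set v := _ * _; lra.
Qed.

Lemma kerD_gt0 w x t : E w -> x < 0 -> 0 < kerD w x t.
Proof.
move=> Ew x0; apply: lt_le_trans (kerD_ge t Ew x0).
by rewrite exprn_gt0// subr_gt0 expR_lt1.
Qed.

(** The suffixes [x] and [t] stand for partial derivatives, see the lemmas
    [ugrad_ker] and following. The kernel itself is
    [(1 - |z|^2) / |1 - conj z * w|^2]. *)
Definition kerDx w x t : R := 2 * (kern w * rho x - kerP w x t).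
Definition kerI w x t : R := (kerD w x t)^-1.
Definition ker w x t : R := (1 - rho x) * kerI w x t.
Definition kerx w x t : R :=
  - 2 * rho x * kerI w x t - (1 - rho x) * kerDx w x t * kerI w x t ^+ 2.
Definition kert w x t : R := 2 * (1 - rho x) * kerQ w x t * kerI w x t ^+ 2.
Definition kerxx w x t : R :=
  - 4 * rho x * kerI w x t + 4 * rho x * kerDx w x t * kerI w x t ^+ 2
  - 2 * (1 - rho x) * (2 * kern w * rho x - kerP w x t) * kerI w x t ^+ 2
  + 2 * (1 - rho x) * kerDx w x t ^+ 2 * kerI w x t ^+ 3.
Definition kerxt w x t : R :=
  - 4 * rho x * kerQ w x t * kerI w x t ^+ 2
  + 2 * (1 - rho x) * kerQ w x t * kerI w x t ^+ 2
  - 4 * (1 - rho x) * kerDx w x t * kerQ w x t * kerI w x t ^+ 3.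
Definition kertt w x t : R :=
  - 2 * (1 - rho x) * kerP w x t * kerI w x t ^+ 2
  + 8 * (1 - rho x) * kerQ w x t ^+ 2 * kerI w x t ^+ 3.

(** The kernel is superharmonic, and most strongly so for [z] near [w]:
    minus its integral has a large Laplacian where the measure has much
    mass. *)
Lemma ker_laplacian w x t : E w -> x < 0 ->
  kerxx w x t + kertt w x t = - (4 * rho x * (1 - kern w) * kerI w x t ^+ 2).
Proof.
move=> Ew x0; have D0 := kerD_gt0 t Ew x0.
rewrite /kerxx /kertt /kerDx.
have -> : kerQ w x t ^+ 2 = kern w * rho x - kerP w x t ^+ 2.
  by rewrite -(kerPQ w x t); ring.
rewrite /kerI; move: D0; rewrite /kerD.
move: (kerP w x t) (rho x) (kern w) => p r n D0.
by field; rewrite gt_eqF.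
Qed.

Lemma has_grad_expcos x t :
  has_grad (fun x t => expR x * cos t) x t (expR x * cos t) (- (expR x * sin t)).
Proof.
have [h _] := has_cgrad_cexp x t.
apply: has_grad_eq (has_grad_near (@ltr01 R) _ h) _ _.
- by move=> u v _ _; rewrite Re_cexp.
- exact: Re_cexp.
- by rewrite ReMc Im_cexp /=; ring.
Qed.

Lemma has_grad_expsin x t :
  has_grad (fun x t => expR x * sin t) x t (expR x * sin t) (expR x * cos t).
Proof.
have [_ h] := has_cgrad_cexp x t.
apply: has_grad_eq (has_grad_near (@ltr01 R) _ h) _ _.
- by move=> u v _ _; rewrite Im_cexp.
- exact: Im_cexp.
- by rewrite ImMc Re_cexp /=; ring.
Qed.

Lemma has_grad_rho x t : has_grad (fun x _ => rho x) x t (2 * rho x) 0.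
Proof.
have h : has_grad (fun x _ : R => expR x) x t (expR x) 0.
  apply: has_grad_eq (has_grad_comp (has_grad_fst x t) (is_derive_expR x)) _ _.
    by rewrite mulr1.
  by rewrite mulr0.
have := has_gradM h h => h2.
apply: has_grad_eq (has_grad_near (@ltr01 R) _ h2) _ _.
- by move=> u v _ _; rewrite /rho expr2.
- by rewrite /rho; ring.
- by ring.
Qed.

Let coord_bound w : E w -> `|w.1 : R| <= 1 /\ `|w.2 : R| <= 1.
Proof.
rewrite /E /plane_disc /unit_disc /mkset => h; split.
  exact: le_trans (Re_le_cabs (cpx w)) (ltW h).
exact: le_trans (Im_le_cabs (cpx w)) (ltW h).
Qed.

Let uc1 x t : ugrad E (fun w _ _ => w.1 : R) x t (fun _ => 0) (fun _ => 0).
Proof. by apply: (@ugrad_cst _ _ E (fun w => w.1 : R) x t 1) => // w /coord_bound[]. Qed.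

Let uc2 x t : ugrad E (fun w _ _ => w.2 : R) x t (fun _ => 0) (fun _ => 0).
Proof. by apply: (@ugrad_cst _ _ E (fun w => w.2 : R) x t 1) => // w /coord_bound[]. Qed.

Lemma ugrad_kerP x t : ugrad E kerP x t (fun w => kerP w x t) (fun w => kerQ w x t).
Proof.
have ua := has_grad_ugrad E (has_grad_expcos x t).
have ub := has_grad_ugrad E (has_grad_expsin x t).
apply: ugrad_eq (ugradD (ugradM (uc1 x t) ua) (ugradM (uc2 x t) ub)) _ _ => w _ /=.
  by rewrite /kerP; ring.
by rewrite /kerQ; ring.
Qed.

Lemma ugradZ (W : Type) (F : set W) (u : W -> R -> R -> R) x t (ux ut : W -> R) (c : R) :
  ugrad F u x t ux ut ->
  ugrad F (fun i x t => c * u i x t) x t (fun i => c * ux i) (fun i => c * ut i).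
Proof.
move=> hu; have hc : has_grad (fun _ _ : R => c) x t 0 0 by exact: has_grad_cst.
by apply: ugrad_eq (ugradM (has_grad_ugrad F hc) hu) _ _ => i _ /=; ring.
Qed.

Lemma ugrad_kerQ x t : ugrad E kerQ x t (fun w => kerQ w x t) (fun w => - kerP w x t).
Proof.
have ua := has_grad_ugrad E (has_grad_expcos x t).
have ub := ugradZ (-1) (has_grad_ugrad E (has_grad_expsin x t)).
have h := ugradD (ugradM (uc2 x t) ua) (ugradM (uc1 x t) ub).
have -> : kerQ = (fun w x t => w.2 * (expR x * cos t) + w.1 * (-1 * (expR x * sin t))).
  by apply/funext => w; apply/funext => x'; apply/funext => t'; rewrite /kerQ; ring.
apply: ugrad_eq h _ _ => w _ /=.
  by ring.
by rewrite /kerP; ring.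
Qed.

Let un x t : ugrad E (fun w _ _ => kern w) x t (fun _ => 0) (fun _ => 0).
Proof.
apply: (@ugrad_cst _ _ E kern x t 1) => // w Ew.
by rewrite ger0_norm ?kern_ge0// ltW// kern_lt1.
Qed.

Let ur x t : ugrad E (fun _ x _ => rho x) x t (fun _ => 2 * rho x) (fun _ => 0).
Proof. exact: (has_grad_ugrad E (has_grad_rho x t)). Qed.

Let u1r x t : ugrad E (fun _ x _ => 1 - rho x) x t (fun _ => - 2 * rho x) (fun _ => 0).
Proof.
have h := has_gradB (has_grad_cst 1 x t) (has_grad_rho x t).
by apply: ugrad_eq (has_grad_ugrad E h) _ _ => w _; ring.
Qed.

Lemma ugrad_kerD x t : ugrad E kerD x t (fun w => kerDx w x t) (fun w => - 2 * kerQ w x t).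
Proof.
have h1 := ugradZ (-2) (ugrad_kerP x t).
have h2 := ugradM (un x t) (ur x t).
have h3 := has_grad_ugrad E (has_grad_cst 1 x t).
have -> : kerD = (fun w x t => (1 + -2 * kerP w x t) + kern w * rho x).
  by apply/funext => w; apply/funext => x'; apply/funext => t'; rewrite /kerD; ring.
apply: ugrad_eq (ugradD (ugradD h3 h1) h2) _ _ => w _ /=.
  by rewrite /kerDx; ring.
by ring.
Qed.

Lemma ugrad_kerI x t : x < 0 -> ugrad E kerI x t
  (fun w => - (kerDx w x t * kerI w x t ^+ 2)) (fun w => 2 * kerQ w x t * kerI w x t ^+ 2).
Proof.
move=> x0.
have m0 : 0 < (1 - expR x) ^+ 2 by rewrite exprn_gt0// subr_gt0 expR_lt1.
have hm w : E w -> (1 - expR x) ^+ 2 <= `|kerD w x t|.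
  by move=> Ew; rewrite ger0_norm; [exact: kerD_ge|exact: ltW (kerD_gt0 t Ew x0)].
apply: ugrad_eq (ugradV m0 hm (ugrad_kerD x t)) _ _ => w Ew /=.
  by rewrite /kerI mulNr exprVn.
by rewrite /kerI !mulNr opprK exprVn.
Qed.

Lemma ugrad_ker x t : x < 0 ->
  ugrad E ker x t (fun w => kerx w x t) (fun w => kert w x t).
Proof.
move=> x0; apply: ugrad_eq (ugradM (u1r x t) (ugrad_kerI t x0)) _ _ => w Ew /=.
  by rewrite /kerx; ring.
by rewrite /kert; ring.
Qed.

Let uI2 x t : x < 0 -> ugrad E (fun w x t => kerI w x t ^+ 2) x t
  (fun w => - 2 * kerDx w x t * kerI w x t ^+ 3) (fun w => 4 * kerQ w x t * kerI w x t ^+ 3).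
Proof.
move=> x0; have h := ugrad_kerI t x0.
have -> : (fun w x t => kerI w x t ^+ 2) = (fun w x t => kerI w x t * kerI w x t).
  by apply/funext => w; apply/funext => x'; apply/funext => t'; rewrite expr2.
by apply: ugrad_eq (ugradM h h) _ _ => w Ew /=; ring.
Qed.

Let uDx x t : ugrad E kerDx x t
  (fun w => 2 * (2 * kern w * rho x - kerP w x t)) (fun w => - 2 * kerQ w x t).
Proof.
have h1 := ugradZ (-2) (ugrad_kerP x t).
have h2 := ugradZ 2 (ugradM (un x t) (ur x t)).
have -> : kerDx = (fun w x t => 2 * (kern w * rho x) + -2 * kerP w x t).
  by apply/funext => w; apply/funext => x'; apply/funext => t'; rewrite /kerDx; ring.
by apply: ugrad_eq (ugradD h2 h1) _ _ => w _ /=; ring.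
Qed.

Lemma ugrad_kerx x t : x < 0 ->
  ugrad E kerx x t (fun w => kerxx w x t) (fun w => kerxt w x t).
Proof.
move=> x0.
have h1 := ugradZ (-2) (ugradM (ur x t) (ugrad_kerI t x0)).
have h2 := ugradZ (-1) (ugradM (ugradM (u1r x t) (uDx x t)) (uI2 t x0)).
have -> : kerx = (fun w x t => -2 * (rho x * kerI w x t) +
   -1 * ((1 - rho x) * kerDx w x t * kerI w x t ^+ 2)).
  by apply/funext => w; apply/funext => x'; apply/funext => t'; rewrite /kerx; ring.
apply: ugrad_eq (ugradD h1 h2) _ _ => w _ /=.
  by rewrite /kerxx; ring.
by rewrite /kerxt; ring.
Qed.

Lemma ugrad_kert x t : x < 0 ->
  ugrad E kert x t (fun w => kerxt w x t) (fun w => kertt w x t).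
Proof.
move=> x0.
have h := ugradZ 2 (ugradM (ugradM (u1r x t) (ugrad_kerQ x t)) (uI2 t x0)).
have -> : kert = (fun w x t => 2 * ((1 - rho x) * kerQ w x t * kerI w x t ^+ 2)).
  by apply/funext => w; apply/funext => x'; apply/funext => t'; rewrite /kert; ring.
apply: ugrad_eq h _ _ => w _ /=.
  by rewrite /kerxt; ring.
by rewrite /kertt; ring.
Qed.

Section measurability.
Variables (x t : R).
Notation mfun f := (measurable_fun E (f : plane R -> R)).

Let mP : mfun (fun w => kerP w x t).
Proof.
apply: measurable_funTS; have := measurable_affine (expR x * cos t) (expR x * sin t) 0.
by apply: eq_measurable_fun => w _; rewrite /kerP /= addr0 mulrC [w.2 * _]mulrC.
Qed.

Let mQ : mfun (fun w => kerQ w x t).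
Proof.
apply: measurable_funTS; have := measurable_affine (- (expR x * sin t)) (expR x * cos t) 0.
by apply: eq_measurable_fun => w _; rewrite /kerQ /=; ring.
Qed.

Let mn : mfun kern.
Proof.
apply: measurable_funTS; rewrite /kern.
apply: measurable_funD; apply: measurable_funX; [exact: measurable_fst|exact: measurable_snd].
Qed.

Let mc (c : R) : mfun (fun _ => c). Proof. exact: measurable_cst. Qed.

Let mD : mfun (fun w => kerD w x t).
Proof.
apply: measurable_funD; last by apply: measurable_funM; [exact: mn|exact: mc].
by apply: measurable_funB; [exact: mc|apply: measurable_funM; [exact: mc|exact: mP]].
Qed.

Let mI : mfun (fun w => kerI w x t).
Proof.
have -> : (fun w => kerI w x t) = (fun w => kerD w x t `^ (-1)).
  by apply/funext => w; rewrite /kerI powR_inv1// kerDE sqr_ge0.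
exact: (measurableT_comp (measurable_powR _) mD).
Qed.

Let mDx : mfun (fun w => kerDx w x t).
Proof.
apply: measurable_funM; first exact: mc.
by apply: measurable_funB; [apply: measurable_funM; [exact: mn|exact: mc]|exact: mP].
Qed.

Ltac mtac := repeat first [exact: mP | exact: mQ | exact: mn | exact: mc | exact: mI
  | exact: mDx | apply: measurable_funB | apply: measurable_funD | apply: measurable_funM
  | apply: measurable_funX].

Lemma measurable_ker : mfun (fun w => ker w x t).
Proof. rewrite /ker; mtac. Qed.
Lemma measurable_kerx : mfun (fun w => kerx w x t).
Proof. rewrite /kerx; mtac. Qed.
Lemma measurable_kert : mfun (fun w => kert w x t).
Proof. rewrite /kert; mtac. Qed.
Lemma measurable_kerxx : mfun (fun w => kerxx w x t).
Proof. rewrite /kerxx; mtac. Qed.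
Lemma measurable_kerxt : mfun (fun w => kerxt w x t).
Proof. rewrite /kerxt; mtac. Qed.
Lemma measurable_kertt : mfun (fun w => kertt w x t).
Proof. rewrite /kertt; mtac. Qed.
Lemma measurable_kerlap : mfun (fun w => (1 - kern w) * kerI w x t ^+ 2).
Proof. mtac. Qed.
End measurability.

End kernel.

Section carleson_potential.
Context {R : realType} (mu : {measure set (plane R) -> \bar R}).
Let E : set (plane R) := plane_disc R.
Hypothesis mufin : (mu (plane_disc R) < +oo)%E.

Definition phi x t : R := - \int[mu]_(w in E) ker w x t.
Definition phix x t : R := - \int[mu]_(w in E) kerx w x t.
Definition phit x t : R := - \int[mu]_(w in E) kert w x t.
Definition phixx x t : R := - \int[mu]_(w in E) kerxx w x t.
Definition phixt x t : R := - \int[mu]_(w in E) kerxt w x t.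
Definition phitt x t : R := - \int[mu]_(w in E) kertt w x t.
Definition philap x t : R := 4 * rho x * \int[mu]_(w in E) ((1 - kern w) * kerI w x t ^+ 2).

Lemma has_grad_phi x t : x < 0 -> has_grad phi x t (phix x t) (phit x t).
Proof.
move=> x0; apply: has_gradN; apply: has_grad_integral => //.
- by exists 1 => // h k _ _; exact: measurable_ker.
- exact: measurable_kerx.
- exact: measurable_kert.
- exact: ugrad_ker.
Qed.

Lemma has_grad_phix x t : x < 0 -> has_grad phix x t (phixx x t) (phixt x t).
Proof.
move=> x0; apply: has_gradN; apply: has_grad_integral => //.
- by exists 1 => // h k _ _; exact: measurable_kerx.
- exact: measurable_kerxx.
- exact: measurable_kerxt.
- exact: ugrad_kerx.
Qed.

Lemma has_grad_phit x t : x < 0 -> has_grad phit x t (phixt x t) (phitt x t).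
Proof.
move=> x0; apply: has_gradN; apply: has_grad_integral => //.
- by exists 1 => // h k _ _; exact: measurable_kert.
- exact: measurable_kerxt.
- exact: measurable_kertt.
- exact: ugrad_kert.
Qed.

Let mE : measurable E. Proof. exact: measurable_plane_disc. Qed.

(** Both [1 - |w|^2 <= 2 |1 - conj z * w|] and
    [1 - |z| <= |1 - conj z * w|]. *)
Lemma kerlap_bound w x t : E w -> x < 0 ->
  0 <= (1 - kern w) * kerI w x t ^+ 2 <= 2 / (1 - expR x) * kerI w x t.
Proof.
move=> Ew x0; have D0 := kerD_gt0 t Ew x0; have n1 := kern_lt1 Ew.
have I0 : 0 < kerI w x t by rewrite invr_gt0.
have d0 : 0 < 1 - expR x by rewrite subr_gt0 expR_lt1.
apply/andP; split; first by rewrite mulr_ge0 ?sqr_ge0// subr_ge0 ltW.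
rewrite expr2 mulrA ler_pM2r//.
set u := cabs (1 - conjc (cexp x t) * cpx w).
have uD : kerD w x t = u ^+ 2 by exact: kerDE.
have u0 : 0 <= u by exact: cabs_ge0.
have du : 1 - expR x <= u.
  by rewrite -(@ler_sqr _ (1 - expR x)) ?nnegrE ?(ltW d0)// -uD kerD_ge.
have n2 : 1 - kern w <= 2 * u.
  have ww : kern w = cabs (cpx w) ^+ 2 by rewrite cabs_sq.
  have w1 : cabs (cpx w) < 1 by exact: Ew.
  have := cabsD (1 - conjc (cexp x t) * cpx w) (conjc (cexp x t) * cpx w).
  rewrite subrK cabs1 -/u cabsM cabs_conjc cabs_cexp.
  have : expR x * cabs (cpx w) <= cabs (cpx w).
    by rewrite ler_piMl ?cabs_ge0// ltW// expR_lt1.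
  by rewrite ww; have := cabs_ge0 (cpx w); nra.
rewrite /kerI uD ler_pdivlMr// mulrAC -/u.
have u1 : 0 < u by exact: lt_le_trans du.
rewrite ler_pdivrMr ?exprn_gt0// expr2.
have : (1 - kern w) * (1 - expR x) <= 2 * u * u by apply: ler_pM => //; [rewrite subr_ge0 ltW|exact: ltW].
by rewrite mulrA.
Qed.

Lemma kerI_le w x t : E w -> x < 0 -> `|kerI w x t| <= (1 - expR x) ^- 2.
Proof.
move=> Ew x0; have D0 := kerD_gt0 t Ew x0.
rewrite ger0_norm ?invr_ge0 ?(ltW D0)// lef_pV2 ?posrE//; first exact: kerD_ge.
by rewrite exprn_gt0// subr_gt0 expR_lt1.
Qed.

Lemma kerI_integrable x t : x < 0 -> mu.-integrable E (EFin \o (fun w => kerI w x t)).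
Proof.
move=> x0; apply: (bounded_integrable_disc mufin (M := (1 - expR x) ^- 2)).
  have r1 : 1 - rho x != 0 by rewrite subr_eq0 eq_sym lt_eqF// expr_lt1 ?expR_ge0// expR_lt1.
  have := measurable_funM (measurable_cst (D := E) (1 - rho x)^-1) (measurable_ker x t).
  by apply: eq_measurable_fun => w _ /=; rewrite /ker mulrA mulVf// mul1r.
by move=> w Ew; exact: kerI_le.
Qed.

Lemma phi_laplacian x t : x < 0 -> phixx x t + phitt x t = philap x t.
Proof.
move=> x0; rewrite /phixx /phitt /philap -opprD.
have [[M1 M10 B1] _] := ugrad_kerx t x0; have [[M2 M20 B2] _] := ugrad_kert t x0.
have I1 := bounded_integrable_disc mufin (measurable_kerxx x t) (fun w Ew => let: And3 _ h _ := B1 w Ew in h).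
have I2 := bounded_integrable_disc mufin (measurable_kertt x t) (fun w Ew => let: And3 _ _ h := B2 w Ew in h).
rewrite -RintegralD//.
rewrite (@eq_Rintegral _ _ _ mu E (fun w => - (4 * rho x) * ((1 - kern w) * kerI w x t ^+ 2))); last first.
  by move=> w; rewrite inE => Ew; rewrite ker_laplacian//; ring.
rewrite RintegralZl//; first by ring.
apply: (bounded_integrable_disc mufin (M := 2 / (1 - expR x) * (1 - expR x) ^- 2)).
  exact: measurable_kerlap.
move=> w Ew; have /andP[h1 h2] := kerlap_bound t Ew x0.
rewrite ger0_norm//; apply: le_trans h2 _; apply: ler_wpM2l.
  by rewrite divr_ge0// subr_ge0 ltW// expR_lt1.
by apply: le_trans (kerI_le t Ew x0); rewrite ler_norm.
Qed.

Section bounds.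
Variable C : R.
Hypothesis C0 : 0 < C.
Hypothesis hC : forall a : R[i], cabs a < 1 ->
    (\int[mu]_(w in plane_disc R) (cabs (1 - conjc a * cpx w)^-1 ^+ 2)%:E <=
      (C / (1 - cabs a ^+ 2))%:E)%E.

Lemma kerI_integral_le x t : x < 0 ->
  \int[mu]_(w in E) kerI w x t <= C / (1 - rho x).
Proof.
move=> x0; have a1 : cabs (cexp x t) < 1 by rewrite cabs_cexp expR_lt1.
have := hC a1; rewrite cabs_cexp -/(rho x).
rewrite (_ : (\int[mu]_(w in plane_disc R) _)%E = (\int[mu]_(w in E) (kerI w x t)%:E)%E); last first.
  by apply: eq_integral => w _; rewrite /kerI kerDE cabsV exprVn.
have fn := integrable_fin_num mE (kerI_integrable t x0).
by rewrite -lee_fin /Rintegral (fineK fn).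
Qed.

Lemma rho_lt1 (x : R) : x < 0 -> rho x < 1.
Proof. by move=> x0; rewrite expr_lt1 ?expR_ge0// expR_lt1. Qed.

(** The lower bound is the Carleson condition at the point [cexp x t]. *)
Lemma phi_bounds x t : x < 0 -> - C <= phi x t <= 0.
Proof.
move=> x0; rewrite /phi lerN2 oppr_le0; have r1 := rho_lt1 x0.
have E1 : \int[mu]_(w in E) ker w x t = (1 - rho x) * \int[mu]_(w in E) kerI w x t.
  by rewrite -RintegralZl//; exact: kerI_integrable.
have r0 : 0 < 1 - rho x by rewrite subr_gt0.
rewrite E1; apply/andP; split.
  by have := kerI_integral_le t x0; rewrite ler_pdivlMr// mulrC.
apply: mulr_ge0; first exact: ltW.
by apply: Rintegral_ge0 => w Ew; rewrite invr_ge0 ltW// kerD_gt0.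
Qed.

(** Together with [philap_ge] this bounds the coefficient [A] itself. *)
Lemma philap_le x t : x < 0 -> philap x t <= 8 * C * rho x / (1 - expR x) ^+ 2.
Proof.
move=> x0; rewrite /philap; have r1 := rho_lt1 x0.
have d0 : 0 < 1 - expR x by rewrite subr_gt0 expR_lt1.
have IK := kerI_integrable t x0.
have I1 : mu.-integrable E (EFin \o (fun w => 2 / (1 - expR x) * kerI w x t)).
  rewrite (_ : EFin \o _ = fun w => ((2 / (1 - expR x))%:E * (EFin \o (fun w => kerI w x t)) w)%E).
    exact: integrableZl.
  by apply/funext => w /=; rewrite -EFinM.
have h : \int[mu]_(w in E) ((1 - kern w) * kerI w x t ^+ 2) <= 2 / (1 - expR x) * (C / (1 - rho x)).
  apply: (@le_trans _ _ (\int[mu]_(w in E) (2 / (1 - expR x) * kerI w x t))).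
    apply: le_Rintegral => //; last by move=> w Ew; have /andP[] := kerlap_bound t Ew x0.
    apply: (bounded_integrable_disc mufin (M := 2 / (1 - expR x) * (1 - expR x) ^- 2)).
      exact: measurable_kerlap.
    move=> w Ew; have /andP[h1 h2] := kerlap_bound t Ew x0.
    rewrite ger0_norm//; apply: le_trans h2 _; apply: ler_wpM2l.
      by rewrite divr_ge0// ltW.
    by apply: le_trans (kerI_le t Ew x0); rewrite ler_norm.
  rewrite RintegralZl//; apply: ler_wpM2l; first by rewrite divr_ge0// ltW.
  exact: kerI_integral_le.
have rr : 0 <= rho x by rewrite sqr_ge0.
have h2 : C / (1 - rho x) <= C / (1 - expR x).
  apply: ler_wpM2l; first exact: ltW.
  rewrite lef_pV2 ?posrE ?subr_gt0//; last by rewrite -subr_gt0.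
  by rewrite lerB// /rho expr2 ler_piMl ?expR_ge0// ltW// -subr_gt0.
apply: (@le_trans _ _ (4 * rho x * (2 / (1 - expR x) * (C / (1 - expR x))))).
  apply: ler_wpM2l; first by rewrite mulr_ge0.
  apply: (le_trans h); apply: ler_wpM2l => //; by rewrite divr_ge0// ltW.
by apply: eq_le_refl; field; rewrite gt_eqF.
Qed.

End bounds.

Section density.
Variable A : R[i] -> R[i].
Hypothesis hA : analytic_disc A.
Hypothesis hmu : has_disc_density mu
  (fun z : R[i] => cabs (A z) ^+ 2 * (1 - cabs z ^+ 2) ^+ 3).

(** The density is [|A|^2], which is subharmonic, times a weight that is at
    least [((1 - |a|) / 2)^3] on this disc. *)
Lemma mu_disc_ge (a : R[i]) : cabs a < 1 ->
  (((1 - cabs a) ^+ 5 / 32 * cabs (A a) ^+ 2)%:E <=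
    mu [set w | (cabs (cpx w - a) < (1 - cabs a) / 2)%R])%E.
Proof.
move=> a1; set d := 1 - cabs a; have d0 : 0 < d by rewrite subr_gt0.
have d20 : 0 < d / 2 by rewrite divr_gt0.
set B := [set w : plane R | cabs (cpx w - a) < d / 2].
have mB : measurable B by exact: measurable_disc.
have Bd w : B w -> cabs (cpx w) <= 1 - d / 2.
  rewrite /B /mkset => h; have := cabsD (cpx w - a) a; rewrite subrK.
  by move: h; rewrite /d; lra.
have BE : B `&` plane_disc R = B.
  apply/seteqP; split => [w []//|w Bw]; split=> //.
  by rewrite /plane_disc /unit_disc /mkset; apply: le_lt_trans (Bd w Bw) _; lra.
rewrite hmu// BE.
have dA u : cabs (u - a) < d / 2 -> derivable (A : R[i]^o -> R[i]^o) u 1.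
  move=> h; apply: hA; rewrite /unit_disc /mkset.
  have := cabsD (u - a) a; rewrite subrK; move: h; rewrite /d; lra.
have := area_sub_mean d20 dA; rewrite -/B => S.
have d3 : 0 <= (d / 2) ^+ 3 by rewrite exprn_ge0// ltW.
have mA : measurable_fun B (fun w => (cabs (A (cpx w)) ^+ 2)%:E).
  apply/measurable_EFinP; have := measurable_disc_sq dA.
  move=> /(@measurable_funTS _ _ _ _ B); apply: eq_measurable_fun => w.
  by rewrite inE /disc_sq => Bw; rewrite ifT.
have mk : measurable_fun B (fun w : plane R => (1 - cabs (cpx w) ^+ 2) ^+ 3).
  apply: measurable_funTS.
  have -> : (fun w : plane R => (1 - cabs (cpx w) ^+ 2) ^+ 3) = (fun w => (1 - kern w) ^+ 3).
    by apply/funext => w; rewrite cabs_sq.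
  apply: measurable_funX; apply: measurable_funB; first exact: measurable_cst.
  by apply: measurable_funD; apply: measurable_funX; [exact: measurable_fst|exact: measurable_snd].
apply: (@le_trans _ _ (((d / 2) ^+ 3)%:E * \int[area R]_(w in B) (cabs (A (cpx w)) ^+ 2)%:E)%E).
  rewrite (_ : d ^+ 5 / 32 * _ = (d / 2) ^+ 3 * ((d / 2) ^+ 2 * cabs (A a) ^+ 2)); last by field.
  by rewrite EFinM; apply: lee_wpmul2l => //; rewrite lee_fin.
rewrite -ge0_integralZl//; last by move=> w _; rewrite lee_fin sqr_ge0.
apply: ge0_le_integral => //.
- by move=> w _; rewrite -EFinM lee_fin mulr_ge0 ?sqr_ge0.
- exact: emeasurable_funM.
- apply/measurable_EFinP; apply: measurable_funM => //.
  exact/measurable_EFinP.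
- move=> w Bw; rewrite -EFinM lee_fin mulrC; apply: ler_wpM2l; first exact: sqr_ge0.
  have w1 := Bd w Bw; apply: lerXn2r; rewrite ?nnegrE ?(ltW d20)//.
    by have := cabs_ge0 (cpx w); nra.
  by have := cabs_ge0 (cpx w); nra.
Qed.

(** With [z = cexp x t] and [d = 1 - |z|], for [w] within [d / 2] of [z] one
    has [|1 - conj z * w| <= 3 d] and [1 - |w|^2 >= d / 2], and [mu_disc_ge]
    bounds the mass of these [w] from below. The constant is
    [1296 = 2 * 3^4 * 32 / 4]. *)
Lemma philap_ge x t : x < 0 ->
  rho x * (1 - expR x) ^+ 2 * cabs (A (cexp x t)) ^+ 2 / 1296 <= philap x t.
Proof.
move=> x0; pose a := cexp x t; have ax : cabs a = expR x by exact: cabs_cexp.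
have a1 : cabs a < 1 by rewrite ax expR_lt1.
have := mu_disc_ge a1; rewrite ax; set d := 1 - expR x => S.
have d0 : 0 < d by rewrite subr_gt0 expR_lt1.
set B := [set w : plane R | cabs (cpx w - a) < d / 2] in S.
have mB : measurable B by exact: measurable_disc.
have Bd w : B w -> cabs (cpx w) <= 1 - d / 2.
  rewrite /B /mkset => h; have := cabsD (cpx w - a) a; rewrite subrK ax.
  by move: h; rewrite /d; lra.
have BE : B `<=` E.
  by move=> w Bw; rewrite /E /plane_disc /unit_disc /mkset; apply: le_lt_trans (Bd w Bw) _; lra.
have low w : B w -> 1 / (162 * d ^+ 3) <= (1 - kern w) * kerI w x t ^+ 2.
  move=> Bw; have Ew := BE w Bw; have D0 := kerD_gt0 t Ew x0.
  have w1 := Bd w Bw; have ww : kern w = cabs (cpx w) ^+ 2 by rewrite cabs_sq.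
  have k1 : d / 2 <= 1 - kern w by rewrite ww; have := cabs_ge0 (cpx w); nra.
  have Dd : kerD w x t <= (3 * d) ^+ 2.
    rewrite kerDE ler_sqr ?nnegrE ?cabs_ge0 ?mulr_ge0 ?(ltW d0)//.
    have -> : 1 - conjc (cexp x t) * cpx w = (1 - conjc a * a) + conjc a * (a - cpx w).
      by rewrite /a; ring.
    apply: le_trans (cabsD _ _) _; rewrite cabsM cabs_conjc ax cabsB.
    have e1 : cabs (1 - conjc a * a) = 1 - expR x ^+ 2.
      have -> : 1 - conjc a * a = (1 - expR x ^+ 2)%:C.
        have := cabs_sq a; rewrite ax; case: (a) => p q /= ->.
        by apply/eqP; rewrite eq_complex /=; apply/andP; split; apply/eqP; ring.
      by rewrite cabs_real ger0_norm// subr_ge0 ltW// rho_lt1.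
    have e0 := expR_ge0 x.
    have : expR x * cabs (cpx w - a) <= d / 2.
      apply: (@le_trans _ _ (1 * (d / 2))); last by rewrite mul1r.
      by apply: ler_pM => //; [exact: cabs_ge0|rewrite -subr_ge0 ltW|exact: ltW].
    by rewrite e1; move: d0; rewrite /d; nra.
  apply: (@le_trans _ _ (d / 2 * ((3 * d) ^+ 2)^-1 ^+ 2)).
    by apply: eq_le_refl; field; rewrite gt_eqF.
  apply: ler_pM => //.
  - by rewrite divr_ge0// ltW.
  - exact: sqr_ge0.
  - have p9 : 0 < (3 * d) ^+ 2 by rewrite exprn_gt0// mulr_gt0.
    apply: lerXn2r; rewrite ?nnegrE ?invr_ge0 ?(ltW p9) ?(ltW D0)//.
    by rewrite lef_pV2 ?posrE.
have IL : mu.-integrable E (EFin \o (fun w => (1 - kern w) * kerI w x t ^+ 2)).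
  apply: (bounded_integrable_disc mufin (M := 2 / (1 - expR x) * (1 - expR x) ^- 2)).
    exact: measurable_kerlap.
  move=> w Ew; have /andP[h1 h2] := kerlap_bound t Ew x0.
  rewrite ger0_norm//; apply: le_trans h2 _; apply: ler_wpM2l.
    by rewrite divr_ge0// ltW.
  by apply: le_trans (kerI_le t Ew x0); rewrite ler_norm.
have c0 : 0 < 1 / (162 * d ^+ 3) by rewrite divr_gt0// mulr_gt0// exprn_gt0.
have main : 1 / (162 * d ^+ 3) * (d ^+ 5 / 32 * cabs (A a) ^+ 2) <=
    \int[mu]_(w in E) ((1 - kern w) * kerI w x t ^+ 2).
  rewrite -lee_fin /Rintegral fineK; last exact: (integrable_fin_num mE IL).
  apply: (@le_trans _ _ (\int[mu]_(w in B) (1 / (162 * d ^+ 3))%:E)%E).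
    rewrite integral_cst// EFinM; apply: lee_wpmul2l => //.
    by rewrite lee_fin ltW.
  apply: (@le_trans _ _ (\int[mu]_(w in B) ((1 - kern w) * kerI w x t ^+ 2)%:E)%E).
    apply: ge0_le_integral => //.
    - by move=> w _; rewrite lee_fin ltW.
    - by apply/measurable_EFinP; exact: (measurable_funS mE BE (measurable_kerlap x t)).
  apply: ge0_subset_integral => //.
  - by apply/measurable_EFinP; exact: measurable_kerlap.
  - by move=> w Ew; rewrite lee_fin; have /andP[] := kerlap_bound t Ew x0.
rewrite /philap.
apply: le_trans (ler_wpM2l _ main); last by rewrite mulr_ge0 ?sqr_ge0.
by apply: eq_le_refl; rewrite /a; field; rewrite gt_eqF.
Qed.

End density.

End carleson_potential.

(** * Growth of the derivative of a normal solution *)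

Section segments.
Context {R : realType}.
Implicit Types (z v c : R[i]).

Lemma has_grad_is_derive (u : R -> R -> R) x t ux ut : has_grad u x t ux ut ->
  is_derive x 1 (u^~ t) ux.
Proof.
move=> hu.
have cv : h^-1 *: (u (h *: 1 + x) t - u x t) @[h --> 0^'] --> ux.
  apply/cvgrPdist_le => e e0; have [d d0 H] := hu e e0.
  near=> h.
  have h0 : h != 0 by near: h; exact: nbhs_dnbhs_neq.
  have hd : `|h| < d.
    by near: h; apply: dnbhs0_lt.
  have := H h 0 hd; rewrite normr0 !addr0 mulr0 subr0 => /(_ d0) K.
  rewrite [h *: 1]mulr1 [h + x]addrC distrC.
  rewrite (_ : h^-1 *: _ - ux = h^-1 * (u (x + h) t - u x t - ux * h)); last first.
    by rewrite /GRing.scale/=; field.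
  by rewrite normrM normfV mulrC ler_pdivrMr ?normr_gt0.
apply: DeriveDef; first by apply/cvg_ex; exists ux.
exact: cvg_lim.
Unshelve. all: by end_near. Qed.

Lemma is_derive_bound (u du : R -> R) M : (forall s : R, 0 <= s <= 1 -> is_derive s 1 u (du s)) ->
  (forall s : R, 0 <= s <= 1 -> `|du s| <= M) -> `|u 1 - u 0| <= M.
Proof.
move=> hu hM.
have [||c] := @MVT _ u du 0 1 (@ltr01 R).
- by move=> x; rewrite in_itv/= => /andP[x0 x1]; apply: hu; rewrite !ltW.
- apply: derivable_within_continuous => x; rewrite in_itv/= => x01.
  by have [] := hu x x01.
rewrite in_itv/= => /andP[c0 c1] ->; rewrite subr0 mulr1; apply: hM.
by rewrite !ltW.
Qed.

Definition seg z v (s : R) : R[i] := z + s%:C * v.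

Lemma has_cgrad_seg z v x t : has_cgrad (fun x _ => seg z v x) x t v 0.
Proof.
apply/has_cgradP => e e0; exists 1 => // h k _ _.
have -> : seg z v (x + h) - seg z v x - v * h%:C - 0 * k%:C = 0.
  by rewrite /seg rmorphD /=; ring.
by rewrite cabs0 mulr_ge0 ?addr_ge0 ?(ltW e0).
Qed.

Lemma has_grad_seg (f : R[i]^o -> R[i]^o) z v s t : derivable f (seg z v s) 1 ->
  has_cgrad (fun x _ => f (seg z v x)) s t (derive1 f (seg z v s) * v) 0.
Proof.
move=> df; have := @has_cgrad_comp _ f (fun x _ => seg z v x) s t _ _ (has_cgrad_seg z v s t) df.
by rewrite mulr0.
Qed.

(** The mean value inequality for the real and imaginary parts of
    [f (z + s v) - s (c v)] as functions of [s], whence the factor [2]. *)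
Lemma seg_bound (f : R[i]^o -> R[i]^o) z v c M :
  (forall s, 0 <= s <= 1 -> derivable f (seg z v s) 1) ->
  (forall s, 0 <= s <= 1 -> cabs (derive1 f (seg z v s) - c) <= M) ->
  cabs (f (z + v) - f z - c * v) <= 2 * M * cabs v.
Proof.
move=> df hM.
have z0 : seg z v 0 = z by rewrite /seg mul0r addr0.
have z1 : seg z v 1 = z + v by rewrite /seg mul1r.
have B s : 0 <= s <= 1 -> cabs ((derive1 f (seg z v s) - c) * v) <= M * cabs v.
  by move=> s01; rewrite cabsM ler_wpM2r ?cabs_ge0// hM.
have K1 : `|(Re (f (z + v)) - Re (c * v)) - Re (f z)| <= M * cabs v.
  have := @is_derive_bound (fun s => Re (f (seg z v s)) - Re (c * v) * s)
    (fun s => Re (derive1 f (seg z v s) * v) - Re (c * v)) (M * cabs v).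
  rewrite z0 z1 mulr1 mulr0 subr0; apply=> s s01.
    have [h _] := has_grad_seg 0 (df s s01).
    have g := has_gradB h (has_gradM (has_grad_cst (Re (c * v)) s 0) (has_grad_fst s 0)).
    have := has_grad_is_derive g; rewrite mul0r add0r mulr1; exact.
  by rewrite -ReB -mulrBl; apply: le_trans (Re_le_cabs _) _; exact: B.
have K2 : `|(Im (f (z + v)) - Im (c * v)) - Im (f z)| <= M * cabs v.
  have := @is_derive_bound (fun s => Im (f (seg z v s)) - Im (c * v) * s)
    (fun s => Im (derive1 f (seg z v s) * v) - Im (c * v)) (M * cabs v).
  rewrite z0 z1 mulr1 mulr0 subr0; apply=> s s01.
    have [_ h] := has_grad_seg 0 (df s s01).
    have g := has_gradB h (has_gradM (has_grad_cst (Im (c * v)) s 0) (has_grad_fst s 0)).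
    have := has_grad_is_derive g; rewrite mul0r add0r mulr1; exact.
  by rewrite -ImB -mulrBl; apply: le_trans (Im_le_cabs _) _; exact: B.
apply: le_trans (cabs_le_ReIm _) _; rewrite !ReB !ImB.
rewrite (addrAC (Re _)) (addrAC (Im _)); apply: le_trans (lerD K1 K2) _.
by apply: eq_le_refl; ring.
Qed.

Lemma seg_max (f : R[i]^o -> R[i]^o) z v :
  (forall s, 0 <= s <= 1 -> derivable f (seg z v s) 1) ->
  exists2 s, 0 <= s <= 1 & forall r, 0 <= r <= 1 -> cabs (f (seg z v r)) <= cabs (f (seg z v s)).
Proof.
move=> df.
have cf : {within `[(0 : R), 1], continuous (fun s => Re (f (seg z v s)) * Re (f (seg z v s)) + Im (f (seg z v s)) * Im (f (seg z v s)))}.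
  apply: ccontP => s; rewrite in_itv/= => s01; have [h1 h2] := has_grad_seg 0 (df s s01).
  have := has_grad_continuousx (has_gradD (has_gradM h1 h1) (has_gradM h2 h2)).
  exact.
have [s] := EVT_max (@ler01 R) cf; rewrite in_itv/= => s01 hs.
exists s => // r r01; have := hs r; rewrite in_itv/= => /(_ r01).
by rewrite -!expr2 -!cabs_sq ler_sqr ?nnegrE ?cabs_ge0.
Qed.

(** The derivative of [1 / (1 + |f|^2)] is at most
    [2 |f| |f'| / (1 + |f|^2)^2], and [2 |f| <= 1 + |f|^2]. *)
Lemma inv_lmod_lipschitz (f : R[i]^o -> R[i]^o) z v M :
  (forall s, 0 <= s <= 1 -> derivable f (seg z v s) 1) ->
  (forall s, 0 <= s <= 1 ->
    cabs (derive1 f (seg z v s)) <= M * (1 + cabs (f (seg z v s)) ^+ 2)) ->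
  `|(1 + cabs (f (z + v)) ^+ 2)^-1 - (1 + cabs (f z) ^+ 2)^-1| <= M * cabs v.
Proof.
move=> df hM.
have z0 : seg z v 0 = z by rewrite /seg mul0r addr0.
have z1 : seg z v 1 = z + v by rewrite /seg mul1r.
pose a s := Re (f (seg z v s)); pose b s := Im (f (seg z v s)).
pose n s := 1 + (a s * a s + b s * b s).
have nE s : n s = 1 + cabs (f (seg z v s)) ^+ 2 by rewrite cabs_sq /n !expr2.
have n1 s : 1 <= n s by rewrite nE lerDl sqr_ge0.
have n0 s : 0 < n s by exact: lt_le_trans ltr01 (n1 s).
pose da s := Re (derive1 f (seg z v s) * v); pose db s := Im (derive1 f (seg z v s) * v).
have := @is_derive_bound (fun s => (n s)^-1)
  (fun s => - (n s) ^- 2 * (2 * (a s * da s + b s * db s))) (M * cabs v).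
rewrite !nE z0 z1; apply=> s s01.
  have [h1 h2] := has_grad_seg 0 (df s s01); rewrite -/(da s) -/(db s) in h1 h2.
  have g := has_gradD (has_grad_cst 1 s 0) (has_gradD (has_gradM h1 h1) (has_gradM h2 h2)).
  have nz : 1 + (a s * a s + b s * b s) != 0 by rewrite -/(n s) gt_eqF.
  have := has_grad_is_derive (@has_gradV _ (fun x _ => 1 + (a x * a x + b x * b x)) s 0 _ _ nz g).
  rewrite (_ : - (0 + _) / _ = - (n s) ^- 2 * (2 * (a s * da s + b s * db s))); first exact.
  rewrite -/(n s) mulNr mulNr mulrC; congr (- (_ * _)); rewrite /a /b; ring.
have := hM s s01; rewrite -nE.
set D := derive1 f _ => HD.
have C1 : `|a s * da s + b s * db s| <= cabs (f (seg z v s)) * cabs (D * v).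
  have -> : a s * da s + b s * db s = Re (conjc (f (seg z v s)) * (D * v)).
    by rewrite ReMc Re_conjc Im_conjc mulNr opprK.
  by apply: le_trans (Re_le_cabs _) _; rewrite cabsM cabs_conjc.
have D1 : cabs (D * v) <= M * n s * cabs v by rewrite cabsM ler_wpM2r ?cabs_ge0.
have F1 : 2 * cabs (f (seg z v s)) <= n s.
  rewrite nE; have := sqr_ge0 (cabs (f (seg z v s)) - 1); nra.
have v0 := cabs_ge0 (D * v).
rewrite normrM normrN normfV (ger0_norm (sqr_ge0 (n s))) [`|2 * _|]normrM.
rewrite (ger0_norm (ler0n _ 2)) mulrC ler_pdivrMr ?exprn_gt0//.
apply: (@le_trans _ _ (n s * cabs (D * v))).
  apply: (@le_trans _ _ (2 * (cabs (f (seg z v s)) * cabs (D * v)))).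
    by rewrite ler_pM2l.
  by rewrite mulrA ler_wpM2r.
apply: (@le_trans _ _ (n s * (M * n s * cabs v))).
  by rewrite ler_wpM2l// ltW.
by apply: eq_le_refl; ring.
Qed.

End segments.

Section newton.
Context {R : realType}.
Implicit Types (z v : R[i]).

Lemma seg_norm z v (s : R) : 0 <= s <= 1 -> cabs (seg z v s - z) <= cabs v.
Proof.
move=> /andP[s0 s1]; rewrite /seg addrC addKr cabsM cabs_real ger0_norm//.
by rewrite ler_piMl ?cabs_ge0.
Qed.

(** Newton iteration with the slope frozen at [G0] halves [|f|] at each
    step, and its steps add up to at most [2 q]. *)
Lemma approximate_zero (f : R[i]^o -> R[i]^o) z0 (G0 : R[i]) :
  G0 != 0 -> let q := cabs (f z0) / cabs G0 in
  (forall z, cabs (z - z0) <= 2 * q -> derivable f z 1) ->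
  (forall z, cabs (z - z0) <= 2 * q -> cabs (derive1 f z - G0) <= cabs G0 / 4) ->
  forall n, exists2 z, cabs (z - z0) <= (2 - 2 * 2 ^- n) * q &
    cabs (f z) <= 2 ^- n * cabs (f z0).
Proof.
move=> G00 q df hf; have G0p : 0 < cabs G0 by rewrite cabs_gt0.
have q0 : 0 <= q by rewrite divr_ge0 ?cabs_ge0.
elim=> [|n [z zn fz]].
  exists z0; rewrite expr0 invr1; first by rewrite subrr cabs0 mulr1 subrr mul0r.
  by rewrite mul1r.
pose h : R := 2 ^- n; have h0 : 0 < h by rewrite invr_gt0 exprn_gt0.
have hS : 2 ^- n.+1 = h / 2 by rewrite exprS invfM mulrC.
rewrite hS; rewrite -/h in zn fz.
pose v := - (f z / G0).
have vq : cabs v <= h * q.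
  by rewrite /v cabsN cabsM cabsV /q mulrA ler_pM2r ?invr_gt0.
have inb s : 0 <= s <= 1 -> cabs (seg z v s - z0) <= 2 * q.
  move=> s01; rewrite (_ : seg z v s - z0 = (seg z v s - z) + (z - z0)); last by ring.
  apply: le_trans (cabsD _ _) _; have := seg_norm z v s01; move: zn vq h0 q0.
  set a := cabs _; set b := cabs _; set c := cabs _; nra.
have := @seg_bound _ f z v G0 (cabs G0 / 4) (fun s s01 => df _ (inb s s01))
  (fun s s01 => hf _ (inb s s01)).
have -> : f (z + v) - f z - G0 * v = f (z + v) by rewrite /v; field.
move=> B; exists (z + v).
  rewrite (_ : z + v - z0 = (z - z0) + v); last by ring.
  apply: le_trans (cabsD _ _) _; move: zn vq; set a := cabs _; set b := cabs _; lra.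
apply: (le_trans B).
have -> : 2 * (cabs G0 / 4) * cabs v = cabs (f z) / 2.
  by rewrite /v cabsN cabsM cabsV; field; rewrite gt_eqF.
by rewrite mulrAC ler_pM2r.
Qed.

Variables (f A : R[i]^o -> R[i]^o) (K sigma : R).
Hypotheses (af : analytic_disc f) (af' : analytic_disc (derive1 f)).
Hypothesis ode : forall z, unit_disc R z -> derive1 (derive1 f) z + A z * f z = 0.
Hypothesis K0 : 0 <= K.
Hypothesis hK : forall z, cabs z < 1 -> cabs (A z) * (1 - cabs z) ^+ 2 <= K.
Hypothesis s0 : 0 <= sigma.
Hypothesis hs : forall z, cabs z < 1 ->
  (1 - cabs z) * cabs (derive1 f z) <= sigma * (1 + cabs (f z) ^+ 2).

(** [8] keeps the disc of radius [8 q] around [z0] inside the unit disc,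
    [640 K] makes [f'] vary by at most a quarter on the disc of radius
    [2 q], and [14 sigma] contradicts normality, where
    [q = |f z0| / |f' z0|]. *)
Let Lam := 8 + 640 * K + 14 * sigma.

(** If the inequality fails, the equation keeps [f'] within a quarter of its
    value at [z0] on a disc in which [approximate_zero] finds points with
    [|f| <= 1 / 2]. There [1 / (1 + |f|^2)] is at least [4 / 5], while it is
    at most [1 / 2] at [z0]: too large a variation over a short hyperbolic
    distance. *)
Lemma derive_le_large z0 : cabs z0 < 1 -> 1 < cabs (f z0) ->
  (1 - cabs z0) * cabs (derive1 f z0) <= Lam * cabs (f z0).
Proof.
move=> z01 F1; rewrite leNgt; apply/negP => HG.
set d := 1 - cabs z0 in HG; set G0 := derive1 f z0 in HG.
have d0 : 0 < d by rewrite subr_gt0.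
have F0 : 0 < cabs (f z0) by exact: lt_trans F1.
have L8 : 8 <= Lam by move: K0 s0; rewrite /Lam; lra.
have L0 : 0 < Lam by lra.
have dG : 0 < d * cabs G0 by apply: lt_trans HG; rewrite mulr_gt0.
have G0p : 0 < cabs G0 by rewrite pmulr_rgt0 in dG.
pose q := cabs (f z0) / cabs G0.
have q0 : 0 < q by rewrite divr_gt0.
have qE : q * cabs G0 = cabs (f z0) by rewrite divfK// gt_eqF.
have qd : Lam * q < d.
  by rewrite -(ltr_pM2r G0p) -mulrA qE.
have q8 : 8 * q < d by apply: le_lt_trans qd; rewrite ler_pM2r.
have inb z : cabs (z - z0) <= 2 * q -> d / 2 <= 1 - cabs z.
  by move=> h; have := cabsD (z - z0) z0; rewrite subrK; move: h q8; rewrite /d; lra.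
have ind z : cabs (z - z0) <= 2 * q -> cabs z < 1 by move=> /inb; lra.
pose k := 4 * K / d ^+ 2.
have k0 : 0 <= k by apply: divr_ge0; [exact: mulr_ge0|exact: sqr_ge0].
have f2 z : cabs (z - z0) <= 2 * q -> cabs (derive1 (derive1 f) z) <= k * cabs (f z).
  move=> h; have z1 := ind z h; have /eqP := ode z1; rewrite addr_eq0 => /eqP ->.
  rewrite cabsN cabsM ler_wpM2r ?cabs_ge0// /k ler_pdivlMr ?exprn_gt0//.
  have := hK z1; have : (d / 2) ^+ 2 <= (1 - cabs z) ^+ 2.
    by apply: lerXn2r; rewrite ?nnegrE ?divr_ge0 ?(ltW d0)// ?subr_ge0 ?(ltW z1)// inb.
  move=> /(ler_wpM2l (cabs_ge0 (A z))) h1 h2.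
  have := le_trans h1 h2; rewrite expr_div_n mulrA ler_pdivrMr//; lra.
have kq : k * (2 * q) ^+ 2 <= 1 / 40.
  have e1 : q ^+ 2 * Lam ^+ 2 <= d ^+ 2.
    rewrite -exprMn mulrC; apply: lerXn2r; rewrite ?nnegrE; last exact: ltW.
      by apply: mulr_ge0; exact: ltW.
    exact: ltW.
  have e2 : 640 * K <= Lam ^+ 2.
    have : Lam <= Lam ^+ 2 by rewrite expr2; nra.
    by move: s0 K0; rewrite /Lam; lra.
  have -> : k * (2 * q) ^+ 2 = 4 * K * (2 * q) ^+ 2 / d ^+ 2.
    by rewrite /k; field; rewrite gt_eqF.
  rewrite ler_pdivrMr ?exprn_gt0//.
  apply: (@le_trans _ _ (1 / 40 * (q ^+ 2 * Lam ^+ 2))); last by rewrite ler_wpM2l.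
  have -> : 4 * K * (2 * q) ^+ 2 = 1 / 40 * (q ^+ 2 * (640 * K)) by field.
  by rewrite ler_wpM2l// ler_wpM2l ?sqr_ge0.
(* The equation bounds the second derivative by [k |f|]; integrating twice
   up to the point of the segment where [|f|] is largest bounds that maximum
   by [4 |f z0|]. *)
have growth v : cabs v <= 2 * q -> forall s, 0 <= s <= 1 ->
    cabs (derive1 f (seg z0 v s) - G0) <= cabs G0 / 4.
  move=> vq.
  have inv s : 0 <= s <= 1 -> cabs (seg z0 v s - z0) <= 2 * q.
    by move=> s01; apply: le_trans (seg_norm _ _ s01) vq.
  have df s : 0 <= s <= 1 -> derivable f (seg z0 v s) 1.
    by move=> s01; apply: af; exact: ind (inv s s01).
  have [m m01 hm] := seg_max df.
  set S := cabs (f (seg z0 v m)) in hm.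
  have S0 : 0 <= S by exact: cabs_ge0.
  have sub s r : 0 <= s <= 1 -> 0 <= r <= 1 ->
      seg z0 (s%:C * v) r = seg z0 v (r * s) /\ 0 <= r * s <= 1.
    move=> /andP[p1 p2] /andP[p3 p4]; split; last by apply/andP; split; nra.
    by rewrite /seg rmorphM /= mulrA.
  have svq s : 0 <= s <= 1 -> cabs (s%:C * v) <= 2 * q.
    move=> /andP[p1 p2]; rewrite cabsM cabs_real ger0_norm//.
    by apply: le_trans vq; rewrite ler_piMl ?cabs_ge0.
  have B1 s : 0 <= s <= 1 -> cabs (derive1 f (seg z0 v s) - G0) <= 2 * (k * S) * (2 * q).
    move=> s01; have := @seg_bound _ (derive1 f) z0 (s%:C * v) 0 (k * S).
    rewrite mul0r subr0 => h; apply: (@le_trans _ _ (2 * (k * S) * cabs (s%:C * v))).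
      apply: h => r r01; have [-> rs] := sub s r s01 r01.
        by apply: af'; exact: ind (inv _ rs).
      rewrite subr0; apply: le_trans (f2 _ (inv _ rs)) _.
      by rewrite ler_wpM2l// hm.
    by apply: ler_wpM2l; [apply: mulr_ge0 => //; exact: mulr_ge0|exact: svq].
  have B2 : cabs (f (z0 + m%:C * v) - f z0 - G0 * (m%:C * v)) <=
      2 * (2 * (k * S) * (2 * q)) * (2 * q).
    have := @seg_bound _ f z0 (m%:C * v) G0 (2 * (k * S) * (2 * q)).
    move=> h; apply: (@le_trans _ _ (2 * (2 * (k * S) * (2 * q)) * cabs (m%:C * v))).
      apply: h => r r01; have [-> rs] := sub m r m01 r01.
        exact: df.
      exact: B1.
    apply: ler_wpM2l; last exact: svq.
    by apply: mulr_ge0 => //; apply: mulr_ge0; apply: mulr_ge0 => //; [exact: mulr_ge0|exact: ltW].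
  have SE : S <= 3 * cabs (f z0) + S / 10.
    have e1 := cabsD (f (z0 + m%:C * v) - f z0 - G0 * (m%:C * v)) (f z0 + G0 * (m%:C * v)).
    rewrite (_ : _ + (f z0 + _) = f (z0 + m%:C * v)) in e1; last by ring.
    have e2 := cabsD (f z0) (G0 * (m%:C * v)).
    have e3 : cabs (G0 * (m%:C * v)) <= 2 * cabs (f z0).
      rewrite cabsM -qE mulrA mulrC ler_pM2r//; exact: svq.
    have e4 : 2 * (2 * (k * S) * (2 * q)) * (2 * q) <= S / 10.
      rewrite (_ : _ * (2 * q) = 4 * S * (k * (2 * q) ^+ 2)); last by ring.
      have : 4 * S * (k * (2 * q) ^+ 2) <= 4 * S * (1 / 40) by rewrite ler_wpM2l ?mulr_ge0.
      lra.
    by move: e1 e2 e3 e4 B2; rewrite -/(seg z0 v m) -/S; lra.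
  move=> s s01; apply: le_trans (B1 s s01) _.
  have S4 : S <= 4 * cabs (f z0) by lra.
  have : k * (2 * q) ^+ 2 * (2 * cabs G0) <= 1 / 40 * (2 * cabs G0).
    by rewrite ler_wpM2r// mulr_ge0// ltW.
  have : 2 * (k * S) * (2 * q) <= 2 * (k * (4 * cabs (f z0))) * (2 * q).
    apply: ler_wpM2r; first by rewrite mulr_ge0// ltW.
    by apply: ler_wpM2l => //; exact: ler_wpM2l.
  have -> : 2 * (k * (4 * cabs (f z0))) * (2 * q) = 2 * (k * (2 * q) ^+ 2 * (2 * cabs G0)).
    by rewrite -qE; ring.
  lra.
have dfb z : cabs (z - z0) <= 2 * q -> cabs (derive1 f z - G0) <= cabs G0 / 4.
  move=> h; have := growth _ h 1; rewrite /seg mul1r (addrC z0) subrK.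
  by apply; rewrite ler01 lexx.
have afb z : cabs (z - z0) <= 2 * q -> derivable f z 1.
  by move=> /ind h; exact: af.
have G0n : G0 != 0 by rewrite -cabs_gt0.
have zer := @approximate_zero f z0 G0 G0n afb dfb.
have e0 : 0 < 1 / (2 * cabs (f z0)) by rewrite divr_gt0// mulr_gt0.
have [n _ /(_ n (leqnn n)) /= hn] := near_infty_natSinv_expn_lt (PosNum e0).
have [zn zn1 zn2] := zer n.
rewrite div1r in hn.
have h0 : 0 < (2 : R) ^- n by rewrite invr_gt0 exprn_gt0.
have fzn : cabs (f zn) <= 1 / 2.
  apply: (le_trans zn2); move: hn; rewrite ltr_pdivlMr ?mulr_gt0//; lra.
have znq : cabs (zn - z0) <= 2 * q.
  by apply: (le_trans zn1); rewrite ler_pM2r//; lra.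
have := @inv_lmod_lipschitz _ f z0 (zn - z0) (2 * sigma / d).
have inv s : 0 <= s <= 1 -> cabs (seg z0 (zn - z0) s - z0) <= 2 * q.
  by move=> s01; apply: le_trans (seg_norm _ _ s01) znq.
move=> /(_ (fun s s01 => afb _ (inv s s01))); rewrite (addrC z0) subrK => KK.
have {KK} : `|(1 + cabs (f zn) ^+ 2)^-1 - (1 + cabs (f z0) ^+ 2)^-1| <= 2 * sigma / d * (2 * q).
  apply: le_trans (KK _) _; last by rewrite ler_wpM2l// divr_ge0 ?mulr_ge0// ltW.
  move=> s s01; have h1 := inb _ (inv s s01); have h2 := hs (ind _ (inv s s01)).
  have h3 : d / 2 * cabs (derive1 f (seg z0 (zn - z0) s)) <= sigma * (1 + cabs (f (seg z0 (zn - z0) s)) ^+ 2).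
    by apply: le_trans h2; rewrite ler_wpM2r ?cabs_ge0.
  rewrite mulrAC ler_pdivlMr//; move: h3.
  move: (cabs (derive1 f _)) (1 + _ ^+ 2) => Y X h3.
  rewrite (_ : Y * d = 2 * (d / 2 * Y)); last by field.
  by rewrite -(mulrA 2) ler_pM2l.
rewrite ler_norml => /andP[_].
have a1 : 4 / 5 <= (1 + cabs (f zn) ^+ 2)^-1.
  have : cabs (f zn) ^+ 2 <= (1 / 2) ^+ 2.
    by apply: lerXn2r; rewrite ?nnegrE ?cabs_ge0.
  have -> : (4 / 5 : R) = (1 + (1 / 2) ^+ 2)^-1 by field.
  have p1 : 0 < 1 + (1 / 2 : R) ^+ 2 by apply: ltr_wpDr => //; exact: sqr_ge0.
  have p2 : 0 < 1 + cabs (f zn) ^+ 2 by apply: ltr_wpDr => //; exact: sqr_ge0.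
  by move=> h; rewrite lef_pV2 ?posrE// lerD2l.
have a2 : (1 + cabs (f z0) ^+ 2)^-1 <= 1 / 2.
  have p2 : 0 < 1 + cabs (f z0) ^+ 2 by apply: ltr_wpDr => //; exact: sqr_ge0.
  rewrite div1r lef_pV2 ?posrE//.
  have : 1 <= cabs (f z0) ^+ 2 by rewrite expr_ge1// ltW.
  lra.
move=> a3; have {}a3 : 3 / 10 <= 2 * sigma / d * (2 * q) by lra.
have : 3 / 10 * d <= 4 * sigma * q.
  by move: a3; rewrite (_ : 2 * sigma / d * (2 * q) = 4 * sigma * q / d) ?ler_pdivlMr//; ring.
have : Lam * q = 8 * q + 640 * (K * q) + 14 * (sigma * q) by rewrite /Lam; ring.
have : 0 <= K * q by rewrite mulr_ge0// ltW.
have : 0 <= sigma * q by rewrite mulr_ge0// ltW.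
lra.
Qed.

(** Where [|f| <= 1] normality alone suffices. *)
Lemma derive_growth z0 : cabs z0 < 1 ->
  ((1 - cabs z0) * cabs (derive1 f z0)) ^+ 2 <= Lam ^+ 2 * (1 + cabs (f z0) ^+ 2).
Proof.
move=> z01; have d0 : 0 < 1 - cabs z0 by rewrite subr_gt0.
have L0 : 0 <= Lam by rewrite /Lam; move: K0 s0; lra.
have F0 := cabs_ge0 (f z0); have G0 := cabs_ge0 (derive1 f z0).
have [F1|F1] := leP (cabs (f z0)) 1.
  have h := hs z01.
  have F2 : cabs (f z0) ^+ 2 <= 1 by rewrite expr_le1.
  have h1 : (1 - cabs z0) * cabs (derive1 f z0) <= Lam.
    have : sigma * (1 + cabs (f z0) ^+ 2) <= sigma * 2 by rewrite ler_wpM2l//; lra.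
    by rewrite /Lam; move: K0 s0 h; lra.
  apply: (@le_trans _ _ (Lam ^+ 2)).
    by apply: lerXn2r; rewrite ?nnegrE ?mulr_ge0// ltW.
  by rewrite ler_peMr ?sqr_ge0// lerDl sqr_ge0.
have h := derive_le_large z01 F1.
apply: (@le_trans _ _ ((Lam * cabs (f z0)) ^+ 2)).
  by apply: lerXn2r; rewrite ?nnegrE ?mulr_ge0// ltW.
by rewrite exprMn ler_wpM2l ?sqr_ge0// lerDr.
Qed.

End newton.

(** * The logarithm of the regularised modulus *)

Section exponential.
Context {R : realType}.
Variables (L Lx Lt : R -> R -> R) (x t Lxx Lxt Ltx Ltt : R).
Hypotheses (hL : has_grad L x t (Lx x t) (Lt x t))
  (hLx : has_grad Lx x t Lxx Lxt) (hLt : has_grad Lt x t Ltx Ltt).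

Lemma has_grad_exp :
  has_grad (fun x t => expR (L x t)) x t (expR (L x t) * Lx x t) (expR (L x t) * Lt x t).
Proof. exact: has_grad_comp hL (is_derive_expR _). Qed.

(** For [u = expR L] this is the field [(X - x) * grad u + u e_x]. Its
    divergence is the Laplacian of [u] times [X - x], and on the circle
    [x = X] it only involves [u]. *)
Lemma has_div_exp_weight (X : R) :
  has_div (fun x t => (X - x) * (expR (L x t) * Lx x t) + expR (L x t))
    (fun x t => (X - x) * (expR (L x t) * Lt x t)) x t
    ((X - x) * (expR (L x t) * (Lxx + Ltt + Lx x t ^+ 2 + Lt x t ^+ 2))).
Proof.
have hy := has_gradB (has_grad_cst X x t) (has_grad_fst x t).
have h1 := has_gradD (has_gradM hy (has_gradM has_grad_exp hLx)) has_grad_exp.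
have h2 := has_gradM hy (has_gradM has_grad_exp hLt).
by do 4 eexists; split; [exact: h1|exact: h2|ring].
Qed.

End exponential.

Section log_modulus.
Context {R : realType}.
(** The hypotheses are the Cauchy-Riemann equations for [F = a + i b], its
    derivative [c + i e] and its second derivative [h1 + i h2] with respect
    to [x + i t]. *)
Variables (a b c e : R -> R -> R) (x t h1 h2 eps : R).
Hypotheses (ha : has_grad a x t (c x t) (- e x t)) (hb : has_grad b x t (e x t) (c x t))
  (hc : has_grad c x t h1 (- h2)) (he : has_grad e x t h2 h1) (eps0 : 0 < eps).

Definition lmod x t : R := eps + (a x t * a x t + b x t * b x t).
Definition logW x t : R := ln (lmod x t).
Definition logWx x t : R := 2 * (a x t * c x t + b x t * e x t) * (lmod x t)^-1.
Definition logWt x t : R := 2 * (b x t * c x t - a x t * e x t) * (lmod x t)^-1.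

Lemma lmod_gt0 x' t' : 0 < lmod x' t'.
Proof. by rewrite /lmod ltr_wpDr// addr_ge0// -expr2 sqr_ge0. Qed.

Lemma has_grad_lmod : has_grad lmod x t (2 * (a x t * c x t + b x t * e x t))
  (2 * (b x t * c x t - a x t * e x t)).
Proof.
have h := has_gradD (has_grad_cst eps x t) (has_gradD (has_gradM ha ha) (has_gradM hb hb)).
by apply: has_grad_eq h _ _; ring.
Qed.

Lemma has_grad_lmodV : has_grad (fun x t => (lmod x t)^-1) x t
  (- logWx x t * (lmod x t)^-1) (- logWt x t * (lmod x t)^-1).
Proof.
have n0 := lmod_gt0 x t; have nz : lmod x t != 0 by rewrite gt_eqF.
apply: has_grad_eq (has_gradV nz has_grad_lmod) _ _.
  by rewrite /logWx expr2 invfM mulrA mulNr.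
by rewrite /logWt expr2 invfM mulrA mulNr.
Qed.

Lemma has_grad_logW : has_grad logW x t (logWx x t) (logWt x t).
Proof.
apply: has_grad_eq (has_grad_comp has_grad_lmod (is_derive1_ln (lmod_gt0 x t))) _ _.
  by rewrite mulrC.
by rewrite mulrC.
Qed.

Definition logWxx : R := 2 * (c x t ^+ 2 + e x t ^+ 2 + a x t * h1 + b x t * h2) * (lmod x t)^-1
  - logWx x t ^+ 2.
Definition logWtt : R := 2 * (c x t ^+ 2 + e x t ^+ 2 - a x t * h1 - b x t * h2) * (lmod x t)^-1
  - logWt x t ^+ 2.

Lemma has_grad_logWx : exists Wxt, has_grad logWx x t logWxx Wxt.
Proof.
have h := has_gradM (has_gradZ 2 (has_gradD (has_gradM ha hc) (has_gradM hb he))) has_grad_lmodV.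
eexists; apply: has_grad_eq h _ _; last by [].
by rewrite /logWxx [in RHS]/logWx /logWx; ring.
Qed.

Lemma has_grad_logWt : exists Wtx, has_grad logWt x t Wtx logWtt.
Proof.
have h := has_gradM (has_gradZ 2 (has_gradB (has_gradM hb hc) (has_gradM ha he))) has_grad_lmodV.
eexists; apply: has_grad_eq h _ _; first by [].
by rewrite /logWtt [in RHS]/logWt /logWt; ring.
Qed.

Lemma logW_laplacian :
  logWxx + logWtt = 4 * eps * (c x t ^+ 2 + e x t ^+ 2) * (lmod x t)^-1 ^+ 2.
Proof.
have n0 := lmod_gt0 x t.
rewrite /logWxx /logWtt /logWx /logWt; move: n0; rewrite /lmod => n0.
by field; rewrite gt_eqF.
Qed.

Lemma logW_gradient_sq :
  logWx x t ^+ 2 + logWt x t ^+ 2 =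
  4 * ((c x t ^+ 2 + e x t ^+ 2) * (lmod x t)^-1) * (1 - eps * (lmod x t)^-1).
Proof.
have n0 := lmod_gt0 x t.
rewrite /logWx /logWt; move: n0; rewrite /lmod => n0.
by field; rewrite gt_eqF.
Qed.

End log_modulus.

(** * An auxiliary vector field *)

Section field_estimate.
Context {R : realType}.
Implicit Types T : R.

(** [efun] is the solution of [2 E' = g / T + 2 g'] for [g = gfun]: with
    this relation the terms of [field_div] of order [p] that carry no small
    factor cancel. [dgfun] and [defun] are the derivatives of [gfun] and
    [efun]. *)
Definition gfun T : R := T * (1 + T)^-1 ^+ 2.
Definition efun T : R := T * (3 + T) / 2 * (1 + T)^-1 ^+ 2.
Definition dgfun T : R := (1 - T) * (1 + T)^-1 ^+ 3.
Definition defun T : R := (3 - T) / 2 * (1 + T)^-1 ^+ 3.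

Lemma field_functions_bounds T : 0 <= T ->
  [/\ 0 <= gfun T <= T, 0 <= efun T <= 3 / 2 * T, `|dgfun T| <= 1 & `|defun T| <= 3 / 2].
Proof.
move=> T0; have I0 : 0 < (1 + T)^-1 by rewrite invr_gt0; lra.
have I1 : (1 + T)^-1 * (1 + T) = 1 by rewrite mulVf// gt_eqF//; lra.
have Il : (1 + T)^-1 <= 1 by rewrite invf_le1; lra.
rewrite /gfun /efun /dgfun /defun; move: I0 I1 Il; set i := (1 + T)^-1 => I0 I1 Il.
have i2 : i ^+ 2 <= 1 by rewrite expr_le1// ltW.
have i3 : i ^+ 3 <= 1 by rewrite expr_le1// ltW.
have i20 : 0 <= i ^+ 2 by rewrite exprn_ge0// ltW.
have i30 : 0 <= i ^+ 3 by rewrite exprn_ge0// ltW.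
split.
- by rewrite mulr_ge0//= ler_piMr.
- have e : T * (3 + T) / 2 * i ^+ 2 = T / 2 * (i ^+ 2 * (3 + T)) by ring.
  have e2 : i ^+ 2 * (3 + T) = i ^+ 2 * 2 + i by rewrite expr2; transitivity (i * i * 2 + i * (i * (1 + T))); [ring|rewrite I1 mulr1].
  rewrite e e2; apply/andP; split; first by rewrite mulr_ge0 ?divr_ge0// addr_ge0 ?mulr_ge0// ltW.
  have : i ^+ 2 * 2 + i <= 3 by lra.
  by move=> h; have := ler_wpM2l (divr_ge0 T0 (ler0n _ 2)) h; lra.
- rewrite normrM (ger0_norm i30).
  have h : `|1 - T| <= 1 + T by rewrite ler_norml; apply/andP; split; lra.
  apply: le_trans (ler_wpM2r i30 h) _.
  by rewrite exprS mulrA [(1 + T) * _]mulrC I1 mul1r.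
- rewrite normrM (ger0_norm i30).
  have h : `|(3 - T) / 2| <= 3 / 2 * (1 + T) by rewrite ler_norml; apply/andP; split; lra.
  apply: le_trans (ler_wpM2r i30 h) _.
  have -> : 3 / 2 * (1 + T) * i ^+ 3 = 3 / 2 * i ^+ 2 * (i * (1 + T)) by ring.
  by rewrite I1 mulr1 ler_piMr.
Qed.

Lemma field_functions_relation T : 0 <= T ->
  [/\ 2 * defun T * T = gfun T + 2 * dgfun T * T,
      gfun T + dgfun T * T = 2 * T * (1 + T)^-1 ^+ 3 &
      2 * defun T - 2 * dgfun T * T = (3 - 3 * T + 2 * T ^+ 2) * (1 + T)^-1 ^+ 3].
Proof.
move=> T0; have n0 : 1 + T != 0 by rewrite gt_eqF//; lra.
by split; rewrite /gfun /dgfun /defun; field.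
Qed.

Section divergence_estimate.
Variables (y n p r kap m1 m2 q C b : R).
Let N := n ^+ 2.
Let T := y ^+ 2 * N.
Let Tx := - 2 * y * N + y ^+ 2 * (2 * N - 2 * m1 - 2 * N * p).
Let Tt := y ^+ 2 * (- 2 * m2 - 2 * N * r).
Let M := 1 + C.
Let c1 := M ^- 3.
Let k := 3 + 2 * M.

(** The divergence of the field [w V] of [has_div_field], divided by [w], as
    a function of the values at one point: [p] and [r] are half the partial
    derivatives of [log (1 + |F|^2)], [n^2] is [|F'|^2 / (1 + |F|^2)], and
    [m1], [m2] come from the coefficient of the equation. *)
Definition field_div : R :=
  2 * q * (p * (- efun T + y * gfun T * p) + r * (y * gfun T * r))
  - defun T * Tx - gfun T * p + y * dgfun T * (Tx * p + Tt * r)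
  + 2 * y * gfun T * N * kap.

(** The leading term is [y N (2 E' - 2 g' T)], at least [c1 y N] as
    [T <= C]. The remaining terms are small multiples of [y N], or of size
    [y^2 n b], which the inequality of arithmetic and geometric means splits
    into [y n^2] and [y^3 b^2]. *)
Lemma field_div_ge : 0 <= y -> 0 <= n -> 0 <= kap <= 1 -> T <= C -> 0 <= C ->
  p ^+ 2 + r ^+ 2 = N * (1 - kap) -> m1 ^+ 2 + m2 ^+ 2 <= N * b ^+ 2 -> 0 <= b ->
  k * y <= c1 / 4 -> 0 <= q -> 3 * M * q <= c1 / 4 ->
  c1 / 4 * (y * N) - k ^+ 2 / c1 * (y ^+ 3 * b ^+ 2) <= field_div.
Proof.
move=> y0 n0 /andP[kap0 kap1] TC C0 hpr hm b0 hy q0 hq.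
have N0 : 0 <= N by exact: sqr_ge0.
have T0 : 0 <= T by rewrite mulr_ge0 ?sqr_ge0.
have [/andP[g0 gT] /andP[E0 ET] dg1 dE1] := field_functions_bounds T0.
have [r1 r2 r3] := field_functions_relation T0.
have M1 : 1 <= M by rewrite /M; lra.
have M0 : 0 < M by lra.
have c10 : 0 < c1 by rewrite invr_gt0 exprn_gt0.
have k0 : 0 < k by rewrite /k; lra.
have I0 : 0 < (1 + T)^-1 by rewrite invr_gt0; lra.
have tauM : y * n <= M.
  rewrite -(@ler_sqr _ (y * n)) ?nnegrE ?mulr_ge0 ?(ltW M0)// exprMn.
  apply: (le_trans TC); rewrite /M; nra.
have pn : `|p| <= n.
  rewrite -(@ler_sqr _ `|p|) ?nnegrE// real_normK ?num_real//.
  have := sqr_ge0 r; have : 0 <= N * kap by rewrite mulr_ge0.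
  by move: hpr; rewrite /N; lra.
have m1n : `|m1| <= n * b.
  rewrite -(@ler_sqr _ `|m1|) ?nnegrE ?mulr_ge0// real_normK ?num_real// exprMn.
  by have := sqr_ge0 m2; move: hm; rewrite /N; lra.
have mpr : `|m1 * p + m2 * r| <= N * b.
  rewrite -(@ler_sqr _ `|m1 * p + m2 * r|) ?nnegrE ?mulr_ge0// real_normK ?num_real//.
  have cs : (m1 * p + m2 * r) ^+ 2 + (m1 * r - m2 * p) ^+ 2 =
    (m1 ^+ 2 + m2 ^+ 2) * (p ^+ 2 + r ^+ 2) by ring.
  have : (m1 ^+ 2 + m2 ^+ 2) * (p ^+ 2 + r ^+ 2) <= N * b ^+ 2 * N.
    apply: ler_pM => //; try by rewrite addr_ge0 ?sqr_ge0.
    by rewrite hpr ler_piMr//; lra.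
  have := sqr_ge0 (m1 * r - m2 * p); rewrite exprMn [N ^+ 2]expr2; lra.
have t1 : - (c1 / 4 * (y * N)) <= 2 * q * (p * (- efun T + y * gfun T * p) + r * (y * gfun T * r)).
  have e : p * (- efun T + y * gfun T * p) + r * (y * gfun T * r) =
     - (p * efun T) + y * gfun T * (p ^+ 2 + r ^+ 2) by ring.
  have pos : 0 <= y * gfun T * (p ^+ 2 + r ^+ 2).
    by apply: mulr_ge0; [exact: mulr_ge0|rewrite addr_ge0 ?sqr_ge0].
  have pE : p * efun T <= n * (3 / 2 * T).
    apply: (@le_trans _ _ (n * efun T)).
      by apply: ler_wpM2r => //; apply: le_trans pn; exact: ler_norm.
    exact: ler_wpM2l.
  have nT : n * (3 / 2 * T) <= 3 / 2 * (M * (y * N)).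
    have -> : n * (3 / 2 * T) = 3 / 2 * (y * n * (y * N)) by rewrite /T; ring.
    by apply: ler_wpM2l => //; apply: ler_wpM2r => //; exact: mulr_ge0.
  have big : - (3 / 2 * (M * (y * N))) <= - (p * efun T) + y * gfun T * (p ^+ 2 + r ^+ 2) by lra.
  rewrite e; apply: le_trans (ler_wpM2l (mulr_ge0 (ler0n _ 2) q0) big).
  have : 3 * M * q * (y * N) <= c1 / 4 * (y * N) by rewrite ler_wpM2r// mulr_ge0.
  lra.
have t2 : c1 * (y * N) <= y * N * (2 * defun T - 2 * dgfun T * T).
  rewrite mulrC; apply: ler_wpM2l; first exact: mulr_ge0.
  rewrite r3 /c1.
  have h1 : M ^- 3 <= (1 + T)^-1 ^+ 3.
    rewrite exprVn lef_pV2 ?posrE ?exprn_gt0//; last by lra.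
    by apply: lerXn2r; rewrite ?nnegrE /M; lra.
  apply: (le_trans h1); rewrite ler_peMl ?exprn_ge0 ?(ltW I0)//.
  have := sqr_ge0 (T - 3 / 4); lra.
have t3 : 0 <= 2 * y * N * kap * (gfun T + dgfun T * T).
  rewrite r2; apply: mulr_ge0; first by rewrite !mulr_ge0.
  by rewrite !mulr_ge0 ?exprn_ge0 ?(ltW I0).
have nrm (s v : R) : `|s * v| <= `|s| * `|v| by rewrite normrM.
have t4 : - (3 * (y * (y * N))) <= - (2 * defun T * (y ^+ 2 * N)).
  rewrite lerN2.
  have -> : 2 * defun T * (y ^+ 2 * N) = 2 * defun T * (y * (y * N)) by ring.
  apply: ler_wpM2r; first by rewrite !mulr_ge0.
  by move: dE1; rewrite ler_norml; lra.
have t5 : - (2 * M * (y * (y * N))) <= 2 * y * dgfun T * T * p.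
  have a1 : `|dgfun T * p| <= n.
    rewrite normrM; apply: (@le_trans _ _ (1 * n)); last by rewrite mul1r.
    by apply: ler_pM.
  have -> : 2 * y * dgfun T * T * p = 2 * y * T * (dgfun T * p) by ring.
  have a2 : - (2 * y * T * n) <= 2 * y * T * (dgfun T * p).
    rewrite -mulrN; apply: ler_wpM2l; first by rewrite !mulr_ge0.
    by move: a1; rewrite ler_norml => /andP[].
  apply: le_trans a2; rewrite lerN2.
  have -> : 2 * y * T * n = y * n * (2 * (y * (y * N))) by rewrite /T; ring.
  have -> : 2 * M * (y * (y * N)) = M * (2 * (y * (y * N))) by ring.
  by apply: ler_wpM2r => //; rewrite !mulr_ge0.
have t6 : - (3 * (y ^+ 2 * n * b)) <= 2 * defun T * y ^+ 2 * m1.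
  have a1 : `|defun T * m1| <= 3 / 2 * (n * b) by rewrite normrM; apply: ler_pM.
  have -> : 2 * defun T * y ^+ 2 * m1 = 2 * y ^+ 2 * (defun T * m1) by ring.
  have -> : - (3 * (y ^+ 2 * n * b)) = 2 * y ^+ 2 * - (3 / 2 * (n * b)) by field.
  apply: ler_wpM2l; first by rewrite mulr_ge0 ?sqr_ge0.
  by move: a1; rewrite ler_norml => /andP[].
have t7 : - (2 * M * (y ^+ 2 * n * b)) <= - (2 * y ^+ 3 * dgfun T * (m1 * p + m2 * r)).
  have a1 : `|dgfun T * (m1 * p + m2 * r)| <= N * b.
    rewrite normrM; apply: (@le_trans _ _ (1 * (N * b))); last by rewrite mul1r.
    by apply: ler_pM.
  have -> : 2 * y ^+ 3 * dgfun T * (m1 * p + m2 * r) = 2 * y ^+ 3 * (dgfun T * (m1 * p + m2 * r)) by ring.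
  rewrite lerN2; apply: (@le_trans _ _ (2 * y ^+ 3 * (N * b))).
    apply: ler_wpM2l; first by rewrite mulr_ge0 ?exprn_ge0.
    by move: a1; rewrite ler_norml => /andP[].
  have -> : 2 * y ^+ 3 * (N * b) = y * n * (2 * (y ^+ 2 * n * b)) by rewrite /N; ring.
  have -> : 2 * M * (y ^+ 2 * n * b) = M * (2 * (y ^+ 2 * n * b)) by ring.
  by apply: ler_wpM2r => //; rewrite !mulr_ge0 ?sqr_ge0.
have amgm : k * (y ^+ 2 * n * b) <= c1 / 4 * (y * N) + k ^+ 2 / c1 * (y ^+ 3 * b ^+ 2).
  rewrite -subr_ge0.
  have -> : c1 / 4 * (y * N) + k ^+ 2 / c1 * (y ^+ 3 * b ^+ 2) - k * (y ^+ 2 * n * b) =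
    y * ((c1 * n / 2 - k * y * b) ^+ 2 / c1) by rewrite /N; field; rewrite gt_eqF.
  by apply: mulr_ge0 => //; apply: divr_ge0; [exact: sqr_ge0|exact: ltW].
have small : k * y * (y * N) <= c1 / 4 * (y * N) by apply: ler_wpM2r => //; exact: mulr_ge0.
have -> : field_div = 2 * q * (p * (- efun T + y * gfun T * p) + r * (y * gfun T * r))
  + y * N * (2 * defun T - 2 * dgfun T * T) + 2 * y * N * kap * (gfun T + dgfun T * T)
  - 2 * defun T * (y ^+ 2 * N) + 2 * y * dgfun T * T * p + 2 * defun T * y ^+ 2 * m1
  - 2 * y ^+ 3 * dgfun T * (m1 * p + m2 * r).
  rewrite /field_div /Tx /Tt.
  have e1 : y * dgfun T * ((- 2 * y * N + y ^+ 2 * (2 * N - 2 * m1 - 2 * N * p)) * p +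
      y ^+ 2 * (- 2 * m2 - 2 * N * r) * r) =
    p * (- 2 * dgfun T * T) + 2 * y * dgfun T * T * p
    - 2 * y ^+ 3 * dgfun T * (m1 * p + m2 * r) - 2 * y * dgfun T * T * (p ^+ 2 + r ^+ 2).
    by rewrite /T; ring.
  rewrite e1 hpr.
  have e2 : defun T * (- 2 * y * N + y ^+ 2 * (2 * N - 2 * m1 - 2 * N * p)) =
    - (2 * defun T) * (y * N) + 2 * defun T * (y ^+ 2 * N) - 2 * defun T * y ^+ 2 * m1
    - p * (2 * defun T * T) by rewrite /T; ring.
  rewrite e2 r1; ring.
have kM : k = 3 + 2 * M by [].
have e3 : k * y * (y * N) = 3 * (y * (y * N)) + 2 * M * (y * (y * N)) by rewrite kM; ring.
have e4 : k * (y ^+ 2 * n * b) = 3 * (y ^+ 2 * n * b) + 2 * M * (y ^+ 2 * n * b) by rewrite kM; ring.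
rewrite e3 in small; rewrite e4 in amgm.
move: t1 t2 t3 t4 t5 t6 t7 small amgm.
move: (2 * q * _) (y * N * (_ - _)) (2 * y * N * kap * _) (2 * defun T * (y ^+ 2 * N))
  (2 * y * dgfun T * T * p) (2 * defun T * y ^+ 2 * m1) (2 * y ^+ 3 * dgfun T * _).
move: (2 * M * (y * (y * N))) (3 * (y * (y * N))) (3 * (y ^+ 2 * n * b)) (2 * M * (y ^+ 2 * n * b))
  (k ^+ 2 / c1 * _) => A1 A2 A3 A4 A5 B1 B2 B3 B4 B5 B6 B7.
move: (y * N) => yN.
lra.
Qed.

End divergence_estimate.

End field_estimate.

Section vector_field.
Context {R : realType}.

Lemma has_grad_gfun (u : R -> R -> R) x t ux ut : 0 <= u x t -> has_grad u x t ux ut ->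
  has_grad (fun x t => gfun (u x t)) x t (dgfun (u x t) * ux) (dgfun (u x t) * ut).
Proof.
move=> u0 hu; have n0 : 1 + u x t != 0 by rewrite gt_eqF//; lra.
have h1 := has_gradD (has_grad_cst 1 x t) hu.
have h2 := @has_gradV _ (fun x t => 1 + u x t) x t _ _ n0 h1.
have h3 := has_gradM hu (has_gradM h2 h2).
by apply: has_grad_eq (has_grad_near (@ltr01 R) _ h3) _ _ => [h k _ _||];
  rewrite /gfun /dgfun ?expr2//; field.
Qed.

Lemma has_grad_efun (u : R -> R -> R) x t ux ut : 0 <= u x t -> has_grad u x t ux ut ->
  has_grad (fun x t => efun (u x t)) x t (defun (u x t) * ux) (defun (u x t) * ut).
Proof.
move=> u0 hu; have n0 : 1 + u x t != 0 by rewrite gt_eqF//; lra.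
have h1 := has_gradD (has_grad_cst 1 x t) hu.
have h1' := has_gradD (has_grad_cst 3 x t) hu.
have h2 := @has_gradV _ (fun x t => 1 + u x t) x t _ _ n0 h1.
have h3 := has_gradM (has_gradZ 2^-1 (has_gradM hu h1')) (has_gradM h2 h2).
apply: has_grad_eq (has_grad_near (@ltr01 R) _ h3) _ _ => [h k _ _||];
  rewrite /efun /defun; last 2 first.
- by field.
- by field.
by rewrite expr2 [2^-1 * _]mulrC.
Qed.

Variables (a b c e : R -> R -> R) (X q : R).

(** Here [X] is the coordinate of the outer circle, and the field is
    [V = - E(T) e_x + (y g(T) / 2) * grad log (1 + |F|^2)] with [y = X - x]
    and [T = y^2 |F'|^2 / (1 + |F|^2)]. *)
Definition kap x t : R := (lmod a b 1 x t)^-1.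
Definition Nf x t : R := (c x t * c x t + e x t * e x t) * kap x t.
Definition Tf x t : R := (X - x) * (X - x) * Nf x t.
Definition wf x t : R := expR (q * logW a b 1 x t).
Definition Vx x t : R := - efun (Tf x t) + (X - x) * gfun (Tf x t) * (logWx a b c e 1 x t / 2).
Definition Vt x t : R := (X - x) * gfun (Tf x t) * (logWt a b c e 1 x t / 2).

Lemma kap_gt0 x t : 0 < kap x t.
Proof. by rewrite invr_gt0 lmod_gt0. Qed.

Lemma Nf_ge0 x t : 0 <= Nf x t.
Proof. by rewrite mulr_ge0 ?(ltW (kap_gt0 _ _))// addr_ge0// -expr2 sqr_ge0. Qed.

Lemma Tf_ge0 x t : 0 <= Tf x t.
Proof. by rewrite mulr_ge0 ?Nf_ge0// -expr2 sqr_ge0. Qed.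

Variables (x t b1 b2 : R).
Hypotheses (ha : has_grad a x t (c x t) (- e x t)) (hb : has_grad b x t (e x t) (c x t))
  (hc : has_grad c x t (c x t - b1) (- (e x t - b2)))
  (he : has_grad e x t (e x t - b2) (c x t - b1)).

Let p := logWx a b c e 1 x t / 2.
Let r := logWt a b c e 1 x t / 2.
Let m1 := kap x t * (c x t * b1 + e x t * b2).
Let m2 := kap x t * (e x t * b1 - c x t * b2).
Let n := Num.sqrt (Nf x t).

Let nE : n ^+ 2 = Nf x t. Proof. by rewrite sqr_sqrtr ?Nf_ge0. Qed.
Let WxE : logWx a b c e 1 x t = 2 * p. Proof. by rewrite /p; field. Qed.
Let WtE : logWt a b c e 1 x t = 2 * r. Proof. by rewrite /r; field. Qed.

Lemma has_grad_Tf : has_grad Tf x t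
  (- 2 * (X - x) * n ^+ 2 + (X - x) ^+ 2 * (2 * n ^+ 2 - 2 * m1 - 2 * n ^+ 2 * p))
  ((X - x) ^+ 2 * (- 2 * m2 - 2 * n ^+ 2 * r)).
Proof.
have hy := has_gradB (has_grad_cst X x t) (has_grad_fst x t).
have hk := has_grad_lmodV ha hb (@ltr01 R).
have hN := has_gradM (has_gradD (has_gradM hc hc) (has_gradM he he)) hk.
have hT := has_gradM (has_gradM hy hy) hN.
apply: has_grad_eq hT _ _; rewrite nE ?WxE ?WtE /m1 /m2 /Nf -/(kap x t); ring.
Qed.

Lemma has_div_field : has_div (fun x t => wf x t * Vx x t) (fun x t => wf x t * Vt x t) x t
  (wf x t * field_div (X - x) n p r (kap x t) m1 m2 q).
Proof.
have hy := has_gradB (has_grad_cst X x t) (has_grad_fst x t).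
have hW := has_grad_logW ha hb (@ltr01 R).
have hw := has_grad_comp (has_gradZ q hW) (is_derive_expR _).
have [Wxt hWx] := has_grad_logWx ha hb hc he (@ltr01 R).
have [Wtx hWt] := has_grad_logWt ha hb hc he (@ltr01 R).
have lap := logW_laplacian a b c e x t (c x t - b1) (e x t - b2) (@ltr01 R).
have hg := has_grad_gfun (Tf_ge0 x t) has_grad_Tf.
have hE := has_grad_efun (Tf_ge0 x t) has_grad_Tf.
have hygx := has_gradM (has_gradM hy hg) (has_gradZ 2^-1 hWx).
have hygt := has_gradM (has_gradM hy hg) (has_gradZ 2^-1 hWt).
have hVx := has_gradD (has_gradN hE) hygx.
have h1 := has_gradM hw hVx.
have h2 := has_gradM hw hygt.
do 4 eexists; split.
- apply: has_grad_near (@ltr01 R) _ h1 => h k _ _.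
  by rewrite /wf /Vx [logWx a b c e 1 (x + h) (t + k) / 2]mulrC.
- apply: has_grad_near (@ltr01 R) _ h2 => h k _ _.
  by rewrite /wf /Vt [logWt a b c e 1 (x + h) (t + k) / 2]mulrC.
have TE : (X - x) ^+ 2 * n ^+ 2 = Tf x t by rewrite nE /Tf expr2.
rewrite /field_div TE -/(wf x t).
have lapE : logWtt a b c e x t (c x t - b1) (e x t - b2) 1 =
    4 * n ^+ 2 * kap x t - logWxx a b c e x t (c x t - b1) (e x t - b2) 1.
  apply/eqP; rewrite eq_sym subr_eq addrC; apply/eqP; rewrite lap nE /Nf /kap; ring.
rewrite lapE WxE WtE.
move: (logWxx _ _ _ _ _ _ _ _ _) (gfun _) (efun _) (dgfun _) (defun _) (wf x t) (n ^+ 2) => v1 v2 v3 v4 v5 v6 v7.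
by field.
Qed.

End vector_field.

(** * Bounded circle means *)

Section solution.
Context {R : realType}.

Definition fre (f : R[i] -> R[i]) x t : R := Re (f (cexp x t)).
Definition fim (f : R[i] -> R[i]) x t : R := Im (f (cexp x t)).

(** The derivative of [f] in the variable [x + i t]. *)
Definition zderiv (f : R[i]^o -> R[i]^o) (z : R[i]) : R[i] := z * derive1 f z.

Lemma fre_fim_periodic (g : R[i] -> R[i]) x :
  fre g x (2 * pi) = fre g x 0 /\ fim g x (2 * pi) = fim g x 0.
Proof. by rewrite /fre /fim cexp_2pi. Qed.

Lemma cexp_disc (x t : R) : x < 0 -> unit_disc R (cexp x t).
Proof. by move=> x0; rewrite /unit_disc /mkset cabs_cexp expR_lt1. Qed.

Lemma has_grad_solution (f : R[i]^o -> R[i]^o) x t : analytic_disc f -> x < 0 ->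
  has_grad (fre f) x t (fre (zderiv f) x t) (- fim (zderiv f) x t) /\
  has_grad (fim f) x t (fim (zderiv f) x t) (fre (zderiv f) x t).
Proof.
move=> af x0; have [h1 h2] := has_cgrad_comp (has_cgrad_cexp x t) (af _ (cexp_disc t x0)).
rewrite /fre /fim /zderiv; split.
  apply: has_grad_eq h1 _ _; first by rewrite mulrC.
  by rewrite !ReMc !ImMc /=; ring.
apply: has_grad_eq h2 _ _; first by rewrite mulrC.
by rewrite !ReMc !ImMc /=; ring.
Qed.

Let mul_shuffle (i z d e : R[i]) : i * z * d + z * (e * (i * z)) = i * (z * d + z * (e * z)).
Proof. by rewrite mulrDr !mulrA; congr (_ * _ + _); rewrite [z * e * i]mulrAC [z * i]mulrC. Qed.

(** In the variable [x + i t] the equation reads [F'' = F' - z^2 A F]. *)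
Lemma has_grad_zderiv (f A : R[i]^o -> R[i]^o) x t : ode_solution A f -> x < 0 ->
  let BF := cexp x t ^+ 2 * A (cexp x t) * f (cexp x t) in
  has_grad (fre (zderiv f)) x t (fre (zderiv f) x t - Re BF) (- (fim (zderiv f) x t - Im BF)) /\
  has_grad (fim (zderiv f)) x t (fim (zderiv f) x t - Im BF) (fre (zderiv f) x t - Re BF).
Proof.
move=> [af af' ode] x0 BF; have zd := cexp_disc t x0.
have hz := has_cgrad_cexp x t.
have [h1 h2] := has_cgradM hz (has_cgrad_comp hz (af' _ zd)).
have f2 : derive1 (derive1 f) (cexp x t) = - (A (cexp x t) * f (cexp x t)).
  by apply/eqP; rewrite -addr_eq0; apply/eqP; exact: ode.
have e1 : cexp x t * derive1 f (cexp x t) +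
    cexp x t * (derive1 (derive1 f) (cexp x t) * cexp x t) = zderiv f (cexp x t) - BF.
  by rewrite f2 /BF /zderiv; ring.
have e2 : 'i * cexp x t * derive1 f (cexp x t) +
    cexp x t * (derive1 (derive1 f) (cexp x t) * ('i * cexp x t)) = 'i * (zderiv f (cexp x t) - BF).
  by rewrite -e1; exact: mul_shuffle.
rewrite e1 e2 in h1 h2; rewrite /fre /fim; split.
  apply: has_grad_eq h1 _ _; first by rewrite ReB.
  by rewrite ReMc ReB ImB /=; ring.
apply: has_grad_eq h2 _ _; first by rewrite ImB.
by rewrite ImMc ReB ImB /=; ring.
Qed.

(** The distance to the boundary in the coordinate [x], weighted by [|z|],
    is at most [1 - |z|]. *)
Lemma log_weight (x : R) : - x * expR x <= 1 - expR x.
Proof.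
have h := expR_ge1Dx (- x); have e0 := expR_gt0 x.
have := ler_wpM2r (ltW e0) h; rewrite mulrDl mul1r expRN mulVf ?gt_eqF//.
lra.
Qed.

Lemma le_sq1 (v : R) : - (1 + v * v) <= v <= 1 + v * v.
Proof.
have := sqr_ge0 (v - 1); have := sqr_ge0 (v + 1); rewrite !expr2 => h1 h2.
by apply/andP; split; lra.
Qed.

Lemma damped_le (v y m : R) : 0 <= y <= 1 -> 0 < m ->
  - (m * (1 + v * v)) <= y * (m * v) <= m * (1 + v * v).
Proof.
move=> /andP[p0 p1] m0; have /andP[s1 s2] := le_sq1 v.
have A0 : 0 <= 1 + v * v by rewrite addr_ge0// -expr2 sqr_ge0.
have yA := ler_piMl A0 p1.
have l1 := le_trans (ler_wpM2l p0 s2) yA.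
have l2 : - (1 + v * v) <= y * v by apply: le_trans (ler_wpM2l p0 s1); rewrite mulrN lerN2.
by rewrite mulrCA -mulrN !ler_pM2l// l1 l2.
Qed.

Section weighted_flux.
Variables (f A : R[i]^o -> R[i]^o) (mu : {measure set (plane R) -> \bar R}) (C K la : R).
Hypothesis sol : ode_solution A f.
Hypothesis C0 : 0 <= C.
Hypothesis growth : forall z : R[i], cabs z < 1 ->
  ((1 - cabs z) * cabs (derive1 f z)) ^+ 2 <= C * (1 + cabs (f z) ^+ 2).
Hypothesis la0 : 0 < la.
Hypothesis mufin : (mu (plane_disc R) < +oo)%E.
Hypothesis phiK : forall x t, x < 0 -> - K <= phi mu x t <= 0.
Hypothesis lapA : forall x t, x < 0 ->
  rho x * (1 - expR x) ^+ 2 * cabs (A (cexp x t)) ^+ 2 * la <= philap mu x t.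

Let af : analytic_disc f. Proof. by case: sol. Qed.

Let a := fre f.
Let b := fim f.
Let c := fre (zderiv f).
Let e := fim (zderiv f).
Let M := 1 + C.
Let c1 := M ^- 3.
Let k := 3 + 2 * M.
Let c5 := k ^+ 2 / c1.

Variable q : R.
Hypotheses (q0 : 0 < q) (q1 : q <= 1) (qM : 3 * M * q <= c1 / 4).
(** [alpha] makes the divergence of [w V] absorb the Laplacian of [w], and
    [beta] makes the Laplacian of [u] absorb the error term of that
    divergence. *)
Let alpha := 32 * q / c1.
Let beta := expR K * alpha * c5 / la.
Hypothesis beta2 : beta <= 1 / 2.

Let w := wf a b q.
Let u x t := expR (phi mu x t + q * logW a b 1 x t).

Let M1 : 1 <= M. Proof. by move: C0; rewrite /M; lra. Qed.
Let c10 : 0 < c1. Proof. by rewrite invr_gt0 exprn_gt0// (lt_le_trans ltr01 M1). Qed.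
Let k0 : 0 < k. Proof. by move: M1; rewrite /k; lra. Qed.
Let alpha0 : 0 < alpha. Proof. by rewrite divr_gt0// mulr_gt0. Qed.
Let c50 : 0 < c5. Proof. by rewrite divr_gt0// exprn_gt0. Qed.
Let beta0 : 0 < beta.
Proof. by rewrite /beta divr_gt0// mulr_gt0// mulr_gt0// expR_gt0. Qed.

Lemma lmodE x t : lmod a b 1 x t = 1 + cabs (f (cexp x t)) ^+ 2.
Proof. by rewrite /lmod cabs_sq !expr2. Qed.

Lemma NfE x t : Nf a b c e x t = expR x ^+ 2 * cabs (derive1 f (cexp x t)) ^+ 2 / (1 + cabs (f (cexp x t)) ^+ 2).
Proof.
rewrite /Nf /kap lmodE; congr (_ / _).
rewrite -(cabs_cexp x t) -exprMn -cabsM -/(zderiv f _) cabs_sq !expr2 //.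
Qed.

(** This is the growth condition, by [log_weight]. *)
Lemma Tf_le X x t : x <= X -> X < 0 -> Tf a b c e X x t <= C.
Proof.
move=> xX X0; have x0 : x < 0 by exact: le_lt_trans X0.
rewrite /Tf NfE.
have n0 : 0 < 1 + cabs (f (cexp x t)) ^+ 2 by apply: ltr_wpDr => //; exact: sqr_ge0.
set G := cabs (derive1 f _); set S := 1 + _ in n0 *.
have -> : (X - x) * (X - x) * (expR x ^+ 2 * G ^+ 2 / S) = ((X - x) * expR x * G) ^+ 2 / S by ring.
rewrite ler_pdivrMr//.
have z1 : cabs (cexp x t) < 1 by exact: cexp_disc.
apply: le_trans (growth z1); rewrite cabs_cexp.
have e0 := expR_gt0 x.
have l1 : (X - x) * expR x <= 1 - expR x.
  by apply: le_trans (log_weight x); apply: ler_wpM2r; [exact: ltW|lra].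
have d0 : 0 <= (X - x) * expR x by rewrite mulr_ge0 ?subr_ge0// ltW.
apply: lerXn2r; rewrite ?nnegrE.
- by rewrite mulr_ge0 ?cabs_ge0.
- by rewrite mulr_ge0 ?cabs_ge0// (le_trans d0).
- by rewrite ler_wpM2r ?cabs_ge0.
Qed.

Section point.
Variables (X x t : R).
Hypotheses (xX : x <= X) (X0 : X < 0) (yk : k * (X - x) <= c1 / 4).

Let x0 : x < 0. Proof. exact: le_lt_trans X0. Qed.
Let z := cexp x t.
Let B := z ^+ 2 * A z.
Let b1 := Re (B * f z).
Let b2 := Im (B * f z).
Let ha : has_grad a x t (c x t) (- e x t).
Proof. by have [] := has_grad_solution t af x0. Qed.
Let hb : has_grad b x t (e x t) (c x t).
Proof. by have [] := has_grad_solution t af x0. Qed.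
Let hc : has_grad c x t (c x t - b1) (- (e x t - b2)).
Proof. by have [] := has_grad_zderiv t sol x0. Qed.
Let he : has_grad e x t (e x t - b2) (c x t - b1).
Proof. by have [] := has_grad_zderiv t sol x0. Qed.

Let p := logWx a b c e 1 x t / 2.
Let r := logWt a b c e 1 x t / 2.
Let m1 := kap a b x t * (c x t * b1 + e x t * b2).
Let m2 := kap a b x t * (e x t * b1 - c x t * b2).
Let N := Nf a b c e x t.
Let n := Num.sqrt N.
Let nE : n ^+ 2 = N. Proof. by rewrite sqr_sqrtr ?Nf_ge0. Qed.

Let kap1 : 0 <= kap a b x t <= 1.
Proof.
rewrite (ltW (kap_gt0 _ _ _ _))/= /kap invf_le1 ?lmod_gt0// lmodE lerDl.
exact: sqr_ge0.
Qed.

Let pr2 : p ^+ 2 + r ^+ 2 = n ^+ 2 * (1 - kap a b x t).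
Proof.
have h := logW_gradient_sq a b c e x t (@ltr01 R).
transitivity ((logWx a b c e 1 x t ^+ 2 + logWt a b c e 1 x t ^+ 2) / 4); first by rewrite /p /r; field.
rewrite h mul1r nE /N /Nf /kap -!expr2; by set v := (lmod a b 1 x t)^-1; clearbody v; field.
Qed.

Let m12 : m1 ^+ 2 + m2 ^+ 2 <= n ^+ 2 * cabs B ^+ 2.
Proof.
have -> : m1 ^+ 2 + m2 ^+ 2 = (b1 ^+ 2 + b2 ^+ 2) * kap a b x t * N.
  by rewrite /m1 /m2 /N /Nf; ring.
rewrite -cabs_sq cabsM exprMn nE mulrC; apply: ler_wpM2l; first exact: Nf_ge0.
rewrite -mulrA ler_piMr ?sqr_ge0// /kap ler_pdivrMr ?lmod_gt0// mul1r lmodE lerDr//.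
Qed.

Let fd := field_div (X - x) n p r (kap a b x t) m1 m2 q.

Let fd_ge : c1 / 4 * ((X - x) * N) - c5 * ((X - x) ^+ 3 * cabs B ^+ 2) <= fd.
Proof.
rewrite -nE; apply: field_div_ge => //.
- by rewrite subr_ge0.
- exact: sqrtr_ge0.
- rewrite nE; apply: le_trans (Tf_le t xX X0); rewrite /Tf expr2//.
- exact: cabs_ge0.
- exact: ltW.
Qed.

Let lapB : (X - x) ^+ 2 * cabs B ^+ 2 * la <= philap mu x t.
Proof.
apply: le_trans (lapA t x0); rewrite (ler_pM2r la0).
have -> : cabs B ^+ 2 = rho x * rho x * cabs (A z) ^+ 2.
  by rewrite /B cabsM expr2 cabsM /z cabs_cexp /rho; ring.
have e0 := expR_gt0 x.
have -> : (X - x) ^+ 2 * (rho x * rho x * cabs (A z) ^+ 2) =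
    rho x * ((X - x) * expR x) ^+ 2 * cabs (A z) ^+ 2 by rewrite /rho; ring.
apply: ler_wpM2r; first exact: sqr_ge0.
apply: ler_wpM2l; first exact: sqr_ge0.
have d0 : 0 <= (X - x) * expR x by rewrite mulr_ge0 ?subr_ge0// ltW.
have l1 : (X - x) * expR x <= 1 - expR x.
  by apply: le_trans (log_weight x); apply: ler_wpM2r; [exact: ltW|move: X0; lra].
by apply: lerXn2r; rewrite ?nnegrE// (le_trans d0).
Qed.

Let uw : expR (- K) * w x t <= u x t.
Proof.
rewrite /u expRD; apply: ler_wpM2r; first exact: expR_ge0.
by rewrite ler_expR; have /andP[] := phiK t x0.
Qed.

(** The sum of three divergences: that of [y grad w + w e_x] is at most
    [8 q w y N], that of [w V] is bounded below by [field_div_ge], and that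
    of [y grad u + u e_x] is at least [y u] times the Laplacian of [phi]. *)
Lemma main_field : exists2 D,
  has_div
   (fun x t => (X - x) * (w x t * (q * logWx a b c e 1 x t)) + w x t
     + - alpha * (w x t * Vx a b c e X x t)
     + - beta * ((X - x) * (u x t * (phix mu x t + q * logWx a b c e 1 x t)) + u x t))
   (fun x t => (X - x) * (w x t * (q * logWt a b c e 1 x t))
     + - alpha * (w x t * Vt a b c e X x t)
     + - beta * ((X - x) * (u x t * (phit mu x t + q * logWt a b c e 1 x t)))) x t D
  & D <= 0.
Proof.
have hW := has_grad_logW ha hb (@ltr01 R).
have [Wxt hWx] := has_grad_logWx ha hb hc he (@ltr01 R).
have [Wtx hWt] := has_grad_logWt ha hb hc he (@ltr01 R).
have lap := logW_laplacian a b c e x t (c x t - b1) (e x t - b2) (@ltr01 R).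
set Wxx := logWxx _ _ _ _ _ _ _ _ _ in hWx lap.
set Wtt := logWtt _ _ _ _ _ _ _ _ _ in hWt lap.
have lapN : Wxx + Wtt = 4 * (N * kap a b x t).
  by rewrite lap /N /Nf /kap; ring.
have d1 := @has_div_exp_weight _ (fun x t => q * logW a b 1 x t)
  (fun x t => q * logWx a b c e 1 x t) (fun x t => q * logWt a b c e 1 x t) x t _ _ _ _
  (has_gradZ q hW) (has_gradZ q hWx) (has_gradZ q hWt) X.
have d2 := has_div_field X q ha hb hc he.
have d3 := @has_div_exp_weight _ (fun x t => phi mu x t + q * logW a b 1 x t)
  (fun x t => phix mu x t + q * logWx a b c e 1 x t)
  (fun x t => phit mu x t + q * logWt a b c e 1 x t) x t _ _ _ _
  (has_gradD (has_grad_phi mufin t x0) (has_gradZ q hW))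
  (has_gradD (has_grad_phix mufin t x0) (has_gradZ q hWx))
  (has_gradD (has_grad_phit mufin t x0) (has_gradZ q hWt)) X.
have d := has_divD (has_divD d1 (has_divZ (- alpha) d2)) (has_divZ (- beta) d3).
eexists; first exact: d.
rewrite -/(wf a b q x t) -/(u x t) -/(w x t) -/p -/r -/m1 -/m2 -/N -/n -/fd.
have WxE : logWx a b c e 1 x t = 2 * p by rewrite /p; field.
have WtE : logWt a b c e 1 x t = 2 * r by rewrite /r; field.
have w0 : 0 < w x t by exact: expR_gt0.
have u0 : 0 < u x t by exact: expR_gt0.
have y0 : 0 <= X - x by rewrite subr_ge0.
have N0 : 0 <= N by exact: Nf_ge0.
have /andP[kp0 kp1] := kap1.
have pl := phi_laplacian mufin t x0.
have s1 : (X - x) * (w x t * (q * Wxx + q * Wtt + (q * logWx a b c e 1 x t) ^+ 2 +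
    (q * logWt a b c e 1 x t) ^+ 2)) <= 8 * q * (w x t * ((X - x) * N)).
  have -> : q * Wxx + q * Wtt + (q * logWx a b c e 1 x t) ^+ 2 + (q * logWt a b c e 1 x t) ^+ 2 =
     q * (Wxx + Wtt) + 4 * q ^+ 2 * (p ^+ 2 + r ^+ 2) by rewrite WxE WtE; ring.
  rewrite lapN pr2 nE.
  have -> : 8 * q * (w x t * ((X - x) * N)) = (X - x) * (w x t * (8 * q * N)) by ring.
  apply: ler_wpM2l => //; apply: ler_wpM2l; first exact: ltW.
  have q2 : q ^+ 2 <= q by rewrite expr2 ler_piMr// ltW.
  have h1 : q * (4 * (N * kap a b x t)) <= q * (4 * N).
    by rewrite ler_pM2l// ler_pM2l// ler_piMr.
  have h2 : 4 * q ^+ 2 * (N * (1 - kap a b x t)) <= 4 * q * N.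
    apply: ler_pM.
    - by rewrite mulr_ge0// sqr_ge0.
    - by rewrite mulr_ge0// subr_ge0.
    - by rewrite ler_pM2l.
    - by rewrite ler_piMr//; move: kp0; lra.
  by apply: le_trans (lerD h1 h2) _; apply: eq_le_refl; ring.
have s3 : expR (- K) * w x t * ((X - x) * ((X - x) ^+ 2 * cabs B ^+ 2 * la)) <=
   (X - x) * (u x t * (phixx mu x t + q * Wxx + (phitt mu x t + q * Wtt) +
    (phix mu x t + q * logWx a b c e 1 x t) ^+ 2 + (phit mu x t + q * logWt a b c e 1 x t) ^+ 2)).
  have -> : expR (- K) * w x t * ((X - x) * ((X - x) ^+ 2 * cabs B ^+ 2 * la)) =
    (X - x) * (expR (- K) * w x t * ((X - x) ^+ 2 * cabs B ^+ 2 * la)) by ring.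
  apply: ler_wpM2l => //; apply: ler_pM => //.
  - by rewrite mulr_ge0 ?expR_ge0// ltW.
  - by apply: mulr_ge0 (ltW la0); apply: mulr_ge0; exact: sqr_ge0.
  have -> : phixx mu x t + q * Wxx + (phitt mu x t + q * Wtt) = philap mu x t + q * (Wxx + Wtt).
    by rewrite -pl; ring.
  rewrite lapN -addrA -addrA; apply: (le_trans lapB); rewrite lerDl.
  apply: addr_ge0; first by rewrite mulr_ge0 ?(ltW q0)// mulr_ge0// mulr_ge0.
  by apply: addr_ge0; exact: sqr_ge0.
have s2 : w x t * (c1 / 4 * ((X - x) * N) - c5 * ((X - x) ^+ 3 * cabs B ^+ 2)) <= w x t * fd.
  by rewrite ler_pM2l.
have {}s2 := ler_wpM2l (ltW alpha0) s2; have {}s3 := ler_wpM2l (ltW beta0) s3.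
have e2 : alpha * (w x t * (c1 / 4 * ((X - x) * N) - c5 * ((X - x) ^+ 3 * cabs B ^+ 2))) =
   8 * q * (w x t * ((X - x) * N)) - alpha * c5 * (w x t * ((X - x) ^+ 3 * cabs B ^+ 2)).
  by rewrite /alpha; field; rewrite gt_eqF.
have e3 : beta * (expR (- K) * w x t * ((X - x) * ((X - x) ^+ 2 * cabs B ^+ 2 * la))) =
   alpha * c5 * (w x t * ((X - x) ^+ 3 * cabs B ^+ 2)).
  by rewrite /beta expRN; field; rewrite !gt_eqF// expR_gt0.
rewrite e2 in s2; rewrite e3 in s3.
move: s1 s2 s3; rewrite !mulNr.
move: (8 * q * _) (alpha * c5 * _) (alpha * (w x t * fd)) (beta * _) (_ * (w x t * (q * Wxx + _ + _ + _))).
by move=> v1 v2 v3 v4 v5; lra.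
Qed.

End point.

Let cossin_2pi : cos (2 * pi) = cos 0 :> R /\ sin (2 * pi) = sin 0 :> R.
Proof. by rewrite cos0 sin0 mulr_natl cos2pi sin2pi. Qed.

Lemma phi_periodic x : phi mu x (2 * pi) = phi mu x 0 /\ phit mu x (2 * pi) = phit mu x 0.
Proof.
have [ec es] := cossin_2pi.
by split; congr (- _); apply: eq_Rintegral => z _;
  rewrite /ker /kert /kerI /kerD /kerP /kerQ ec es.
Qed.

Let lfield X x t := (X - x) * (w x t * (q * logWx a b c e 1 x t)) + w x t
     + - alpha * (w x t * Vx a b c e X x t)
     + - beta * ((X - x) * (u x t * (phix mu x t + q * logWx a b c e 1 x t)) + u x t).

Let kfield X x t := (X - x) * (w x t * (q * logWt a b c e 1 x t))
     + - alpha * (w x t * Vt a b c e X x t)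
     + - beta * ((X - x) * (u x t * (phit mu x t + q * logWt a b c e 1 x t))).

Let kfield_periodic X x : kfield X x (2 * pi) = kfield X x 0.
Proof.
have [ea eb] := fre_fim_periodic f x; have [ec ee] := fre_fim_periodic (zderiv f) x.
have [e1 e2] := phi_periodic x.
by rewrite /kfield /w /u /wf /Vt /Tf /Nf /kap /logWt /logW /lmod /a /b /c /e ea eb ec ee e1 e2.
Qed.

(** The coordinate of the fixed inner circle: for [xs <= x <= X < 0] the
    smallness condition of [main_field] holds. *)
Let xs := - (c1 / (4 * k)).

Let xs_lt0 : xs < 0.
Proof. by rewrite oppr_lt0 divr_gt0// mulr_gt0. Qed.

Let xs_ge : - 1 <= xs.
Proof.
rewrite lerN2 ler_pdivrMr ?mulr_gt0// mul1r.
have : c1 <= 1.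
  have M0 : 0 < M by exact: lt_le_trans ltr01 M1.
  by rewrite invf_le1 ?exprn_gt0// expr_ge1// ltW.
by move: M1; rewrite /k; lra.
Qed.

Let lfield_xs X : xs <= X -> X < 0 ->
  cint 0 (2 * pi) (lfield X X) <= cint 0 (2 * pi) (lfield X xs).
Proof.
move=> xX X0; apply: (@flux_periodic_le _ (lfield X) (kfield X)) => //.
move=> x t /andP[h1 h2]; apply: main_field => //.
have -> : c1 / 4 = k * - xs by rewrite /xs; field; rewrite gt_eqF.
by rewrite ler_pM2l//; move: h1 X0; lra.
Qed.

Let gw x t : x < 0 -> has_grad w x t (w x t * (q * logWx a b c e 1 x t)) (w x t * (q * logWt a b c e 1 x t)).
Proof.
move=> x0; have [ha hb] := has_grad_solution t af x0.
exact: has_grad_comp (has_gradZ q (has_grad_logW ha hb (@ltr01 R))) (is_derive_expR _).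
Qed.

Let gu x t : x < 0 -> exists ux ut, has_grad u x t ux ut.
Proof.
move=> x0; have [ha hb] := has_grad_solution t af x0.
have h := has_gradD (has_grad_phi mufin t x0) (has_gradZ q (has_grad_logW ha hb (@ltr01 R))).
by do 2 eexists; exact: has_grad_comp h (is_derive_expR _).
Qed.

Let gWx x t : x < 0 -> exists ux ut, has_grad (logWx a b c e 1) x t ux ut.
Proof.
move=> x0; have [ha hb] := has_grad_solution t af x0.
have [hc he] := has_grad_zderiv t sol x0.
have [Wxt hWx] := has_grad_logWx ha hb hc he (@ltr01 R).
by do 2 eexists; exact: hWx.
Qed.

(** A bound for [lfield X xs] that does not involve [X], by
    [|v| <= 1 + v^2]. *)
Let hs t := w xs t * (1 + (q * logWx a b c e 1 xs t) * (q * logWx a b c e 1 xs t)) + w xs t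
  + alpha * (w xs t * (3 / 2 * C + C * (1 + logWx a b c e 1 xs t * logWx a b c e 1 xs t)))
  + beta * (u xs t * (1 + (phix mu xs t + q * logWx a b c e 1 xs t) *
        (phix mu xs t + q * logWx a b c e 1 xs t))).

Let lfield_le X t : xs <= X -> X < 0 -> lfield X xs t <= hs t.
Proof.
move=> xX X0; rewrite /lfield /hs.
have w0 : 0 < w xs t by exact: expR_gt0.
have u0 : 0 < u xs t by exact: expR_gt0.
have y0 : 0 <= X - xs by rewrite subr_ge0.
have y1 : X - xs <= 1 by move: xs_ge X0; lra.
have TC := Tf_le t xX X0; have T0 := Tf_ge0 a b c e X xs t.
have [/andP[g0 gT] /andP[E0 ET] _ _] := field_functions_bounds T0.
have y01 : 0 <= X - xs <= 1 by rewrite y0 y1.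
have /andP[_ h1] := damped_le (q * logWx a b c e 1 xs t) y01 w0.
have /andP[h3 _] := damped_le (phix mu xs t + q * logWx a b c e 1 xs t) y01 u0.
have h2 : - Vx a b c e X xs t <= 3 / 2 * C + C * (1 + logWx a b c e 1 xs t * logWx a b c e 1 xs t).
  rewrite /Vx; set L := logWx _ _ _ _ _ _ _; set g := gfun _ in g0 gT *; set E := efun _ in E0 ET *.
  have s1 : - (1 + L * L) <= L / 2.
    by have /andP[] := le_sq1 L; have : 0 <= L * L by [rewrite -expr2 sqr_ge0|]; lra.
  have L0 : 0 <= 1 + L * L by rewrite addr_ge0// -expr2 sqr_ge0.
  have g1 : (X - xs) * g <= C.
    by apply: le_trans (le_trans gT TC); rewrite ler_piMl.
  have := ler_wpM2l (mulr_ge0 y0 g0) s1; have := ler_wpM2r L0 g1.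
  by rewrite mulrN; move: ET TC; lra.
have {}h2 := ler_wpM2l (mulr_ge0 (ltW alpha0) (ltW w0)) h2.
have {}h3 := ler_wpM2l (ltW beta0) h3.
have h4 : 0 <= beta * u xs t by rewrite mulr_ge0 ?ltW.
move: h1 h2 h3 h4; move: (w xs t) (u xs t) (Vx _ _ _ _ _ _ _) (logWx _ _ _ _ _ _ _) (phix _ _ _) (X - xs).
move=> v1 v2 v3 v4 v5 v6; lra.
Qed.

(** On the circle [X] the field is [w - beta u], at least [w / 2] since
    [phi <= 0]; the flux through the inner circle is bounded independently
    of [X]. *)
Lemma circle_bound : exists x1 Q : R, x1 < 0 /\
  forall X, x1 <= X -> X < 0 -> cint 0 (2 * pi) (w X) <= Q.
Proof.
exists xs, (2 * cint 0 (2 * pi) hs); split=> // X xX X0.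
have pi20 : (0 : R) <= 2 * pi by rewrite mulr_ge0// pi_ge0.
have cw : ccont 0 (2 * pi) (w X).
  by apply: ccontP => t _; exact: has_grad_continuoust (gw t X0).
have cu : ccont 0 (2 * pi) (u X).
  by apply: ccontP => t _; have [ux [ut h]] := gu t X0; exact: has_grad_continuoust h.
have lX : lfield X X = (fun t => w X t - beta * u X t).
  apply/funext => t; rewrite /lfield /Vx /Tf !subrr !mul0r /efun !mul0r oppr0 !add0r.
  by rewrite !mulr0 addr0 mulNr.
have uw1 t : u X t <= w X t.
  rewrite /u expRD -/(wf a b q X t) -/(w X t); apply: ler_piMl; first exact: expR_ge0.
  by rewrite -expR0 ler_expR; have /andP[] := phiK t X0.
have cl : ccont 0 (2 * pi) (lfield X X).
  rewrite lX; apply: ccontP => t _; have [ux [ut h]] := gu t X0.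
  exact: has_grad_continuoust (has_gradB (gw t X0) (has_gradZ beta h)).
have ch : ccont 0 (2 * pi) hs.
  apply: ccontP => t _; have [ux [ut h1]] := gu t xs_lt0; have [vx [vt h2]] := gWx t xs_lt0.
  have h3 := gw t xs_lt0; have h4 := has_grad_phix mufin t xs_lt0.
  have k1 (v : R -> R -> R) vx' vt' : has_grad v xs t vx' vt' -> exists ux ut, has_grad (fun x t => 1 + v x t * v x t) xs t ux ut.
    by move=> h; do 2 eexists; exact: has_gradD (has_grad_cst 1 xs t) (has_gradM h h).
  have [? [? k2]] := k1 _ _ _ (has_gradZ q h2).
  have [? [? k3]] := k1 _ _ _ h2.
  have [? [? k4]] := k1 _ _ _ (has_gradD h4 (has_gradZ q h2)).
  exact: has_grad_continuoust (has_gradD (has_gradD (has_gradD (has_gradM h3 k2) h3)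
    (has_gradZ alpha (has_gradM h3 (has_gradD (has_grad_cst (3 / 2 * C) xs t) (has_gradZ C k3)))))
    (has_gradZ beta (has_gradM h1 k4))).
have cx : ccont 0 (2 * pi) (lfield X xs).
  apply: ccontP => t _.
  have yk : k * (X - xs) <= c1 / 4.
    have -> : c1 / 4 = k * - xs by rewrite /xs; field; rewrite gt_eqF.
    by rewrite ler_pM2l//; move: X0; lra.
  have [D [lx [lt [kx [kt [h _ _]]]]] _] := main_field t xX X0 yk.
  exact: has_grad_continuoust h.
have e1 : cint 0 (2 * pi) (w X) <= 2 * cint 0 (2 * pi) (lfield X X).
  rewrite -cintZ//; apply: cint_le => //.
    by apply: ccontP => t _; rewrite lX; have [ux [ut h]] := gu t X0;
      exact: has_grad_continuoust (has_gradZ 2 (has_gradB (gw t X0) (has_gradZ beta h))).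
  move=> t _; rewrite lX.
  have : beta * u X t <= 1 / 2 * w X t.
    by apply: ler_pM => //; [exact: ltW|exact: expR_ge0].
  lra.
apply: (le_trans e1); rewrite ler_pM2l//; apply: le_trans (lfield_xs xX X0) _.
by apply: cint_le => // t _; exact: lfield_le.
Qed.

End weighted_flux.

End solution.

(** * Monotone circle means *)

Section monotone_means.
Context {R : realType}.
Variables (f A : R[i]^o -> R[i]^o).
Hypothesis sol : ode_solution A f.

Let af : analytic_disc f. Proof. by case: sol. Qed.

Let a := fre f.
Let b := fim f.
Let c := fre (zderiv f).
Let e := fim (zderiv f).

(** Both fractions [v] of [eps + s], namely [s / (eps + s)] and
    [eps / (eps + s)], satisfy [v <= v^q], since [v <= 1]. *)
Lemma powR_subadditive (s eps q : R) : 0 <= s -> 0 < eps -> 0 < q -> q <= 1 ->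
  (eps + s) `^ q <= s `^ q + eps `^ q.
Proof.
move=> s0 e0 q0 q1; have S0 : 0 < eps + s by rewrite ltr_pwDl.
have [->|sn] := eqVneq s 0; first by rewrite addr0 lerDr powR_ge0.
have sp : 0 < s by rewrite lt_neqAle eq_sym sn.
have frac (v : R) : 0 < v -> v <= eps + s -> v / (eps + s) * (eps + s) `^ q <= v `^ q.
  move=> v0 vS; have vv : 0 < v / (eps + s) <= 1 by rewrite divr_gt0// ler_pdivrMr// mul1r.
  have h := ger1_powR vv q1.
  apply: le_trans (ler_wpM2r (powR_ge0 _ _) h) _.
  by rewrite -powRM ?divr_ge0 ?(ltW v0) ?(ltW S0)// divfK// gt_eqF.
have h1 : s / (eps + s) * (eps + s) `^ q <= s `^ q.
  by apply: frac => //; rewrite lerDr ltW.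
have h2 : eps / (eps + s) * (eps + s) `^ q <= eps `^ q.
  by apply: frac => //; rewrite lerDl.
apply: le_trans (lerD h1 h2); rewrite -mulrDl -mulrDl [s + eps]addrC divff ?mul1r//.
by rewrite gt_eqF.
Qed.

Let too_big (B v v' m : R) : v' <= B -> v + m <= v' -> 1 + `|B| <= m -> 0 <= v -> False.
Proof. by have := ler_norm B; lra. Qed.

Section regularized.
Variables (q eps : R).
Hypotheses (q0 : 0 < q) (eps0 : 0 < eps).

Let u x t := expR (q * logW a b eps x t).
Let ux x t := u x t * (q * logWx a b c e eps x t).
Let U x := cint 0 (2 * pi) (u x).
Let V x := cint 0 (2 * pi) (ux x).

Let uweight (X x t : R) : x < 0 -> exists2 D,
  has_div (fun x t => (X - x) * (u x t * (q * logWx a b c e eps x t)) + u x t)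
    (fun x t => (X - x) * (u x t * (q * logWt a b c e eps x t))) x t ((X - x) * D) & 0 <= D.
Proof.
move=> x0; have [ha hb] := has_grad_solution t af x0.
have [hc he] := has_grad_zderiv t sol x0.
have hW := has_grad_logW ha hb eps0.
have [Wxt hWx] := has_grad_logWx ha hb hc he eps0.
have [Wtx hWt] := has_grad_logWt ha hb hc he eps0.
eexists; first exact: (@has_div_exp_weight _ (fun x t => q * logW a b eps x t)
  (fun x t => q * logWx a b c e eps x t) (fun x t => q * logWt a b c e eps x t) x t _ _ _ _
  (has_gradZ q hW) (has_gradZ q hWx) (has_gradZ q hWt) X).
rewrite -mulrDr logW_laplacian//.
have l0 := lmod_gt0 a b eps0 x t.
apply: mulr_ge0; first exact: expR_ge0.
apply: addr_ge0; last exact: sqr_ge0.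
apply: addr_ge0; last exact: sqr_ge0.
apply: mulr_ge0; first exact: ltW.
apply: mulr_ge0; last exact: sqr_ge0.
apply: mulr_ge0; last by rewrite addr_ge0// sqr_ge0.
by rewrite mulr_ge0// ltW.
Qed.

Let uper X x : (X - x) * (u x (2 * pi) * (q * logWt a b c e eps x (2 * pi))) =
  (X - x) * (u x 0 * (q * logWt a b c e eps x 0)).
Proof.
have [ea eb] := fre_fim_periodic f x; have [ec ee] := fre_fim_periodic (zderiv f) x.
by rewrite /u /logWt /logW /lmod /a /b /c /e ea eb ec ee.
Qed.

Let ccontu x : x < 0 -> ccont 0 (2 * pi) (u x).
Proof.
move=> x0; apply: ccontP => t _.
have [ha hb] := has_grad_solution t af x0.
exact: has_grad_continuoust (has_grad_comp (has_gradZ q (has_grad_logW ha hb eps0)) (is_derive_expR _)).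
Qed.

Let ccontux x : x < 0 -> ccont 0 (2 * pi) (ux x).
Proof.
move=> x0; apply: ccontP => t _.
have [ha hb] := has_grad_solution t af x0.
have [hc he] := has_grad_zderiv t sol x0.
have [Wxt hWx] := has_grad_logWx ha hb hc he eps0.
have hu := has_grad_comp (has_gradZ q (has_grad_logW ha hb eps0)) (is_derive_expR _).
exact: has_grad_continuoust (has_gradM hu (has_gradZ q hWx)).
Qed.

Let cint_weight X x : x < 0 -> cint 0 (2 * pi) (fun t => (X - x) * ux x t + u x t) = (X - x) * V x + U x.
Proof.
move=> x0; rewrite cintD ?cintZ//; [exact: ccontux| |exact: ccontu].
apply: ccontP => t _; have [ha hb] := has_grad_solution t af x0.
have [hc he] := has_grad_zderiv t sol x0.
have [Wxt hWx] := has_grad_logWx ha hb hc he eps0.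
have hu := has_grad_comp (has_gradZ q (has_grad_logW ha hb eps0)) (is_derive_expR _).
exact: has_grad_continuoust (has_gradZ (X - x) (has_gradM hu (has_gradZ q hWx))).
Qed.

(** The mean [U] is convex: its tangent lines lie below it. For [X > x] the
    weighted field is integrated from [x] up to [X], for [X < x] from [X] up
    to [x]; the sign of the weight [X - x] changes accordingly. *)
Let tangent x X : x < 0 -> X < 0 -> U x + (X - x) * V x <= U X.
Proof.
move=> x0 X0; rewrite [U x + _]addrC.
have UX : U X = cint 0 (2 * pi) (fun t => (X - X) * ux X t + u X t).
  by rewrite cint_weight// subrr mul0r add0r.
rewrite [leRHS]UX -[leLHS](cint_weight X x0).
have [xX|Xx] := leP x X; last first.
  apply: (@flux_periodic_le _ (fun x t => (X - x) * (u x t * (q * logWx a b c e eps x t)) + u x t)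
    (fun x t => (X - x) * (u x t * (q * logWt a b c e eps x t))) X x (ltW Xx) (uper X)) => y t /andP[y1 y2].
  have [D hD D0] := uweight X t (le_lt_trans y2 x0).
  by eexists; first exact: hD; rewrite mulr_le0_ge0// subr_le0.
have h := @flux_periodic_le _
  (fun x t => -1 * ((X - x) * (u x t * (q * logWx a b c e eps x t)) + u x t))
  (fun x t => -1 * ((X - x) * (u x t * (q * logWt a b c e eps x t)))) x X xX.
have ccw y : y < 0 -> ccont 0 (2 * pi) (fun t => (X - y) * ux y t + u y t).
  move=> y0; apply: ccontP => t _.
  by have [D [lx [lt [kx [kt [hl _ _]]]]] _] := uweight X t y0; exact: has_grad_continuoust hl.
have E y : y < 0 -> cint 0 (2 * pi) (fun t => -1 * ((X - y) * (u y t * (q * logWx a b c e eps y t)) + u y t)) =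
    - cint 0 (2 * pi) (fun t => (X - y) * ux y t + u y t).
  by move=> y0; apply: etrans (cintZ (-1) (ccw y y0)) _; rewrite mulN1r.
apply: (le_opp_eq (E _ x0) (E _ X0)); apply: h => [y|y t /andP[y1 y2]].
  by congr (-1 * _); exact: uper.
have [D hD D0] := uweight X t (le_lt_trans y2 X0).
eexists; first exact: has_divZ hD.
by rewrite mulN1r oppr_le0 mulr_ge0// subr_ge0.
Qed.

Let U_bounded_near0 : exists x1 B, forall x, x < x1 -> x < 0 -> U x <= B.
Proof.
have z0 : unit_disc R 0 by rewrite /unit_disc /mkset cabs0.
have [d d0 H] := derivable_close (af z0) (@ltr01 R).
pose S := eps + (1 + cabs (f 0)) ^+ 2.
exists (ln d), (expR (q * ln S) * (2 * pi - 0)) => x xd x0.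
have pi20 : (0 : R) <= 2 * pi by rewrite mulr_ge0// pi_ge0.
rewrite -cint_cst//; apply: cint_le; [exact: ccontu|exact: ccont_cst|move=> t _].
rewrite ler_expR ler_pM2l// ler_ln ?posrE; last 2 first.
- exact: lmod_gt0.
- by rewrite ltr_wpDr ?sqr_ge0.
rewrite /lmod -!expr2 -cabs_sq lerD2l.
apply: lerXn2r; rewrite ?nnegrE ?cabs_ge0 ?addr_ge0 ?cabs_ge0//.
have hd : cabs (cexp x t) < d by rewrite cabs_cexp -[d]lnK ?posrE// ltr_expR.
have := H _ hd; rewrite add0r => h1.
by rewrite -[f (cexp x t)](subrK (f 0)); apply: le_trans (cabsD _ _) _; rewrite lerD2r.
Qed.

(** A convex function of [x] that is bounded near minus infinity is
    nondecreasing; the bound is the continuity of [f] at the origin. *)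
Let V_ge0 x : x < 0 -> 0 <= V x.
Proof.
move=> x0; rewrite leNgt; apply/negP => V0.
have [x1 [B hB]] := U_bounded_near0.
have U0 : 0 <= U x by apply: Rintegral_ge0 => t _; exact: expR_ge0.
pose B1 := 1 + `|B|.
have B10 : 0 < B1 by rewrite ltr_wpDr.
pose X := Num.min (x1 - 1) (x + B1 / V x).
have X1 : X < x1 by rewrite gt_min; apply/orP; left; lra.
have X2 : X <= x + B1 / V x by rewrite ge_min lexx orbT.
have BV : B1 / V x < 0 by rewrite pmulr_rlt0// invr_lt0.
have X0 : X < 0 by apply: le_lt_trans X2 _; lra.
have big : B1 <= (X - x) * V x.
  have -> : B1 = B1 / V x * V x by rewrite divfK// lt_eqF.
  by rewrite ler_nM2r//; lra.
exact: (too_big (hB X X1 X0) (tangent x0 X0) big U0).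
Qed.

Lemma regularized_mean_monotone x X : x <= X -> X < 0 -> U x <= U X.
Proof.
move=> xX X0; have x0 : x < 0 by exact: le_lt_trans X0.
apply: le_trans (tangent x0 X0); rewrite lerDl mulr_ge0 ?V_ge0//.
by rewrite subr_ge0.
Qed.

End regularized.

Lemma cabs_powR_regularized (p eps x t : R) : 0 < eps ->
  expR (p / 2 * logW a b eps x t) = (eps + cabs (f (cexp x t)) ^+ 2) `^ (p / 2) /\
  cabs (f (cexp x t)) `^ p = (cabs (f (cexp x t)) ^+ 2) `^ (p / 2).
Proof.
move=> e0; split.
  rewrite /logW; have -> : lmod a b eps x t = eps + cabs (f (cexp x t)) ^+ 2.
    by rewrite /lmod cabs_sq !expr2.
  rewrite /powR gt_eqF//; apply: ltr_wpDr => //; exact: sqr_ge0.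
by rewrite -powR_sq ?cabs_ge0// -powRrM; congr (_ `^ _); field.
Qed.

Lemma circle_cexp (r t : R) : 0 < r -> r%:C * cexpi t = cexp (ln r) t.
Proof. by move=> r0; rewrite /cexp lnK. Qed.

Lemma ccont_regularized (p eps x : R) : 0 < eps -> x < 0 ->
  ccont 0 (2 * pi) (fun t => expR (p * logW a b eps x t)).
Proof.
move=> e0 x0; apply: ccontP => t _.
have [ha hb] := has_grad_solution t af x0.
exact: has_grad_continuoust (has_grad_comp (has_gradZ p (has_grad_logW ha hb e0)) (is_derive_expR _)).
Qed.

Lemma pmean_le_regularized (p eps r : R) : 0 < p -> 0 < eps -> 0 < r < 1 ->
  pmean p f r <= cint 0 (2 * pi) (fun t => expR (p / 2 * logW a b eps (ln r) t)).
Proof.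
move=> p0 e0 r01; have /andP[r0 r1] := r01.
have x0 : ln r < 0 by apply: ln_lt0.
apply: cint_le; [exact: pmean_ccont|exact: ccont_regularized|move=> t _].
rewrite circle_cexp//; have [-> ->] := cabs_powR_regularized p (ln r) t e0.
have s0 := sqr_ge0 (cabs (f (cexp (ln r) t))).
apply: ge0_ler_powR; rewrite ?nnegrE//.
- by rewrite divr_ge0// ltW.
- by rewrite addr_ge0// ltW.
- by rewrite lerDr ltW.
Qed.

(** [(eps + |f|^2)^(p/2)] replaces [|f|^p], which is not differentiable at
    the zeros of [f], and differs from it by at most [eps^(p/2)]. *)
Lemma pmean_monotone (p r1 r2 : R) : 0 < p -> p <= 2 -> 0 < r1 -> r1 <= r2 -> r2 < 1 ->
  pmean p f r1 <= pmean p f r2.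
Proof.
move=> p0 p2 r10 r12 r21.
have r20 : 0 < r2 by exact: lt_le_trans r12.
have r11 : r1 < 1 by exact: le_lt_trans r21.
have r101 : 0 < r1 < 1 by rewrite r10.
have r201 : 0 < r2 < 1 by rewrite r20.
have pi20 : (0 : R) < 2 * pi by rewrite mulr_gt0// pi_gt0.
have x0 : ln r2 < 0 by apply: ln_lt0.
have q0 : 0 < p / 2 by rewrite divr_gt0.
have q1 : p / 2 <= 1 by rewrite ler_pdivrMr// mul1r.
apply/ler_addgt0Pr => d d0.
pose h := d / (2 * pi).
have h0 : 0 < h by rewrite divr_gt0.
pose eps := h `^ (p / 2)^-1.
have e0 : 0 < eps by rewrite powR_gt0.
have eE : eps `^ (p / 2) = h by rewrite -powRrM mulVf ?gt_eqF// powRr1// ltW.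
apply: le_trans (pmean_le_regularized p0 e0 r101) _.
have l12 : ln r1 <= ln r2 by rewrite ler_ln.
apply: le_trans (regularized_mean_monotone q0 e0 l12 x0) _.
have -> : d = cint 0 (2 * pi) (fun _ => h).
  by rewrite cint_cst ?ltW// subr0 /h divfK// gt_eqF.
rewrite -cintD; [|exact: pmean_ccont|exact: ccont_cst].
have cp : ccont 0 (2 * pi) (fun t => cabs (f (r2%:C * cexpi t)) `^ p + h).
  have hp : ccont 0 (2 * pi) (fun t => cabs (f (r2%:C * cexpi t)) `^ p) by exact: pmean_ccont.
  by move=> x; apply: cvgD; [exact: hp|exact: cvg_cst].
apply: cint_le; [exact: ccont_regularized|exact: cp|move=> t _].
rewrite circle_cexp//; have [-> ->] := cabs_powR_regularized p (ln r2) t e0.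
by rewrite -eE; apply: powR_subadditive => //; exact: sqr_ge0.
Qed.

End monotone_means.

(** * Assembling the estimates *)

Section assembly.
Context {R : realType}.

Lemma polar (z : R[i]) : z != 0 -> exists t : R, z = cexp (ln (cabs z)) t.
Proof.
move=> z0; have m0 : 0 < cabs z by rewrite cabs_gt0.
set m := cabs z in m0 *.
pose u := Re z / m; pose v := Im z / m.
have uv : u ^+ 2 + v ^+ 2 = 1.
  by rewrite /u /v !expr_div_n -mulrDl -cabs_sq divff// sqrf_eq0 gt_eqF.
have u1 : - 1 <= u <= 1.
  rewrite -ler_norml -(@ler_sqr _ `|u|) ?nnegrE// real_normK ?num_real//.
  by rewrite expr1n -uv lerDl sqr_ge0.
have su : sin (acos u) = `|v|.
  by rewrite sin_acos// -uv addrC addKr sqrtr_sqr.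
have reE : Re z = m * u by rewrite /u mulrC divfK// gt_eqF.
have imE : Im z = m * v by rewrite /v mulrC divfK// gt_eqF.
have ceq t : cos t = u -> sin t = v -> z = cexp (ln m) t.
  move=> ct st; apply/eqP; rewrite eq_complex; apply/andP; split; apply/eqP.
    by rewrite Re_cexp lnK// ct.
  by rewrite Im_cexp lnK// st.
have [v0|v0] := leP 0 v.
  by exists (acos u); apply: ceq; rewrite ?acosK// su ger0_norm.
by exists (- acos u); apply: ceq; rewrite ?cosN ?acosK// sinN su ltr0_norm// opprK.
Qed.

(** At [a = 0] the integrand of the hypothesis is [1]. *)
Lemma carleson_finite (mu : {measure set (plane R) -> \bar R}) (C : R) :
  (forall a : R[i], cabs a < 1 ->
    (\int[mu]_(w in plane_disc R) (cabs (1 - conjc a * cpx w)^-1 ^+ 2)%:E <=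
      (C / (1 - cabs a ^+ 2))%:E)%E) ->
  (mu (plane_disc R) < +oo)%E.
Proof.
move=> hC; have := hC 0; rewrite cabs0 => /(_ ltr01).
rewrite (_ : (\int[mu]_(w in plane_disc R) _)%E = (\int[mu]_(w in plane_disc R) 1%:E)%E); last first.
  by apply: eq_integral => w _; rewrite conjc0 mul0r subr0 invr1 cabs1 expr1n.
rewrite integral_cst; last exact: measurable_plane_disc.
by rewrite mul1e => /le_lt_trans; apply; exact: ltry.
Qed.

(** The two bounds of the Laplacian of the potential, divided by [rho x],
    bound [|A|^2 (1 - |z|)^4]. The origin is not of the form [cexp x t] and
    is reached by continuity. *)
Lemma coefficient_bound (mu : {measure set (plane R) -> \bar R}) (A : R[i] -> R[i]) (C la : R) :
  analytic_disc A -> 0 < la ->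
  (forall x t, x < 0 ->
     rho x * (1 - expR x) ^+ 2 * cabs (A (cexp x t)) ^+ 2 * la <= philap mu x t) ->
  (forall x t, x < 0 -> philap mu x t <= 8 * C * rho x / (1 - expR x) ^+ 2) ->
  exists2 K, 0 <= K & forall z, cabs z < 1 -> cabs (A z) * (1 - cabs z) ^+ 2 <= K.
Proof.
move=> hA la0 lo up; pose m := 8 * C / la.
have hx x t : x < 0 -> cabs (A (cexp x t)) * (1 - expR x) ^+ 2 <= 1 + `|m|.
  move=> x0; have d0 : 0 < 1 - expR x by rewrite subr_gt0 expR_lt1.
  have r0 : 0 < rho x by rewrite exprn_gt0// expR_gt0.
  have h := le_trans (lo x t x0) (up x t x0).
  rewrite ler_pdivlMr ?exprn_gt0// in h.
  set v := _ * _; have hv : v ^+ 2 * la <= 8 * C.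
    rewrite -(ler_pM2l r0); apply: le_trans (le_trans _ h) _.
      by apply: eq_le_refl; rewrite /v; ring.
    by apply: eq_le_refl; ring.
  have vm : v ^+ 2 <= m by rewrite /m ler_pdivlMr.
  have := ler_norm m; have := sqr_ge0 (v - 1); have := sqr_ge0 v.
  rewrite sqrrB expr1n mulr1 => h1 h2 h3; lra.
have K0 : 0 <= 1 + `|m| by rewrite addr_ge0.
have hz z : z != 0 -> cabs z < 1 -> cabs (A z) * (1 - cabs z) ^+ 2 <= 1 + `|m|.
  move=> z0 z1; have [t zE] := polar z0; have m0 : 0 < cabs z by rewrite cabs_gt0.
  have l0 : ln (cabs z) < 0 by apply: ln_lt0; rewrite m0.
  by have := hx _ t l0; rewrite -zE lnK.
have u0 : unit_disc R 0 by rewrite /unit_disc /mkset cabs0.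
have [d d0 H] := derivable_close (hA 0 u0) (@ltr01 R).
pose s := Num.min (d / 2) (1 / 2).
have s0 : 0 < s by rewrite lt_min !divr_gt0.
have sd : s < d by rewrite gt_min; apply/orP; left; lra.
have s2 : s <= 1 / 2 by rewrite ge_min lexx orbT.
have cs : cabs (s%:C) = s by rewrite cabs_real gtr0_norm.
have sn : s%:C != 0 by rewrite -cabs_gt0 cs.
exists (1 + 4 * (1 + `|m|)); first by move: K0; lra.
move=> z z1; have [->|z0] := eqVneq z 0; last first.
  by apply: le_trans (hz z z0 z1) _; move: K0; lra.
rewrite cabs0 subr0 expr1n mulr1.
have h1 : cabs (A s%:C) * (1 - s) ^+ 2 <= 1 + `|m| by rewrite -[X in 1 - X]cs; apply: hz => //; rewrite cs; lra.
have := H s%:C; rewrite cs add0r => /(_ sd) h2.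
have h3 : cabs (A 0) <= cabs (A s%:C) + 1.
  have := cabsD (A s%:C - (A s%:C - A 0)) (A s%:C - A 0).
  have := cabsD (A s%:C) (- (A s%:C - A 0)).
  rewrite cabsN (_ : A s%:C - (A s%:C - A 0) = A 0); last by ring.
  by move=> h _; move: h h2; lra.
have h4 : (1 / 2) ^+ 2 <= (1 - s) ^+ 2 by apply: lerXn2r; rewrite ?nnegrE; lra.
have := ler_wpM2l (cabs_ge0 (A s%:C)) h4; lra.
Qed.

Lemma normal_function_bound (f : R[i] -> R[i]) : normal_function f ->
  exists2 sigma, 0 <= sigma & forall z, cabs z < 1 ->
    (1 - cabs z) * cabs (derive1 (f : R[i]^o -> R[i]^o) z) <= sigma * (1 + cabs (f z) ^+ 2).
Proof.
rewrite /normal_function /normal_sup; set S := [set _ | _ in _] => hS.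
have ub z : cabs z < 1 -> (((1 - cabs z ^+ 2) * (cabs (derive1 (f : R[i]^o -> R[i]^o) z)
    / (1 + cabs (f z) ^+ 2)))%:E <= ereal_sup S)%E.
  by move=> z1; apply: ereal_sup_ubound; exists z.
case: (ereal_sup S) hS ub => [r _ ub|//|_ ub]; last first.
  by have := ub 0; rewrite cabs0 => /(_ ltr01); rewrite leeNy_eq.
exists `|r| => // z z1; have := ub z z1; rewrite lee_fin.
have n0 : 0 < 1 + cabs (f z) ^+ 2 by apply: ltr_wpDr => //; exact: sqr_ge0.
rewrite mulrA ler_pdivrMr// => h.
have c0 := cabs_ge0 z; have c1 := cabs_ge0 (derive1 (f : R[i]^o -> R[i]^o) z).
apply: (@le_trans _ _ (r * (1 + cabs (f z) ^+ 2))).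
  apply: le_trans h; apply: ler_wpM2r => //.
  by rewrite lerB// expr2 ler_piMl// ltW.
by apply: ler_wpM2r; [exact: ltW|exact: ler_norm].
Qed.

(** The conditions of [circle_bound] are all linear in [q]. *)
Lemma small_exponent (C K la : R) : 0 <= C -> 0 < la -> exists2 q0 : R, 0 < q0 &
  forall q, 0 < q -> q < q0 -> [/\ q <= 1, 3 * (1 + C) * q <= (1 + C) ^- 3 / 4 &
    expR K * (32 * q / (1 + C) ^- 3) * ((3 + 2 * (1 + C)) ^+ 2 / (1 + C) ^- 3) / la <= 1 / 2].
Proof.
move=> C0 la0; have M0 : 0 < 1 + C by lra.
set c1 := (1 + C) ^- 3; have c10 : 0 < c1 by rewrite invr_gt0 exprn_gt0.
set k2 := (3 + 2 * (1 + C)) ^+ 2; have k20 : 0 < k2 by apply: exprn_gt0; lra.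
pose D := expR K * 32 / c1 * (k2 / c1) / la.
have D0 : 0 < D.
  apply: divr_gt0 => //; apply: mulr_gt0; last exact: divr_gt0.
  by apply: divr_gt0 => //; rewrite mulr_gt0// expR_gt0.
exists (Num.min (Num.min 1 (c1 / 4 / (3 * (1 + C)))) (1 / 2 / D)).
  rewrite !lt_min ltr01; apply/andP; split; last by rewrite divr_gt0// divr_gt0.
  by apply: divr_gt0; [exact: divr_gt0|exact: mulr_gt0].
move=> q q0; rewrite !lt_min => /andP[/andP[q1 q2] q3]; split; first exact: ltW.
  by rewrite mulrC -ler_pdivlMr ?mulr_gt0// ltW.
have -> : expR K * (32 * q / c1) * (k2 / c1) / la = q * D by rewrite /D; ring.
by rewrite -ler_pdivlMr// ltW.
Qed.

End assembly.

Theorem corollary9 (R : realType) (A : R[i] -> R[i])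
    (mu : {measure set (plane R) -> \bar R})
    (hA : analytic_disc A)
    (hmu : has_disc_density mu
             (fun z : R[i] => cabs (A z) ^+ 2 * (1 - cabs z ^+ 2) ^+ 3))
    (hcarleson : carleson mu) :
  forall f : R[i] -> R[i], ode_solution A f -> normal_function f ->
    exists2 p0 : R, 0 < p0 & forall p : R, 0 < p -> p < p0 -> hardy p f.
Proof.
move=> f sol nf; have [af af' ode] := sol.
have [C C0 hC] := carleson_kernel hcarleson.
have mufin := carleson_finite hC.
have [la la0 lapA] : exists2 la : R, 0 < la & forall x t, x < 0 ->
    rho x * (1 - expR x) ^+ 2 * cabs (A (cexp x t)) ^+ 2 * la <= philap mu x t.
  by exists (1296^-1); [rewrite invr_gt0 ltr0n|move=> x t; exact: philap_ge].
have [K K0 hK] := coefficient_bound hA la0 lapA (fun x t => philap_le mufin C0 hC t).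
have [sigma s0 hs] := normal_function_bound nf.
have growth := derive_growth af af' ode K0 hK s0 hs.
set L := (_ ^+ 2) in growth; have L0 : 0 <= L by exact: sqr_ge0.
have [q0 q00 small] := small_exponent C L0 la0.
exists (2 * q0) => [|p p0 pq]; first by rewrite mulr_gt0.
have p20 : 0 < p / 2 by rewrite divr_gt0.
have p2q : p / 2 < q0 by rewrite ltr_pdivrMr// mulrC.
have [q1 qM beta2] := small _ p20 p2q.
have [x1 [Q [x10 bd]]] := circle_bound sol L0 growth la0 mufin
  (fun x t => phi_bounds mufin hC t) lapA p20 q1 qM beta2.
have p2 : p <= 2 by move: q1; rewrite ler_pdivrMr// mul1r.
have mono r1 r2 : 0 < r1 -> r1 <= r2 -> r2 < 1 -> pmean p f r1 <= pmean p f r2.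
  by move=> h1 h2 h3; exact: (pmean_monotone sol p0 p2 h1 h2 h3).
have bd1 X : x1 <= X -> X < 0 -> pmean p f (expR X) <= Q.
  move=> xX X0; apply: le_trans (bd X xX X0).
  have e01 : 0 < expR X < 1 by rewrite expR_gt0 expR_lt1.
  by have := pmean_le_regularized sol p0 (@ltr01 R) e01; rewrite expRK.
suff [] : hardy p f /\ (hardy_norm p f <= (((2 * pi)^-1 * Q) `^ p^-1)%:E)%E by [].
apply: hardy_monotone => // r /andP[r0 r1].
have e1 : expR x1 < 1 by rewrite expR_lt1.
have [rx|xr] := leP r (expR x1).
  exact: le_trans (mono _ _ r0 rx e1) (bd1 _ (lexx _) x10).
rewrite -[r]lnK ?posrE//; apply: bd1; last by apply: ln_lt0; rewrite r0.
by rewrite -[x1]expRK ler_ln ?posrE ?expR_gt0// ltW.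
Qed.
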